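(* Let $\mathbb{K}$ be an algebraically closed field with $\mathrm{char}(\mathbb{K})\neq2$ and let $C\subset\mathbb{P}^2=\mathbb{P}^2_{\mathbb{K}}$ be a smooth cubic curve. The subgroup of $\mathrm{Ine}(C)$ generated by all the cubic involutions $\sigma_p$ centred at the points $p\in C$ is the free product $\bigstar_{p\in C}\langle\sigma_p\rangle$ of the groups $\langle\sigma_p\rangle$ (each of order $2$).
   Context: $\mathrm{Bir}(\mathbb{P}^2)$ is the group of birational transformations of $\mathbb{P}^2$ over $\mathbb{K}$. For an irreducible curve $C\subset\mathbb{P}^2$, the inertia group is $\mathrm{Ine}(C)=\{g\in\mathrm{Bir}(\mathbb{P}^2)\mid g(C)\subset C,\ g|_C:C\dashrightarrow C\text{ is birational, and } g(p)=p\text{ for a general point }p\in C\}$. For a smooth cubic $C\subset\mathbb{P}^2$ and a point $p\in C$, the cubic involution $\sigma_p\in\mathrm{Ine}(C)$ centred at $p$ is the birational transformation defined as follows: if $D$ is a general line of $\mathbb{P}^2$ passing through $p$, then $\sigma_p(D)=D$ and the restriction of $\sigma_p$ to $D$ is the (non-trivial) involution of $D\cong\mathbb{P}^1$ that fixes the two points of $(D\cap C)\setminus\{p\}$. *)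

(* Defs.v *)
From HB Require Import structures.
From mathcomp Require Import all_boot all_algebra.
From mathcomp Require Import mpoly.

Set Implicit Arguments.
Unset Strict Implicit.
Unset Printing Implicit Defensive.

Import GRing.Theory.
Local Open Scope ring_scope.
Local Open Scope quotient_scope.

(* Homogeneous coordinates of a rational map P^2 --> P^2, once required to be *)
(* nonzero and homogeneous of the same degree (see ratmap).                  *)
Definition triple (K : fieldType) := 3.-tuple {mpoly K[3]}.

Section Triples.
Variable K : fieldType.
Implicit Types (f g h s t : triple K) (d : nat).

Definition nonzero t := [exists i, tnth t i != 0].

(* [x_0 : x_1 : x_2] and [y_0 : y_1 : y_2] agree iff all 2x2 minors vanish. *)
Definition cross s t :=
  [forall i, forall j, tnth s i * tnth t j == tnth s j * tnth t i].

(* The common degree of a homogeneous triple; msize is 1 + degree. *)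
Definition tdeg t := (\max_(i < 3) msize (tnth t i)).-1.

Definition homog_triple t := [forall i, tnth t i \is (tdeg t).-homog].

Definition id_triple : triple K := [tuple 'X_i | i < 3].

Definition comp_triple f g : triple K := [tuple tnth f i \mPo g | i < 3].

(* comp_triple f g may vanish, in which case f \o g is not a rational map. *)
Definition inverts f g :=
  nonzero (comp_triple f g) && cross (comp_triple f g) id_triple.

Lemma nonzeroP t : reflect (exists i, tnth t i != 0) (nonzero t).
Proof. exact: existsP. Qed.

Lemma crossP s t :
  reflect (forall i j, tnth s i * tnth t j = tnth s j * tnth t i) (cross s t).
Proof.
apply: (iffP forallP) => [H i j|H i]; first by apply/eqP/(forallP (H i)).
by apply/forallP => j; apply/eqP.
Qed.

Lemma homog_tripleP t :
  reflect (exists d, forall i, tnth t i \is d.-homog) (homog_triple t).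
Proof.
apply: (iffP forallP) => [H|[d H] i]; first by exists (tdeg t).
have [/nonzeroP[j nzj]|/existsPn Z] := boolP (nonzero t); last first.
  by have /negPn/eqP-> := Z i; apply: dhomog0.
suff -> : tdeg t = d by [].
have sz k : tnth t k != 0 -> msize (tnth t k) = d.+1.
  move=> nz; have /dhomog_msize H1 := H k.
  by have <- := dhomog_uniq nz H1 (H k); rewrite prednK // lt0n mmeasure_poly_eq0.
rewrite /tdeg; suff -> : (\max_(k < 3) msize (tnth t k))%N = d.+1 by [].
apply/eqP; rewrite eqn_leq; apply/andP; split; last first.
  by rewrite -(sz _ nzj); apply: (leq_bigmax j).
apply/bigmax_leqP => k _; have [->|/sz->//] := eqVneq (tnth t k) 0.
by rewrite msize0.
Qed.

Lemma tnth_comp f g i : tnth (comp_triple f g) i = tnth f i \mPo g.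
Proof. by rewrite tnth_mktuple. Qed.

Lemma tnth_id i : tnth id_triple i = 'X_i.
Proof. by rewrite tnth_mktuple. Qed.

Lemma cross_refl t : cross t t.
Proof. by apply/crossP => i j; rewrite mulrC. Qed.

Lemma cross_sym s t : cross s t = cross t s.
Proof.
suff H u v : cross u v -> cross v u by apply/idP/idP; apply: H.
by move/crossP=> H; apply/crossP => i j; rewrite mulrC -H mulrC.
Qed.

Lemma cross_trans s t u : nonzero t -> cross s t -> cross t u -> cross s u.
Proof.
case/nonzeroP=> k nz /crossP st /crossP tu; apply/crossP => i j.
apply: (mulfI nz).
by rewrite mulrCA (tu k j) mulrA (st i j) -mulrA (tu i k) mulrCA.
Qed.

Lemma comp_mpolyA n m k (p : {mpoly K[n]}) (s : n.-tuple {mpoly K[m]})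
    (t : m.-tuple {mpoly K[k]}) :
  (p \mPo s) \mPo t = p \mPo [tuple tnth s i \mPo t | i < n].
Proof.
rewrite [p \mPo s]comp_mpolyE raddf_sum comp_mpolyE /=.
apply: eq_bigr => m' _; rewrite comp_mpolyZ rmorph_prod /=; congr (_ *: _).
by apply: eq_bigr => i _; rewrite rmorphXn tnth_mktuple.
Qed.

Lemma comp_tripleA f g h :
  comp_triple (comp_triple f g) h = comp_triple f (comp_triple g h).
Proof. by apply: eq_from_tnth => i; rewrite !tnth_comp comp_mpolyA. Qed.

Lemma comp_triple_id f : comp_triple f id_triple = f.
Proof. by apply: eq_from_tnth => i; rewrite tnth_comp comp_mpoly_id. Qed.

Lemma comp_id_triple f : comp_triple id_triple f = f.
Proof.
by apply: eq_from_tnth => i; rewrite tnth_comp tnth_id comp_mpolyXU -tnth_nth.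
Qed.

Lemma comp_homog_scale n k d (p : {mpoly K[n]}) (s t : n.-tuple {mpoly K[k]})
    (a b : {mpoly K[k]}) :
  p \is d.-homog -> (forall i, a * tnth s i = b * tnth t i) ->
  a ^+ d * (p \mPo s) = b ^+ d * (p \mPo t).
Proof.
move=> /dhomogP hp E; rewrite !comp_mpolyE !mulr_sumr !big_seq.
apply: eq_bigr => m mp; rewrite -!scalerAr; congr (_ *: _).
have <- : mdeg m = d by apply: hp.
rewrite mdegE -!prodrXr -!big_split /=; apply: eq_bigr => i _.
by rewrite -!exprMn E.
Qed.

Lemma comp_dhomog n k d e (p : {mpoly K[n]}) (s : n.-tuple {mpoly K[k]}) :
  p \is d.-homog -> (forall i, tnth s i \is e.-homog) ->
  p \mPo s \is (e * d).-homog.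
Proof.
move=> /dhomogP hp hs; rewrite comp_mpolyE big_seq; apply: rpred_sum => m mp.
have <- : mdeg m = d by apply: hp.
apply: rpredZ; rewrite mdegE big_distrr /=.
elim/big_ind2: _ => [|q1 d1 q2 d2 h1 h2|i _]; first exact: dhomog1.
  exact: dhomogM.
exact: dhomogMn.
Qed.

Lemma homog_comp_triple f g :
  homog_triple f -> homog_triple g -> homog_triple (comp_triple f g).
Proof.
move=> /homog_tripleP[d hf] /homog_tripleP[e hg]; apply/homog_tripleP.
by exists (e * d)%N => i; rewrite tnth_comp; apply: comp_dhomog.
Qed.

Lemma cross_scale s t : nonzero s -> nonzero t -> cross s t ->
  exists a b, [/\ a != 0, b != 0 & forall i, a * tnth s i = b * tnth t i].
Proof.
move=> /nonzeroP[k nzs] /nonzeroP[l nzt] /crossP st.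
exists (tnth t l), (tnth s l).
split=> //; last by move=> i; rewrite mulrC st.
apply: contra_neq nzs => sl0; apply: (mulIf nzt).
by rewrite st sl0 !mul0r.
Qed.

Lemma cross_comp_l f s t : homog_triple f -> nonzero s -> nonzero t ->
  cross s t ->
  cross (comp_triple f s) (comp_triple f t)
  /\ (nonzero (comp_triple f s) = nonzero (comp_triple f t)).
Proof.
move=> /homog_tripleP[d hf] nzs nzt st.
have [a [b [a0 b0 E]]] := cross_scale nzs nzt st.
have Ed i := comp_homog_scale (hf i) E; split.
  apply/crossP => i j; rewrite !tnth_comp.
  apply: (mulfI (expf_neq0 d a0)); rewrite !mulrA !Ed.
  by rewrite -!mulrA; congr (_ * _); rewrite mulrC.
apply: eq_existsb => i; rewrite !tnth_comp; apply/idP/idP => nz.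
  apply: contraNneq nz => Z; apply/eqP/(mulfI (expf_neq0 d a0)).
  by rewrite Ed Z !mulr0.
apply: contraNneq nz => Z; apply/eqP/(mulfI (expf_neq0 d b0)).
by rewrite -Ed Z !mulr0.
Qed.

Lemma cross_comp_r s t h :
  cross s t -> cross (comp_triple s h) (comp_triple t h).
Proof.
by move/crossP=> st; apply/crossP => i j; rewrite !tnth_comp -!rmorphM st.
Qed.

Lemma nonzero_comp_r f h : nonzero (comp_triple f h) -> nonzero f.
Proof.
case/nonzeroP=> i; rewrite tnth_comp => nz; apply/nonzeroP; exists i.
by apply: contraNneq nz => ->; rewrite comp_mpoly0.
Qed.

Lemma nonzero_id : nonzero id_triple.
Proof.
by apply/nonzeroP; exists ord0; rewrite tnth_id -msize_poly_eq0 mmeasureX.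
Qed.

Lemma homog_id : homog_triple id_triple.
Proof.
apply/homog_tripleP; exists 1%N => i.
by rewrite tnth_id dhomogX /= mdeg1.
Qed.

Lemma inverts_nonzero f g h : homog_triple f -> nonzero f ->
  inverts g h -> nonzero (comp_triple f g).
Proof.
move=> hf nzf /andP[nz cr]; apply: (@nonzero_comp_r _ h).
rewrite comp_tripleA (cross_comp_l hf nz nonzero_id cr).2.
by rewrite comp_triple_id.
Qed.

Lemma inverts_comp f f' g g' :
  homog_triple f -> nonzero f -> homog_triple g -> nonzero g ->
  homog_triple g' -> nonzero g' -> homog_triple f' -> nonzero f' ->
  inverts f f' -> inverts g g' -> inverts f' f ->
  inverts (comp_triple f g) (comp_triple g' f').
Proof.
move=> hf nzf hg nzg hg' nzg' hf' nzf' /andP[nff' cff'] /andP[ngg' cgg'] li.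
set k := comp_triple (comp_triple f g) (comp_triple g' f').
have kE : k = comp_triple f (comp_triple (comp_triple g g') f').
  by rewrite /k !comp_tripleA.
have nzX : nonzero (comp_triple (comp_triple g g') f').
  exact: inverts_nonzero (homog_comp_triple hg hg') ngg' li.
have crX : cross (comp_triple (comp_triple g g') f') f'.
  by have := cross_comp_r f' cgg'; rewrite comp_id_triple.
have [c n] := cross_comp_l hf nzX nzf' crX.
rewrite /inverts -/k kE n nff' /=.
exact: cross_trans nff' c cff'.
Qed.

End Triples.

Definition ratmap (K : fieldType) :=
  {t : triple K | homog_triple t && nonzero t}.

Section Bir.
Variable K : fieldType.

(* A birational map together with a representative of its inverse. *)
Definition birpair :=
  {fg : ratmap K * ratmap K |
     inverts (val fg.1) (val fg.2) && inverts (val fg.2) (val fg.1)}.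

Definition fwd (x : birpair) : triple K := val (val x).1.
Definition bwd (x : birpair) : triple K := val (val x).2.

Definition birpair_eq (x y : birpair) := cross (fwd x) (fwd y).

Lemma fwd_homog x : homog_triple (fwd x).
Proof. by have /andP[] := valP (val x).1. Qed.

Lemma fwd_nonzero x : nonzero (fwd x).
Proof. by have /andP[] := valP (val x).1. Qed.

Lemma bwd_homog x : homog_triple (bwd x).
Proof. by have /andP[] := valP (val x).2. Qed.

Lemma bwd_nonzero x : nonzero (bwd x).
Proof. by have /andP[] := valP (val x).2. Qed.

Lemma fwdK x : inverts (bwd x) (fwd x).
Proof. exact: (proj2 (andP (valP x))). Qed.

Lemma bwdK x : inverts (fwd x) (bwd x).
Proof. exact: (proj1 (andP (valP x))). Qed.

Lemma birpair_eq_refl : reflexive birpair_eq.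
Proof. by move=> x; apply: cross_refl. Qed.

Lemma birpair_eq_sym : ssrbool.symmetric birpair_eq.
Proof. by move=> x y; apply: cross_sym. Qed.

Lemma birpair_eq_trans : transitive birpair_eq.
Proof. by move=> y x z; apply: cross_trans (fwd_nonzero y). Qed.

Canonical birpair_equiv :=
  EquivRel birpair_eq birpair_eq_refl birpair_eq_sym birpair_eq_trans.

(* The group of birational transformations of P^2: mutually inverse pairs   *)
(* of homogeneous triples, up to proportionality of the first component.     *)
Definition Bir := {eq_quot birpair_equiv}.

HB.instance Definition _ := Choice.on Bir.
HB.instance Definition _ := EqQuotient.on Bir.

Definition mk_ratmap t (ht : homog_triple t) (nt : nonzero t) : ratmap K :=
  exist _ t (introT andP (conj ht nt)).

Definition mk_birpair (f g : ratmap K) (fg : inverts (val f) (val g))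
    (gf : inverts (val g) (val f)) : birpair :=
  exist _ (f, g) (introT andP (conj fg gf)).

Lemma comp_fwd_nonzero x y : nonzero (comp_triple (fwd x) (fwd y)).
Proof.
exact: inverts_nonzero (fwd_homog x) (fwd_nonzero x) (bwdK y).
Qed.

Lemma comp_bwd_nonzero x y : nonzero (comp_triple (bwd y) (bwd x)).
Proof.
exact: inverts_nonzero (bwd_homog y) (bwd_nonzero y) (fwdK x).
Qed.

Lemma birpair_mul_subproof1 x y : inverts
  (comp_triple (fwd x) (fwd y)) (comp_triple (bwd y) (bwd x)).
Proof.
by apply: inverts_comp; rewrite ?(fwd_homog, fwd_nonzero, bwd_homog,
  bwd_nonzero, fwdK, bwdK).
Qed.

Lemma birpair_mul_subproof2 x y : inverts
  (comp_triple (bwd y) (bwd x)) (comp_triple (fwd x) (fwd y)).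
Proof.
by apply: inverts_comp; rewrite ?(fwd_homog, fwd_nonzero, bwd_homog,
  bwd_nonzero, fwdK, bwdK).
Qed.

(* Multiplication is composition: x * y is "first y, then x". *)
Definition birpair_mul (x y : birpair) : birpair :=
  @mk_birpair
    (mk_ratmap (homog_comp_triple (fwd_homog x) (fwd_homog y))
               (comp_fwd_nonzero x y))
    (mk_ratmap (homog_comp_triple (bwd_homog y) (bwd_homog x))
               (comp_bwd_nonzero x y))
    (birpair_mul_subproof1 x y) (birpair_mul_subproof2 x y).

Lemma birpair_one_subproof : inverts (id_triple K) (id_triple K).
Proof. by rewrite /inverts comp_triple_id nonzero_id cross_refl. Qed.

Definition birpair_one : birpair :=
  @mk_birpair (mk_ratmap (homog_id K) (nonzero_id K))
    (mk_ratmap (homog_id K) (nonzero_id K))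
    birpair_one_subproof birpair_one_subproof.

Definition birpair_inv (x : birpair) : birpair :=
  @mk_birpair (val x).2 (val x).1 (fwdK x) (bwdK x).

Lemma birpair_mul_congr x x' y y' :
  birpair_eq x x' -> birpair_eq y y' ->
  birpair_eq (birpair_mul x y) (birpair_mul x' y').
Proof.
move=> xx' yy'; rewrite /birpair_eq /fwd /=.
apply: (cross_trans (comp_fwd_nonzero x y')).
  by case: (cross_comp_l (fwd_homog x) (fwd_nonzero y) (fwd_nonzero y') yy').
exact: cross_comp_r.
Qed.

Lemma birpair_inv_congr x y :
  birpair_eq x y -> birpair_eq (birpair_inv x) (birpair_inv y).
Proof.
(* x^-1 ~ x^-1 (y y^-1) ~ (x^-1 x) y^-1 ~ y^-1 *)
move=> xy; rewrite /birpair_eq /fwd /= -/(bwd x) -/(bwd y).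
have [/andP[nx cx] /andP[ny cy]] := (fwdK x, bwdK y).
have c1 : cross (comp_triple (bwd x) (comp_triple (fwd y) (bwd y))) (bwd x).
  have [] := cross_comp_l (bwd_homog x) ny (nonzero_id K) cy.
  by rewrite comp_triple_id.
have n1 : nonzero (comp_triple (bwd x) (comp_triple (fwd y) (bwd y))).
  have [_ ->] := cross_comp_l (bwd_homog x) ny (nonzero_id K) cy.
  by rewrite comp_triple_id bwd_nonzero.
have [c3 n3] := cross_comp_l (bwd_homog x) (fwd_nonzero x) (fwd_nonzero y) xy.
have c4 : cross (comp_triple (bwd x) (fwd y)) (id_triple K).
  by rewrite cross_sym in c3; exact: (cross_trans nx c3 cx).
have := cross_comp_r (bwd y) c4; rewrite comp_tripleA comp_id_triple => c2.
by rewrite cross_sym in c1; exact: (cross_trans n1 c1 c2).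
Qed.

Definition bir_mul (x y : Bir) : Bir := \pi_Bir (birpair_mul (repr x) (repr y)).
Definition bir_one : Bir := \pi_Bir birpair_one.
Definition bir_inv (x : Bir) : Bir := \pi_Bir (birpair_inv (repr x)).

Lemma pi_birP x y : (\pi_Bir x = \pi_Bir y) <-> birpair_eq x y.
Proof. by split=> [/eqP|H]; [|apply/eqP]; rewrite eqmodE. Qed.

Lemma repr_bir x : birpair_eq (repr (\pi_Bir x)) x.
Proof. by apply/pi_birP; rewrite reprK. Qed.

Lemma bir_mulE x y : bir_mul (\pi_Bir x) (\pi_Bir y) = \pi_Bir (birpair_mul x y).
Proof. by apply/pi_birP/birpair_mul_congr; apply: repr_bir. Qed.

Lemma bir_invE x : bir_inv (\pi_Bir x) = \pi_Bir (birpair_inv x).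
Proof. by apply/pi_birP/birpair_inv_congr/repr_bir. Qed.

Lemma bir_mulA : associative bir_mul.
Proof.
elim/quotW=> x; elim/quotW=> y; elim/quotW=> z.
rewrite (bir_mulE y z) (bir_mulE x y) !bir_mulE.
by apply/pi_birP; rewrite /birpair_eq /fwd /= comp_tripleA cross_refl.
Qed.

Lemma bir_mul1 : left_id bir_one bir_mul.
Proof.
elim/quotW=> x; rewrite bir_mulE; apply/pi_birP.
by rewrite /birpair_eq {1}/fwd /= comp_id_triple cross_refl.
Qed.

Lemma bir_mulr1 : right_id bir_one bir_mul.
Proof.
elim/quotW=> x; rewrite bir_mulE; apply/pi_birP.
by rewrite /birpair_eq {1}/fwd /= comp_triple_id cross_refl.
Qed.

Lemma bir_mulV : left_inverse bir_one bir_inv bir_mul.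
Proof.
elim/quotW=> x; rewrite bir_invE bir_mulE; apply/pi_birP.
by have /andP[] := fwdK x.
Qed.

Lemma bir_mulrV : right_inverse bir_one bir_inv bir_mul.
Proof.
elim/quotW=> x; rewrite bir_invE bir_mulE; apply/pi_birP.
by have /andP[] := bwdK x.
Qed.

HB.instance Definition _ :=
  isGroup.Build Bir bir_mulA bir_mul1 bir_mulr1 bir_mulV bir_mulrV.

End Bir.

(* P^2 = P(K^3): points and lines are the subspaces of dimension 1 and 2.     *)
Definition point (K : fieldType) := {p : {vspace 'rV[K]_3} | \dim p == 1%N}.
Definition line (K : fieldType) := {D : {vspace 'rV[K]_3} | \dim D == 2%N}.

Definition on_line (K : fieldType) (D : line K) : pred (point K) :=
  fun p => (val p <= val D)%VS.

Definition line_through (K : fieldType) (p : point K) : pred (line K) :=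
  fun D => (val p <= val D)%VS.

(* The zero locus of a homogeneous F; by curveP below, the choice of a       *)
(* vector representing p is irrelevant.                                      *)
Definition curve (K : fieldType) (F : {mpoly K[3]}) : pred (point K) :=
  fun p => F.@[vpick (val p) 0] == 0.

(* Jacobian criterion; it forces F != 0.  Euler's relation does not help in  *)
(* characteristic 3, so "on the curve" is a separate hypothesis.             *)
Definition smooth_cubic (K : fieldType) (F : {mpoly K[3]}) : Prop :=
  F \is 3.-homog /\
  forall v : 'rV[K]_3, v != 0 -> F.@[v 0] = 0 ->
    exists i : 'I_3, F^`M(i).@[v 0] != 0.

(* "P holds for a general element of A", for A an irreducible curve (C, a    *)
(* line, or the pencil of lines through a point): the proper closed subsets  *)
(* of A are its finite subsets.                                              *)
Definition for_general (T : eqType) (A : pred T) (P : T -> Prop) : Prop :=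
  exists S : seq T, forall x, A x -> x \notin S -> P x.

Lemma meval_dhomogZ (K : fieldType) n d (F : {mpoly K[n]}) (c : K)
    (v : 'rV[K]_n) :
  F \is d.-homog -> F.@[(c *: v) 0] = c ^+ d * F.@[v 0].
Proof.
move=> /dhomogP hF; rewrite !mevalE mulr_sumr !big_seq.
apply: eq_bigr => m mF; rewrite mulrCA; congr (_ * _).
have <- : mdeg m = d by apply: hF.
rewrite mdegE -prodrXr -big_split /=; apply: eq_bigr => i _.
by rewrite mxE exprMn.
Qed.

Lemma point_vpick (K : fieldType) (p : point K) : val p = <[vpick (val p)]>%VS.
Proof.
have d1 : \dim (val p) = 1%N by apply/eqP; exact: (valP p).
have nz : vpick (val p) != 0.
  by rewrite vpick0; apply: contra_eqN d1 => /eqP->; rewrite dimv0.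
apply/esym/eqP; rewrite eqEdim dim_vline d1 nz andbT.
by rewrite -memvE memv_pick.
Qed.

Lemma curveP (K : fieldType) d (F : {mpoly K[3]}) (p : point K) :
  F \is d.-homog ->
  reflect (forall v, v \in val p -> F.@[v 0] = 0) (p \in curve F).
Proof.
move=> hF; apply: (iffP eqP) => [H v|H]; last exact: H (memv_pick _).
rewrite (point_vpick p) => /vlineP[c ->].
by rewrite (meval_dhomogZ _ _ hF) H mulr0.
Qed.

Section Geometry.
Variable K : fieldType.
Implicit Types (p q : point K) (F : {mpoly K[3]}) (s : Bir K) (t : triple K).

Definition teval t (v : 'rV[K]_3) : 'rV[K]_3 := \row_i (tnth t i).@[v 0].

Definition triple_sends t p q : Prop :=
  exists v, [/\ val p = <[v]>%VS, teval t v != 0 & val q = <[teval t v]>%VS].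

(* s is defined at p and s(p) = q: any representative without base point at  *)
(* p may be used.                                                            *)
Definition bir_sends s p q : Prop :=
  exists2 x : birpair K, \pi_(Bir K) x = s & triple_sends (fwd x) p q.

(* The second clause asks for a rational self-map h of C inverse to s|_C.    *)
Definition inertia F s : Prop :=
  [/\ forall p q, p \in curve F -> bir_sends s p q -> q \in curve F,
      exists h : ratmap K,
        for_general (curve F) (fun p => exists2 q,
           q \in curve F & bir_sends s p q /\ triple_sends (val h) q p)
        /\ for_general (curve F) (fun q => exists2 p,
           p \in curve F & triple_sends (val h) q p /\ bir_sends s p q)
    & for_general (curve F) (fun p => bir_sends s p p)].

(* A restricts to the automorphism of D given by s.  Every automorphism of   *)
(* D = P^1 comes from a linear automorphism of the plane val D of K^3.       *)
Definition restricts_to s (D : line K) (A : 'End('rV[K]_3)) : Prop :=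
  (A @: val D)%VS = val D
  /\ for_general (on_line D) (fun q => exists2 q',
       val q' = (A @: val q)%VS & bir_sends s q q').

Definition cubic_involution F p s : Prop :=
  for_general (line_through p) (fun D =>
    exists q1 q2 : point K,
      [/\ q1 != q2,
          forall q, (q \in on_line D) && (q \in curve F) && (q != p)
                    = (q == q1) || (q == q2)
        & exists A : 'End('rV[K]_3),
          [/\ restricts_to s D A,
              forall q, q \in on_line D -> (A @: (A @: val q) = val q)%VS,
              exists2 q, q \in on_line D & (A @: val q)%VS != val q,
              (A @: val q1)%VS = val q1
            & (A @: val q2)%VS = val q2]]).

End Geometry.

Section FreeProduct.
Local Open Scope group_scope.

Inductive generated (G : groupType) (X : G -> Prop) : G -> Prop :=
| generated_in x : X x -> generated X x
| generated_1 : generated X 1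
| generated_M x y : generated X x -> generated X y -> generated X (x * y)
| generated_V x : generated X x -> generated X x^-1.

Variables (I : eqType) (G : groupType) (H : I -> G -> Prop).
Implicit Types (u v w : seq (I * G)).

(* The external free product of the subgroups H i: words in letters (i, x)   *)
(* with x in H i, modulo the congruence generated by (i, 1) = empty word and *)
(* (i, x)(i, y) = (i, x * y); its law is concatenation.                      *)
Definition fp_word w : Prop := forall a, a \in w -> H a.1 a.2.

Inductive fp_eq : seq (I * G) -> seq (I * G) -> Prop :=
| fp_eq_refl u : fp_eq u u
| fp_eq_sym u v : fp_eq u v -> fp_eq v u
| fp_eq_trans u v w : fp_eq u v -> fp_eq v w -> fp_eq u w
| fp_eq_cat u u' v v' : fp_eq u u' -> fp_eq v v' -> fp_eq (u ++ v) (u' ++ v')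
| fp_eq_one i : fp_eq [:: (i, 1)] [::]
| fp_eq_mul i x y : H i x -> H i y ->
    fp_eq [:: (i, x); (i, y)] [:: (i, x * y)].

Definition fp_eval w : G := \big[*%g/1]_(a <- w) a.2.

(* S is the (internal) free product of the H i: the canonical map from the   *)
(* external free product to G is injective with image S.                     *)
Definition is_free_product (S : G -> Prop) : Prop :=
  (forall g, S g <-> exists2 w, fp_word w & fp_eval w = g)
  /\ (forall u v, fp_word u -> fp_word v -> (fp_eq u v <-> fp_eval u = fp_eval v)).

End FreeProduct.

(* Main.v *)
Require Import Defs.
From HB Require Import structures.
From mathcomp Require Import all_boot all_order all_algebra.
From mathcomp Require Import mpoly.
From mathcomp Require Import ring zify.

Set Implicit Arguments.
Unset Strict Implicit.
Unset Printing Implicit Defensive.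

Import GRing.Theory.
Local Open Scope ring_scope.

(** The cubic involution centred at q is the map
    z |-> dF_z(q) z - 2 F(z) q.
    To show that no nonempty reduced word in these involutions is trivial, apply
    it to a parametrized line, that is, to a point with coordinates in K[s], and
    follow the degree d of the resulting rational curve. The involution at q
    multiplies the degree by 3, less the degree of the common factor of the
    image; near each parameter value, this common factor is governed by the
    contact of the curve with the cubic at q and at the points x whose tangent
    line passes through q. Comparing local orders before and after an
    involution gives linear laws for the degree, the numbers of passages
    through the centres, and the degrees of the common factors. These laws
    alone imply that the degree increases at each letter of a reduced word.

    Uniqueness of the involution holds since on a line its action is the
    harmonic conjugation with respect to two given points. A word fixes all but
    finitely many points of the curve, hence preserves it wherever it is defined. *)

(** The obstacle is that a base point of one involution may be the centre of another. The base
    points of the involution at [q] are [q] and the points [x] with [adjacent x q]; near every other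
    point of the cubic it is invertible and fixes that point, so contacts and common factors found
    there are transported unchanged. The laws need corrections exactly along the edges of [adjacent]
    between centres. This directed graph has at most one edge out of each vertex, a tangent line
    meeting the cubic in one further point only, and it has no 2-cycle; these two facts and the
    linear laws are all that the growth argument uses. Working on a parametrized curve replaces
    multiplicities at infinitely near base points by orders of vanishing at one parameter value.
    This matters when [q] is a flex: the common factor then also depends on the contact of the curve
    with the tangent line at [q]. Characteristic 3 is allowed, so the cubic is encoded by a tensor
    that need not be symmetric, and its polar forms are sums over the slots. *)

Definition i0 : 'I_3 := @Ordinal 3 0 isT.
Definition i1 : 'I_3 := @Ordinal 3 1 isT.
Definition i2 : 'I_3 := @Ordinal 3 2 isT.

Lemma ord3P (P : 'I_3 -> Prop) : P i0 -> P i1 -> P i2 -> forall i, P i.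
Proof.
move=> h0 h1 h2 [[|[|[|//]]] lti]; [move: h0|move: h1|move: h2];
  congr P; exact: val_inj.
Qed.

(** * Cross products and cubic forms in three variables *)

Section Vectors.
Variable R : comNzRingType.
Implicit Types (u v w x : 'rV[R]_3).

Definition vec3 (a b c : R) : 'rV[R]_3 := \row_(i < 3) nth 0 [:: a; b; c] i.

Lemma vec3E a b c :
  (vec3 a b c 0 i0 = a) * (vec3 a b c 0 i1 = b) * (vec3 a b c 0 i2 = c).
Proof. by rewrite !mxE. Qed.

Lemma row3P u v :
  u 0 i0 = v 0 i0 -> u 0 i1 = v 0 i1 -> u 0 i2 = v 0 i2 -> u = v.
Proof. by move=> *; apply/rowP; apply: ord3P. Qed.

Definition vprod u v : 'rV[R]_3 :=
  vec3 (u 0 i1 * v 0 i2 - u 0 i2 * v 0 i1)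
       (u 0 i2 * v 0 i0 - u 0 i0 * v 0 i2)
       (u 0 i0 * v 0 i1 - u 0 i1 * v 0 i0).

Definition dotp u v : R := u 0 i0 * v 0 i0 + u 0 i1 * v 0 i1 + u 0 i2 * v 0 i2.

Definition det3 u v w : R := dotp (vprod u v) w.

Ltac vring := rewrite ?/det3 ?/dotp ?/vprod ?vec3E ?mxE; ring.
Ltac vecring := apply: row3P; rewrite ?/det3 ?/dotp ?/vprod ?vec3E ?mxE /=;
  rewrite ?/det3 ?/dotp ?/vprod ?vec3E ?mxE; ring.

Lemma vprodDl u v x : vprod (u + v) x = vprod u x + vprod v x.
Proof. vecring. Qed.

Lemma vprodZl a u x : vprod (a *: u) x = a *: vprod u x.
Proof. vecring. Qed.

Lemma vprodBl u v x : vprod (u - v) x = vprod u x - vprod v x.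
Proof. vecring. Qed.

Lemma vprodvv u : vprod u u = 0.
Proof. vecring. Qed.

Lemma vprodC u v : vprod u v = - vprod v u.
Proof. vecring. Qed.

Lemma dotpZl a u v : dotp (a *: u) v = a * dotp u v.
Proof. vring. Qed.

Lemma dotpDl u v w : dotp (u + v) w = dotp u w + dotp v w.
Proof. vring. Qed.

Lemma dot0p u : dotp 0 u = 0.
Proof. vring. Qed.

Lemma cramer3 u v w x :
  det3 u v w *: x = det3 x v w *: u + det3 u x w *: v + det3 u v x *: w.
Proof. vecring. Qed.

Lemma det3_combl a b c u v w : det3 (a *: u + b *: v + c *: w) v w = a * det3 u v w.
Proof. vring. Qed.

Lemma det3_combm a b c u v w : det3 u (a *: u + b *: v + c *: w) w = b * det3 u v w.
Proof. vring. Qed.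

Lemma det3_combr a b c u v w : det3 u v (a *: u + b *: v + c *: w) = c * det3 u v w.
Proof. vring. Qed.

Lemma det3_dotpl u v w : det3 u v w = dotp u (vprod v w).
Proof. vring. Qed.

Lemma det3_dotpm u v w : det3 u v w = dotp (vprod w u) v.
Proof. vring. Qed.

Lemma row3_neq0 u : u != 0 -> exists i, u 0 i != 0.
Proof.
move=> un0; have [/existsP[i]|/existsPn h] := boolP [exists i, u 0 i != 0].
  by exists i.
by case/eqP: un0; apply/rowP => i; rewrite mxE; apply/eqP/negPn/h.
Qed.

End Vectors.

Section Trilinear.
Variables (R : comNzRingType) (c : 'I_3 -> 'I_3 -> 'I_3 -> R).
Implicit Types (a b : R) (x y z w q : 'rV[R]_3).

Definition tri x y z : R :=
  \sum_i \sum_j \sum_k c i j k * (x 0 i * y 0 j * z 0 k).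

(* The cubic form, its derivative [polar x y = dF_x(y)] and its second       *)
(* derivative [spol x y w = d^2F_x(y, w)], free of division by 2 or 3.        *)
Definition cub x := tri x x x.
Definition polar x y := tri y x x + tri x y x + tri x x y.
Definition spol x y w := tri x y w + tri x w y + tri y x w
                       + tri y w x + tri w x y + tri w y x.

Lemma tri_lin1 a x x' y z : tri (a *: x + x') y z = a * tri x y z + tri x' y z.
Proof.
rewrite /tri mulr_sumr -big_split /=; apply: eq_bigr => i _.
rewrite mulr_sumr -big_split /=; apply: eq_bigr => j _.
by rewrite mulr_sumr -big_split /=; apply: eq_bigr => k _; rewrite !mxE; ring.
Qed.

Lemma tri_lin2 a x y y' z : tri x (a *: y + y') z = a * tri x y z + tri x y' z.
Proof.
rewrite /tri mulr_sumr -big_split /=; apply: eq_bigr => i _.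
rewrite mulr_sumr -big_split /=; apply: eq_bigr => j _.
by rewrite mulr_sumr -big_split /=; apply: eq_bigr => k _; rewrite !mxE; ring.
Qed.

Lemma tri_lin3 a x y z z' : tri x y (a *: z + z') = a * tri x y z + tri x y z'.
Proof.
rewrite /tri mulr_sumr -big_split /=; apply: eq_bigr => i _.
rewrite mulr_sumr -big_split /=; apply: eq_bigr => j _.
by rewrite mulr_sumr -big_split /=; apply: eq_bigr => k _; rewrite !mxE; ring.
Qed.

Definition triE := (tri_lin1, tri_lin2, tri_lin3).

Lemma tri0x y z : tri 0 y z = 0.
Proof. by rewrite /tri big1 // => i _; rewrite big1 // => j _; rewrite big1 // => k _; rewrite mxE !mul0r mulr0. Qed.

Lemma trix0 x z : tri x 0 z = 0.
Proof. by rewrite /tri big1 // => i _; rewrite big1 // => j _; rewrite big1 // => k _; rewrite !mxE mulr0 mul0r mulr0. Qed.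

Lemma trixx0 x y : tri x y 0 = 0.
Proof. by rewrite /tri big1 // => i _; rewrite big1 // => j _; rewrite big1 // => k _; rewrite !mxE !mulr0. Qed.

Lemma cub_comb2 a b x y : cub (a *: x + b *: y) =
  a ^+ 3 * cub x + a ^+ 2 * b * polar x y + a * b ^+ 2 * polar y x + b ^+ 3 * cub y.
Proof.
have E v : b *: v = b *: v + 0 by rewrite addr0.
by rewrite /cub /polar E !triE !tri0x !trix0 !trixx0; ring.
Qed.

Lemma polar_comb2 a b x y v : polar (a *: x + b *: y) v =
  a ^+ 2 * polar x v + a * b * spol x y v + b ^+ 2 * polar y v.
Proof.
have E w : b *: w = b *: w + 0 by rewrite addr0.
by rewrite /polar /spol E !triE !tri0x !trix0 !trixx0; ring.
Qed.

Lemma polar_lin a x y y' : polar x (a *: y + y') = a * polar x y + polar x y'.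
Proof. by rewrite /polar !triE; ring. Qed.

Lemma polar0 x : polar x 0 = 0.
Proof. by rewrite /polar tri0x trix0 trixx0 !addr0. Qed.

Lemma polarD x y y' : polar x (y + y') = polar x y + polar x y'.
Proof. by rewrite -{1}[y]scale1r polar_lin mul1r. Qed.

Lemma polarZ a x y : polar x (a *: y) = a * polar x y.
Proof. by rewrite -[a *: y]addr0 polar_lin polar0 addr0. Qed.

Lemma polarvv x : polar x x = 3%:R * cub x.
Proof. by rewrite /polar /cub; ring. Qed.

Lemma spolC x y w : spol x y w = spol y x w.
Proof. by rewrite /spol; ring. Qed.

Lemma spolyxx x y : spol y x x = 2%:R * polar x y.
Proof. by rewrite /spol /polar; ring. Qed.

Lemma cubZ a x : cub (a *: x) = a ^+ 3 * cub x.
Proof.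
have := cub_comb2 a 0 x 0; rewrite scale0r addr0 => ->; ring.
Qed.

Lemma polarZl a x y : polar (a *: x) y = a ^+ 2 * polar x y.
Proof.
have := polar_comb2 a 0 x 0 y; rewrite scale0r addr0 => ->; ring.
Qed.

(* On the line through q and z, the involution fixing the two intersections  *)
(* with the cubic other than q.                                              *)
Definition tau q z := polar z q *: z - (2%:R * cub z) *: q.

(* Discriminant of the binary form cutting the residual intersection of the  *)
(* cubic with the line through q and z.                                      *)
Definition discr q z := polar z q ^+ 2 - 4%:R * cub z * polar q z.

Lemma tauE q z : tau q z = polar z q *: z + (- (2%:R * cub z)) *: q.
Proof. by rewrite scaleNr. Qed.

Lemma tauZ a q z : tau q (a *: z) = a ^+ 3 *: tau q z.
Proof. by rewrite /tau polarZl cubZ scalerBr !scalerA; congr (_ *: _ - _ *: _); ring. Qed.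

Section OnCubic.
Variable q : 'rV[R]_3.
Hypothesis Cq : cub q = 0.

Lemma polarqq : polar q q = 0.
Proof. by rewrite polarvv Cq mulr0. Qed.

Lemma cub_line a b y : cub (a *: y + b *: q) =
  a * (a ^+ 2 * cub y + a * b * polar y q + b ^+ 2 * polar q y).
Proof. by rewrite cub_comb2 Cq; ring. Qed.

Lemma polar_line a b y :
  polar (a *: y + b *: q) q = a * (a * polar y q + 2%:R * b * polar q y).
Proof. by rewrite polar_comb2 polarqq spolyxx; ring. Qed.

Lemma polar_lineq a b y : polar q (a *: y + b *: q) = a * polar q y.
Proof. by rewrite polar_lin polarZ polarqq mulr0 addr0. Qed.

Lemma discr_line a b y : discr q (a *: y + b *: q) = a ^+ 4 * discr q y.
Proof. by rewrite /discr polar_line cub_line polar_lineq; ring. Qed.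

(** This is the origin of the formula for [tau]. By [cub_line] the residual intersection is the
    quadratic form [Q(a, b) = a^2 F(y) + a b P(y, q) + b^2 P(q, y)], and the involution of the line
    fixing its two zeros is [(a, b) -> (dQ/db, - dQ/da)]. *)
Lemma tau_line a b y : tau q (a *: y + b *: q) = a ^+ 2 *:
  ((a * polar y q + 2%:R * b * polar q y) *: y
   + (- (2%:R * a * cub y + b * polar y q)) *: q).
Proof.
rewrite tauE polar_line cub_line scalerDr !scalerDr !scalerA -addrA -scalerDl.
congr (_ *: _ + _ *: _); ring.
Qed.

(** Up to the factor [a ^+ 2], [tau_line] is a trace-zero matrix, whose square is the scalar
    [discr]. The second application starts from [a = polar z q], hence the square of that value. *)
Lemma tauK z : tau q (tau q z) = (polar z q ^+ 2 * discr q z) *: z.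
Proof.
rewrite [tau q z]tauE tau_line scalerDr !scalerA.
rewrite [X in _ + X *: q](_ : _ = 0) ?scale0r ?addr0; last by ring.
by congr (_ *: _); rewrite /discr; ring.
Qed.

End OnCubic.
End Trilinear.

Section Morphism.
Variables (R S : comNzRingType) (f : {rmorphism R -> S}).
Implicit Types (x y z q : 'rV[R]_3).

Lemma map_vec3 a b d : map_mx f (vec3 a b d) = vec3 (f a) (f b) (f d).
Proof. by apply: row3P; rewrite mxE !vec3E. Qed.

Lemma map_vprod x y : map_mx f (vprod x y) = vprod (map_mx f x) (map_mx f y).
Proof. by rewrite /vprod map_vec3 !rmorphB !rmorphM !mxE. Qed.

Lemma map_dotp x y : f (dotp x y) = dotp (map_mx f x) (map_mx f y).
Proof. by rewrite /dotp !rmorphD !rmorphM !mxE. Qed.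

Lemma map_det3 x y z :
  f (det3 x y z) = det3 (map_mx f x) (map_mx f y) (map_mx f z).
Proof. by rewrite /det3 map_dotp map_vprod. Qed.

Variables (c : 'I_3 -> 'I_3 -> 'I_3 -> R) (c' : 'I_3 -> 'I_3 -> 'I_3 -> S).
Hypothesis cc' : forall i j k, f (c i j k) = c' i j k.

Lemma map_tri x y z :
  f (tri c x y z) = tri c' (map_mx f x) (map_mx f y) (map_mx f z).
Proof.
rewrite rmorph_sum; apply: eq_bigr => i _; rewrite rmorph_sum.
apply: eq_bigr => j _; rewrite rmorph_sum; apply: eq_bigr => k _.
by rewrite !rmorphM !mxE cc'.
Qed.

Lemma map_cub x : f (cub c x) = cub c' (map_mx f x).
Proof. exact: map_tri. Qed.

Lemma map_polar x y : f (polar c x y) = polar c' (map_mx f x) (map_mx f y).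
Proof. by rewrite !rmorphD /= !map_tri. Qed.

Lemma map_tau q z : map_mx f (tau c q z) = tau c' (map_mx f q) (map_mx f z).
Proof.
by rewrite /tau map_mxB !map_mxZ rmorphM rmorph_nat /= map_polar map_cub.
Qed.

End Morphism.

Definition hevalE := (hornerD, hornerN, hornerM, hornerZ, hornerC, hornerXn, horner_exp, hornerX).

(** * Geometry of a smooth cubic *)

Section FieldVectors.
Variable K : fieldType.
Implicit Types (u v w x : 'rV[K]_3).

Lemma vprod_neq0 u v : vprod u v != 0 -> (u != 0) * (v != 0).
Proof.
move=> h; split; apply: contraNneq h => ->; apply/eqP; apply: row3P;
  rewrite !vec3E !mxE; ring.
Qed.

Lemma vprod_eq0 u v : u != 0 -> vprod u v = 0 -> exists t, v = t *: u.
Proof.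
move=> /row3_neq0[i ui] uv0.
have uv j k : u 0 j * v 0 k = u 0 k * v 0 j.
  have h0 := congr1 (fun x : 'rV_3 => x 0 i0) uv0.
  have h1 := congr1 (fun x : 'rV_3 => x 0 i1) uv0.
  have h2 := congr1 (fun x : 'rV_3 => x 0 i2) uv0.
  move: h0 h1 h2; rewrite !vec3E !mxE => /subr0_eq h0 /subr0_eq h1 /subr0_eq h2.
  by move: j k; apply: ord3P; apply: ord3P.
exists (v 0 i / u 0 i); apply/rowP => k; rewrite mxE.
by rewrite mulrAC -[v 0 i * _]mulrC -uv mulrC mulKf.
Qed.

Lemma vprodZ_eq0 u v : (exists t, v = t *: u) -> vprod u v = 0.
Proof. by case=> t ->; rewrite vprodC vprodZl vprodvv scaler0 oppr0. Qed.

Lemma dotp_neq0 u : u != 0 -> exists w, dotp u w != 0.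
Proof.
move=> /row3_neq0[i ui]; exists (delta_mx 0 i); move: i ui.
by apply: ord3P => ui; rewrite /dotp !mxE /= ?mulr0 ?mulr1 ?addr0 ?add0r.
Qed.

Lemma vprod_compl u : u != 0 -> exists v, vprod u v != 0.
Proof.
move=> u0; have [/existsP[j uj]|/existsPn h] :=
  boolP [exists j, vprod u (delta_mx 0 j) != 0]; first by exists (delta_mx 0 j).
have hh j k : vprod u (delta_mx 0 j) 0 k = 0 by rewrite (eqP (negbNE (h j))) mxE.
by case/eqP: u0; apply: row3P;
  [have := hh i2 i1|have := hh i0 i2|have := hh i1 i0];
  rewrite !vec3E !mxE /= ?mulr0 ?mulr1 ?subr0 ?sub0r // => /eqP;
  rewrite oppr_eq0 => /eqP.
Qed.

Lemma det3_compl u v : vprod u v != 0 -> exists w, det3 u v w != 0.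
Proof. exact: dotp_neq0. Qed.

Lemma cramer3K u v w x : det3 u v w != 0 -> exists a b d,
  [/\ x = a *: u + b *: v + d *: w, a = det3 x v w / det3 u v w,
      b = det3 u x w / det3 u v w & d = det3 u v x / det3 u v w].
Proof.
move=> D0; do 3 eexists; split; try reflexivity.
apply: (scalerI D0); rewrite cramer3 !scalerDr !scalerA.
by congr (_ *: _ + _ *: _ + _ *: _); rewrite mulrC divfK.
Qed.

Lemma det3_eq0 u v x : vprod u v != 0 -> det3 u v x = 0 ->
  exists a b, x = a *: u + b *: v.
Proof.
move=> /det3_compl[w D0] x0.
have [a [b [d [xE _ _ dE]]]] := cramer3K x D0.
by exists a, b; rewrite {1}xE dE x0 mul0r scale0r addr0.
Qed.

Lemma det3_vprod u v w : det3 u v w != 0 ->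
  (vprod u v != 0) * (vprod v w != 0) * (vprod u w != 0).
Proof.
move=> h; split; [split|]; apply: contraNneq h => h.
- by rewrite /det3 h dot0p.
- by rewrite det3_dotpl h /dotp !mxE; apply/eqP; ring.
- by rewrite det3_dotpm vprodC h oppr0 dot0p.
Qed.

End FieldVectors.

Section ClosedField.
Variable K : closedFieldType.

Lemma poly_roots_seq (p : {poly K}) : p != 0 ->
  exists rs : seq K, forall x, root p x -> x \in rs.
Proof.
have [rs ->] := closed_field_poly_normal p; rewrite scaler_eq0 => /norP[l0 _].
by exists rs => x; rewrite rootZ // root_prod_XsubC.
Qed.

Lemma fresh_scalar (rs : seq K) : exists x, x \notin rs.
Proof.
have /closed_nonrootP[x] : \prod_(z <- rs) ('X - z%:P) != 0 :> {poly K}.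
  by rewrite monic_neq0 // monic_prod_XsubC.
by rewrite root_prod_XsubC; exists x.
Qed.

Lemma quadratic_root (a b d : K) : a != 0 ->
  exists x, a * x ^+ 2 + b * x + d = 0.
Proof.
move=> a0; pose p : {poly K} := a *: 'X^2 + b *: 'X + d%:P.
have : size p != 1%N.
  apply: contraNneq a0 => /eqP/size_poly1P[e _ /(congr1 (fun q : {poly K} => q`_2))].
  rewrite /p !coefE /= mulr0 !addr0 mulr1 => ->; exact: eqxx.
case/closed_rootP=> x; rewrite /root /p !hevalE => /eqP h; exists x.
by rewrite -h; ring.
Qed.

End ClosedField.

Section SmoothCubic.
Variables (K : closedFieldType) (c : 'I_3 -> 'I_3 -> 'I_3 -> K).
Hypothesis K2 : 2%:R != 0 :> K.
Hypothesis smooth_c : forall v : 'rV[K]_3, v != 0 -> cub c v = 0 -> exists w, polar c v w != 0.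
Implicit Types (u v w x y q r : 'rV[K]_3).

Local Notation F := (cub c).
Local Notation P := (polar c).

Lemma four0 : 4%:R != 0 :> K.
Proof. by rewrite (natrM _ 2 2) mulf_neq0. Qed.

(* If F vanishes on a line then its gradient there is a binary quadratic     *)
(* form, which has a zero: a singular point.                                 *)
Lemma no_line u v : vprod u v != 0 ->
  ~ [/\ F u = 0, P u v = 0, P v u = 0 & F v = 0].
Proof.
move=> uv0 [Fu Puv Pvu Fv]; have [w D0] := det3_compl uv0.
have sing a b : a *: u + b *: v != 0 -> P (a *: u + b *: v) w != 0.
  move=> x0; have Fx : F (a *: u + b *: v) = 0.
    by rewrite cub_comb2 Fu Puv Pvu Fv; ring.
  have [w'] := smooth_c x0 Fx; apply: contraNneq => Pw.
  have [a' [b' [d' [-> _ _ _]]]] := cramer3K w' D0.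
  rewrite !polarD !polarZ Pw !polar_comb2 !polarvv Fu Fv Puv Pvu.
  by rewrite (spolC _ u v u) !spolyxx Puv Pvu; apply/eqP; ring.
have nz a b : a != 0 \/ b != 0 -> a *: u + b *: v != 0.
  move=> ab; apply: contra_not_neq (elimN eqP D0) => x0.
  have [Da Db] : a * det3 u v w = 0 /\ b * det3 u v w = 0.
    rewrite -(det3_combl a b 0) -(det3_combm a b 0) x0 scale0r addr0.
    by rewrite /det3 /dotp !vec3E !mxE; split; ring.
  case: ab => /negPf n0; [move/eqP: Da|move/eqP: Db];
    by rewrite mulf_eq0 n0 => /eqP.
have [A0|A0] := eqVneq (P u w) 0.
  have /negP[] := sing 1 0 (nz 1 0 (or_introl (oner_neq0 _))).
  by rewrite polar_comb2 A0; apply/eqP; ring.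
have [a ra] := quadratic_root (spol c u v w) (P v w) A0.
have /negP[] := sing a 1 (nz a 1 (or_intror (oner_neq0 _))).
by rewrite polar_comb2 -ra; apply/eqP; ring.
Qed.

(** Otherwise the line would be tangent at both points, which makes four intersections and puts it
    inside the cubic. *)
Lemma chord_tangent u v : vprod u v != 0 -> F u = 0 -> F v = 0 ->
  P u v = 0 -> P v u != 0.
Proof. by move=> uv0 Fu Fv Puv; apply/eqP => Pvu; apply: (no_line uv0). Qed.

(* The tangent line at x passes through q <> x.                              *)
Definition adjacent x q := [&& vprod x q != 0, F x == 0, F q == 0 & P x q == 0].

(** The differential at [x] kills [x] and [q]; being nonzero, it is nonzero on every vector off the
    tangent line. *)
Lemma adj_grad x q w : adjacent x q -> det3 x q w != 0 -> P x w != 0.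
Proof.
case/and4P=> xq0 /eqP Fx /eqP Fq /eqP Pxq D0.
have [w'] := smooth_c (vprod_neq0 xq0).1 Fx.
have [a [b [d [-> _ _ _]]]] := cramer3K w' D0; apply: contraNneq => Pw.
by rewrite !polarD !polarZ polarvv Fx Pxq Pw; apply/eqP; ring.
Qed.

Lemma adj_tangent x q : adjacent x q -> P q x != 0.
Proof. by case/and4P=> xq /eqP Fx /eqP Fq /eqP Pxq; apply: chord_tangent. Qed.

Lemma adj_asym x q : adjacent x q -> ~~ adjacent q x.
Proof. by move=> /adj_tangent h; apply/negP => /and4P[_ _ _ /eqP e]; rewrite e eqxx in h. Qed.

(** The tangent line at [x] has contact two at [x], which leaves a single further intersection. Thus
    [adjacent] is a partial function of its first argument. *)
Lemma adj_inj x q r : adjacent x q -> adjacent x r -> vprod q r = 0.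
Proof.
move=> xq xr; have /and4P[xr0 _ /eqP Fr /eqP Pxr] := xr.
have [D0|/(adj_grad xq)] := eqVneq (det3 x q r) 0; last by rewrite Pxr eqxx.
have /and4P[xq0 /eqP Fx /eqP Fq /eqP Pxq] := xq.
have [a [b rE]] := det3_eq0 xq0 D0.
move: Fr; rewrite rE cub_comb2 Fx Pxq Fq !mulr0 addr0 add0r add0r => /eqP.
rewrite mulf_eq0 (negPf (adj_tangent xq)) orbF mulf_eq0 expf_eq0 /=.
case/orP=> /eqP e0; last first.
  by move: xr0; rewrite rE e0 scale0r addr0 vprodZ_eq0 ?eqxx //; exists a.
by apply: vprodZ_eq0; exists b; rewrite e0 scale0r add0r.
Qed.

(** The tangent line at [q] is spanned by [q] and [y1]; every other line of the pencil passes
    through exactly one point [y0 + s *: y1]. *)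
Lemma pencil_basis q : q != 0 -> F q = 0 -> exists y0 y1,
  [/\ det3 q y1 y0 != 0, P q y1 = 0 & P q y0 != 0].
Proof.
move=> q0 Fq; have [y0 Py0] := smooth_c q0 Fq.
have qy0 : vprod y0 q != 0.
  apply: contraNneq Py0 => h.
  have [||t ->] := @vprod_eq0 _ q y0 => //; first by rewrite vprodC h oppr0.
  by rewrite polarZ polarvv Fq !mulr0.
have [t Dt] := det3_compl qy0.
exists y0, (t - (P q t / P q y0) *: y0); split=> //.
  by move: Dt; congr (_ != 0); rewrite /det3 /dotp !vec3E !mxE; ring.
by rewrite -scaleNr polarD polarZ mulNr divfK // subrr.
Qed.

(** The coefficient of [s^4] is [P y1 q ^+ 2]; if it vanishes, that of [s^3] is [- 4 P q y0 * F y1].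
    Were both zero, the tangent line at [q] would lie in the cubic. *)
Lemma pencil_discr q y0 y1 : F q = 0 -> vprod q y1 != 0 -> P q y1 = 0 ->
  P q y0 != 0 ->
  exists2 D : {poly K}, D != 0 & forall s, D.[s] = discr c q (y0 + s *: y1).
Proof.
move=> Fq qy1 Pq1 Pq0.
pose D : {poly K} :=
  ((P y0 q)%:P + spol c y0 y1 q *: 'X + P y1 q *: 'X^2) ^+ 2
  - 4%:R *: (P q y0 *:
     ((F y0)%:P + P y0 y1 *: 'X + P y1 y0 *: 'X^2 + F y1 *: 'X^3)).
exists D; last first.
  move=> s; have -> : y0 + s *: y1 = 1 *: y0 + s *: y1 by rewrite scale1r.
  by rewrite /discr cub_comb2 polar_comb2 polarD !polarZ Pq1 /D expr2 !hevalE; ring.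
apply/eqP => D0.
have DE : D = (P y0 q ^+ 2 - 4%:R * (P q y0 * F y0))%:P
  + (2%:R * P y0 q * spol c y0 y1 q - 4%:R * (P q y0 * P y0 y1)) *: 'X
  + (spol c y0 y1 q ^+ 2 + 2%:R * P y0 q * P y1 q - 4%:R * (P q y0 * P y1 y0)) *: 'X^2
  + (2%:R * spol c y0 y1 q * P y1 q - 4%:R * (P q y0 * F y1)) *: 'X^3
  + (P y1 q ^+ 2) *: 'X^4.
  by rewrite /D -!mul_polyC; ring.
have /eqP : D`_4 = 0 by rewrite D0 coef0.
rewrite DE !coefE /= !mulr0 !add0r mulr1 expf_eq0 /= => /eqP P10.
have /eqP : D`_3 = 0 by rewrite D0 coef0.
rewrite DE P10 !coefE /= !mulr0 !add0r mulr1 addr0 oppr_eq0 !mulf_eq0.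
rewrite (negPf Pq0) (negPf four0) /= => /eqP F1.
by apply: (no_line qy1).
Qed.

Definition covers (L : seq 'rV[K]_3) x := exists2 l, l \in L & exists t, x = t *: l.

Lemma line_finite u v : vprod u v != 0 -> exists L, forall a b,
  F (a *: u + b *: v) = 0 -> covers L (a *: u + b *: v).
Proof.
move=> uv0.
pose p : {poly K} := (F u)%:P + P u v *: 'X + P v u *: 'X^2 + F v *: 'X^3.
have p0 : p != 0.
  apply/eqP => p0; apply: (no_line uv0).
  have pi i : p`_i = 0 by rewrite p0 coef0.
  move: (pi 0) (pi 1) (pi 2%N) (pi 3%N); rewrite /p !coefE /=.
  by rewrite !mulr0 !mulr1 !addr0 !add0r.
have [rs rsP] := poly_roots_seq p0.
(* [v] is the point at infinity of the affine coordinate [s] on the line. *)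
exists (v :: [seq u + s *: v | s <- rs]) => a b Fab.
have [a0|a0] := eqVneq a 0.
  by exists v; rewrite ?mem_head //; exists b; rewrite a0 scale0r add0r.
exists (u + (b / a) *: v).
  rewrite inE; apply/orP; right; apply: map_f; apply: rsP; apply/eqP.
  apply: (mulfI (expf_neq0 3 a0)); rewrite mulr0 -{}Fab cub_comb2 /p !hevalE.
  by field.
by exists a; rewrite scalerDr scalerA mulrCA divff // mulr1.
Qed.

Lemma lines_finite q (Ys : seq 'rV[K]_3) : (forall y, y \in Ys -> vprod q y != 0) ->
  exists L, forall y, y \in Ys -> forall a b,
  F (a *: y + b *: q) = 0 -> covers L (a *: y + b *: q).
Proof.
elim: Ys => [|y Ys IH] h; first by exists [::].
have [|L LP] := IH; first by move=> z zY; apply: h; rewrite inE zY orbT.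
have [|L' L'P] := @line_finite y q.
  by have := h y (mem_head _ _); rewrite vprodC oppr_eq0.
exists (L' ++ L) => z; rewrite inE => /orP[/eqP->|zY] a b Fab.
  by have [l lL [t e]] := L'P a b Fab; exists l; [rewrite mem_cat lL|exists t].
by have [l lL [t e]] := LP z zY a b Fab; exists l; [rewrite mem_cat lL orbT|exists t].
Qed.

(* [P q x = 0]: the line through q and x is tangent to the cubic at q;       *)
(* [discr c q x = 0]: its two further intersections with the cubic coincide. *)
Lemma pencil_finite q : q != 0 -> F q = 0 -> exists2 Ys : seq 'rV[K]_3,
  forall y, y \in Ys -> vprod q y != 0 &
  forall x, vprod q x != 0 -> discr c q x = 0 \/ P q x = 0 ->
  exists y a b, y \in Ys /\ x = a *: y + b *: q.
Proof.
move=> q0 Fq; have [y0 [y1 [D0 P1 P0]]] := pencil_basis q0 Fq.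
have qy1 := (det3_vprod D0).1.1.
have [D nzD DE] := pencil_discr Fq qy1 P1 P0.
have [rs rsP] := poly_roots_seq nzD.
(* [y1] stands for the tangent line at [q], the one line of the pencil that the parameter [s]
   misses. *)
exists (y1 :: [seq y0 + s *: y1 | s <- rs]).
  move=> y; rewrite inE => /orP[/eqP->//|/mapP[s _ ->]].
  apply: contraNneq D0 => h.
  rewrite (_ : det3 _ _ _ = - dotp (vprod q (y0 + s *: y1)) y1).
    by rewrite h dot0p oppr0.
  by rewrite /det3 /dotp !vec3E !mxE; ring.
move=> x qx h.
have [g [b [a [xE _ _ _]]]] := cramer3K x D0.
have xE' : x = 1 *: (a *: y0 + b *: y1) + g *: q.
  by rewrite scale1r xE -addrA addrC [b *: _ + _]addrC.
have [a0|a0] := eqVneq a 0.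
  by exists y1, b, g; rewrite mem_head; split=> //; rewrite xE' a0 scale0r add0r scale1r.
exists (y0 + (b / a) *: y1), a, g; split; last first.
  by rewrite xE' scale1r scalerDr scalerA mulrCA divff // mulr1.
case: h => h; last first.
  move: h; rewrite xE' polarD !polarZ polarD !polarZ P1 polarvv Fq !mulr0 !addr0 mul1r.
  by move/eqP; rewrite mulf_eq0 (negPf a0) (negPf P0).
rewrite inE; apply/orP; right; apply: map_f; apply: rsP; apply/eqP.
rewrite DE; apply: (mulfI (expf_neq0 4 a0)); rewrite mulr0 -{}h xE' discr_line //.
have -> : a *: y0 + b *: y1 = a *: (y0 + (b / a) *: y1) + 0 *: q.
  by rewrite scale0r addr0 scalerDr scalerA mulrCA divff // mulr1.
by rewrite discr_line // expr1n mul1r.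
Qed.

(** At such an [x] the discriminant vanishes, so [x] lies on one of the finitely many lines of
    [pencil_finite], each of which meets the cubic in finitely many points. *)
Lemma base_finite q : q != 0 -> F q = 0 -> exists L : seq 'rV[K]_3,
  forall x, F x = 0 -> P x q = 0 -> covers L x.
Proof.
move=> q0 Fq; have [Ys Ys0 YsP] := pencil_finite q0 Fq.
have [L LP] := lines_finite Ys0; exists (q :: L) => x Fx Px.
have [/(vprod_eq0 q0)[t ->]|qx] := eqVneq (vprod q x) 0.
  by exists q; [rewrite mem_head|exists t].
have [|y [a [b [yY xE]]]] := YsP x qx; first by left; rewrite /discr Fx Px; ring.
have [|l lL lx] := LP y yY a b; first by rewrite -xE.
by exists l; rewrite ?xE // inE lL orbT.
Qed.

Lemma off_cubic : exists o, F o != 0.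
Proof.
pose u := vec3 1 0 0 : 'rV[K]_3; pose v := vec3 0 1 0 : 'rV[K]_3.
have uv : vprod u v != 0.
  apply/eqP => /(congr1 (fun x : 'rV_3 => x 0 i2)); rewrite !vec3E mxE.
  by apply/eqP; rewrite mul1r mul0r subr0 oner_neq0.
pose p : {poly K} := (F u)%:P + P u v *: 'X + P v u *: 'X^2 + F v *: 'X^3.
have /closed_nonrootP[s ps] : p != 0.
  apply/eqP => p0; apply: (no_line uv).
  have pi i : p`_i = 0 by rewrite p0 coef0.
  move: (pi 0) (pi 1) (pi 2%N) (pi 3%N); rewrite /p !coefE /=.
  by rewrite !mulr0 !mulr1 !addr0 !add0r.
exists (1 *: u + s *: v); apply: contraNneq ps => ps; apply/eqP.
by rewrite -{}ps cub_comb2 /p !hevalE; ring.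
Qed.

Lemma fiber_point o y : F o != 0 -> exists t, F (y + t *: o) = 0.
Proof.
move=> Fo.
pose p : {poly K} := (F y)%:P + P y o *: 'X + P o y *: 'X^2 + F o *: 'X^3.
have : size p != 1%N.
  apply: contraNneq Fo => /eqP/size_poly1P[e _ /(congr1 (fun q : {poly K} => q`_3))].
  rewrite /p !coefE /= !mulr0 !add0r mulr1 => ->; exact: eqxx.
case/closed_rootP=> t; rewrite /root /p !hevalE => /eqP h; exists t.
have -> : y + t *: o = 1 *: y + t *: o by rewrite scale1r.
by rewrite -h cub_comb2; ring.
Qed.

Lemma curve_infinite (L : seq 'rV[K]_3) : exists2 x,
  x != 0 & F x = 0 /\ ~ covers L x.
Proof.
have [o Fo] := off_cubic.
have o0 : o != 0 by apply: contraNneq Fo => ->; rewrite -(scale0r 0) cubZ expr0n mul0r.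
have [z oz] := vprod_compl o0.
have [w D0] := det3_compl oz.
(* [s] is the coordinate on the pencil of lines through [o], and the quotient of determinants
   recovers it from a representative of the point. Each member of [L] thus forbids one value. *)
have [s sL] := fresh_scalar [seq det3 o z l / det3 o l w | l <- L].
have [t Ft] := fiber_point (z + s *: w) Fo.
have xE : z + s *: w + t *: o = t *: o + 1 *: z + s *: w.
  by rewrite scale1r [LHS]addrC addrA.
have dz : det3 o (z + s *: w + t *: o) w = det3 o z w.
  by rewrite xE det3_combm mul1r.
have dw : det3 o z (z + s *: w + t *: o) = s * det3 o z w.
  by rewrite xE det3_combr.
exists (z + s *: w + t *: o).
  by apply: contraNneq D0 => x0; rewrite -dz x0; apply/eqP; rewrite /det3 /dotp !vec3E !mxE; ring.
split=> // -[l lL [k e]]; case/negP: sL; apply/mapP; exists l => //.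
rewrite e in dz dw.
have Dz : k * det3 o l w = det3 o z w by rewrite -dz /det3 /dotp !vec3E !mxE; ring.
have Dw : k * det3 o z l = s * det3 o z w by rewrite -dw /det3 /dotp !vec3E !mxE; ring.
have l0 : det3 o l w != 0 by apply: contraNneq D0 => h; rewrite -Dz h mulr0.
have k0 : k != 0 by apply: contraNneq D0 => h; rewrite -Dz h mul0r.
by apply: (mulIf l0); rewrite divfK //; apply: (mulfI k0); rewrite Dw mulrCA Dz.
Qed.

End SmoothCubic.

(** * Vectors of polynomials and local orders *)

Section PolyVectors.
Variable K : closedFieldType.
Implicit Types (p s : {poly K}) (z : 'rV[{poly K}]_3) (x q r w : 'rV[K]_3) (a : K).

(** A factor not vanishing at [a] is a unit of the local ring at [a]; the order computations below
    discard such factors. *)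
Lemma dvdp_nonroot a k u p : ~~ root u a ->
  (('X - a%:P) ^+ k %| u * p) = (('X - a%:P) ^+ k %| p).
Proof.
by move=> ua; rewrite Gauss_dvdpr // coprimep_expl // coprimep_sym coprimep_XsubC.
Qed.

(** Over an algebraically closed field the degree is the sum of the root multiplicities. This turns
    the local equalities between orders into global laws between degrees. *)
Lemma eqp_mup_size p (q : {poly K}) : p != 0 -> q != 0 -> (forall a, mup a p = mup a q) ->
  size p = size q.
Proof.
move=> p0 q0 e; have [rs pE] := closed_field_poly_normal p.
have [ss qE] := closed_field_poly_normal q.
have lp0 : lead_coef p != 0 by rewrite lead_coef_eq0.
have lq0 : lead_coef q != 0 by rewrite lead_coef_eq0.
suff /perm_size rs_ss : perm_eq rs ss.
  by rewrite pE qE !size_scale // !size_prod_XsubC rs_ss.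
apply/allP => a _ /=; apply/eqP; rewrite -!mu_prod_XsubC.
have h (l : K) (t : {poly K}) : l != 0 -> mup a (l *: t) = mup a t.
  by move=> l0; rewrite -mul_polyC mupMr // rootC.
by rewrite -[LHS](h _ _ lp0) -[RHS](h _ _ lq0) -pE -qE.
Qed.

Lemma mup_eqp a p (q : {poly K}) : p %= q -> mup a p = mup a q.
Proof.
have [->|p0] := eqVneq p 0; first by rewrite eqp_sym eqp0 => /eqP ->.
have [->|q0] := eqVneq q 0; first by rewrite eqp0 (negPf p0).
move=> pq; apply/eqP; rewrite eqn_leq !mup_geq //.
by apply/andP; split; [rewrite -(eqp_dvdr _ pq)|rewrite (eqp_dvdr _ pq)]; rewrite -mup_geq.
Qed.

Definition cst x : 'rV[{poly K}]_3 := map_mx polyC x.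
Definition ev a z : 'rV[K]_3 := map_mx (horner_eval a) z.
Definition cont z : {poly K} := gcdp (gcdp (z 0 i0) (z 0 i1)) (z 0 i2).
Definition ordv a z := mup a (cont z).

Lemma dvdp_cont p z : p %| cont z <-> forall i, p %| z 0 i.
Proof.
rewrite /cont !dvdp_gcd; split=> [/andP[/andP[h0 h1] h2]|h]; last by rewrite !h.
exact: ord3P.
Qed.

Lemma cont0 : cont 0 = 0.
Proof. by rewrite /cont !mxE !gcd0p. Qed.

Lemma cont_eq0 z : (cont z == 0) = (z == 0).
Proof.
apply/eqP/eqP => [h|->]; last exact: cont0.
have /dvdp_cont d : 0 %| cont z by rewrite h.
by apply/rowP => i; rewrite mxE; apply/eqP; rewrite -dvd0p.
Qed.

Lemma dvdp_contP p z : p %| cont z -> exists z', z = p *: z'.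
Proof.
move/dvdp_cont=> h; exists (\row_i (z 0 i %/ p)); apply/rowP => i.
by rewrite !mxE mulrC divpK.
Qed.

Lemma dvdp_contD p z z' : p %| cont z -> p %| cont z' -> p %| cont (z + z').
Proof.
by move=> /dvdp_cont h /dvdp_cont h'; apply/dvdp_cont => i; rewrite mxE dvdp_add.
Qed.

Lemma dvdp_contZ p (q : {poly K}) z : p %| cont z -> p %| cont (q *: z).
Proof. by move=> /dvdp_cont h; apply/dvdp_cont => i; rewrite mxE dvdp_mull. Qed.

Lemma dvdp_contZl p (q : {poly K}) z : p %| q -> p %| cont (q *: z).
Proof. by move=> h; apply/dvdp_cont => i; rewrite mxE dvdp_mulr. Qed.

Lemma dvdp_contN p z : (p %| cont (- z)) = (p %| cont z).
Proof.
by apply/idP/idP => /dvdp_cont h; apply/dvdp_cont => i; have := h i;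
  rewrite mxE dvdpNr.
Qed.

Lemma contZ p z : cont (p *: z) %= p * cont z.
Proof.
rewrite /cont !mxE; apply: eqp_trans (gcdp_mul2l _ _ _).
exact: eqp_gcd (gcdp_mul2l _ _ _) (eqpxx _).
Qed.

Lemma dvdp_cont_dotp p z z' : p %| cont z -> p %| dotp z z'.
Proof. by move=> /dvdp_contP[u ->]; rewrite dotpZl dvdp_mulr. Qed.

Lemma evE a z i : ev a z 0 i = (z 0 i).[a].
Proof. by rewrite mxE. Qed.

Lemma ev_cst a x : ev a (cst x) = x.
Proof. by apply/rowP => i; rewrite !mxE /horner_eval hornerC. Qed.

Lemma evZ a p z : ev a (p *: z) = p.[a] *: ev a z.
Proof. by apply/rowP => i; rewrite !mxE /horner_eval hornerM. Qed.

Lemma evD a z z' : ev a (z + z') = ev a z + ev a z'.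
Proof. by apply/rowP => i; rewrite !mxE /horner_eval hornerD. Qed.

Lemma ev_eq0 a z : (ev a z == 0) = ('X - a%:P %| cont z).
Proof.
apply/eqP/idP => [h|/dvdp_contP[u ->]]; last first.
  by rewrite evZ hornerXsubC subrr scale0r.
apply/dvdp_cont => i; rewrite dvdp_XsubCl /root -evE h mxE; exact: eqxx.
Qed.

Lemma ordv_geq a z n : z != 0 -> (n <= ordv a z)%N = (('X - a%:P) ^+ n %| cont z).
Proof. by move=> z0; rewrite mup_geq // cont_eq0. Qed.

Lemma ordv_eq0 a z : ev a z != 0 -> ordv a z = 0%N.
Proof. by move=> h; rewrite /ordv mupNroot // -dvdp_XsubCl -ev_eq0. Qed.

Lemma ordv_gt0 a z : z != 0 -> (0 < ordv a z)%N = (ev a z == 0).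
Proof. by move=> z0; rewrite ordv_geq // expr1 ev_eq0. Qed.

Lemma ordvZ a p z : p != 0 -> z != 0 -> ordv a (p *: z) = (mup a p + ordv a z)%N.
Proof.
by move=> p0 z0; rewrite /ordv (mup_eqp a (contZ p z)) mupM // cont_eq0.
Qed.

Lemma scalev_neq0 p z : p != 0 -> z != 0 -> p *: z != 0.
Proof.
move=> p0 z0; rewrite -cont_eq0 -dvd0p (eqp_dvdr _ (contZ p z)) dvd0p.
by rewrite mulf_neq0 // cont_eq0.
Qed.

Lemma ev_neq0 a z : ev a z != 0 -> z != 0.
Proof. by apply: contraNneq => ->; rewrite ev_eq0 cont0 dvdp0. Qed.

Lemma ordv_prim a p z : p != 0 -> ev a z != 0 -> ordv a (p *: z) = mup a p.
Proof. by move=> p0 z0; rewrite ordvZ ?(ev_neq0 z0) // (ordv_eq0 z0) addn0. Qed.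

Lemma XsubC_exp_neq0 a n : ('X - a%:P) ^+ n != 0 :> {poly K}.
Proof. by rewrite expf_neq0 // polyXsubC_eq0. Qed.

Lemma mupX a n : mup a (('X - a%:P) ^+ n) = n.
Proof. by rewrite mup_XsubCX eqxx. Qed.

Lemma mup_decomp a p : p != 0 ->
  exists2 u, ~~ root u a & p = ('X - a%:P) ^+ mup a p * u.
Proof.
move=> p0; have : ('X - a%:P) ^+ mup a p %| p by rewrite -mup_geq.
move=> /divpK pE; exists (p %/ ('X - a%:P) ^+ mup a p); last by rewrite mulrC pE.
have u0 : p %/ ('X - a%:P) ^+ mup a p != 0 by apply: contraNneq p0 => h; rewrite -pE h mul0r.
rewrite -dvdp_XsubCl XsubC_dvd // -eqn0Ngt; have := congr1 (mup a) pE.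
by rewrite mupM ?XsubC_exp_neq0 // mupX => /eqP; rewrite -[X in _ == X]add0n eqn_add2r.
Qed.

Lemma ordv_le a z z' : z != 0 -> z' != 0 ->
  (forall k, ('X - a%:P) ^+ k %| cont z -> ('X - a%:P) ^+ k %| cont z') ->
  (ordv a z <= ordv a z')%N.
Proof. by move=> z0 z0' h; rewrite ordv_geq // h // -ordv_geq. Qed.

Lemma ordv_eq a z z' : z != 0 -> z' != 0 ->
  (forall k, (('X - a%:P) ^+ k %| cont z) = (('X - a%:P) ^+ k %| cont z')) ->
  ordv a z = ordv a z'.
Proof.
by move=> z0 z0' h; apply/eqP; rewrite eqn_leq !ordv_le // => k; rewrite h.
Qed.

Lemma cst_det3 x q w : (det3 x q w)%:P = det3 (cst x) (cst q) (cst w).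
Proof. exact: map_det3. Qed.

Definition comb3 x q w (A B W : {poly K}) := A *: cst x + B *: cst q + W *: cst w.

Section Basis.
Variables x q w : 'rV[K]_3.
Hypothesis D0 : det3 x q w != 0.

Lemma comb3P z : exists A B W, z = comb3 x q w A B W.
Proof.
pose D := det3 x q w; pose e := (D^-1)%:P.
exists (e * det3 z (cst q) (cst w)), (e * det3 (cst x) z (cst w)),
  (e * det3 (cst x) (cst q) z).
rewrite /comb3 -!scalerA -!scalerDr -cramer3 scalerA -cst_det3 -rmorphM.
by rewrite mulVf // scale1r.
Qed.

Lemma root_det3 a : ~~ root (det3 (cst x) (cst q) (cst w)) a.
Proof. by rewrite -cst_det3 rootC. Qed.

Lemma dvdp_comb3 a k A B W :
  (('X - a%:P) ^+ k %| cont (comb3 x q w A B W)) =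
  [&& ('X - a%:P) ^+ k %| A, ('X - a%:P) ^+ k %| B & ('X - a%:P) ^+ k %| W].
Proof.
apply/idP/and3P => [h|[hA hB hW]]; last by rewrite !dvdp_contD // dvdp_contZl.
have det u v : ('X - a%:P) ^+ k %| det3 (comb3 x q w A B W) u v.
  by rewrite det3_dotpl dvdp_cont_dotp.
split; rewrite -(dvdp_nonroot _ _ (root_det3 a)) mulrC.
- by rewrite -(det3_combl A B W) det.
- rewrite -(det3_combm A B W) -/(comb3 _ _ _ _ _ _).
  by rewrite [X in _ %| X](_ : _ = det3 (comb3 x q w A B W) (cst w) (cst x)) ?det //
    /det3 /dotp !vec3E; ring.
- rewrite -(det3_combr A B W) -/(comb3 _ _ _ _ _ _).
  by rewrite [X in _ %| X](_ : _ = det3 (comb3 x q w A B W) (cst x) (cst q)) ?det //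
    /det3 /dotp !vec3E; ring.
Qed.

Lemma dvdp_comb3_vprod a k A B W :
  (('X - a%:P) ^+ k %| cont (vprod (comb3 x q w A B W) (cst x))) =
  (('X - a%:P) ^+ k %| B) && (('X - a%:P) ^+ k %| W).
Proof.
have E : vprod (comb3 x q w A B W) (cst x)
  = B *: vprod (cst q) (cst x) + W *: vprod (cst w) (cst x).
  by rewrite /comb3 !vprodDl !vprodZl vprodvv scaler0 add0r.
apply/idP/andP => [h|[hB hW]]; last by rewrite E dvdp_contD // dvdp_contZl.
split; rewrite -(dvdp_nonroot _ _ (root_det3 a)) mulrC.
  rewrite -dvdpNr.
  rewrite [X in _ %| X](_ : _ = dotp (vprod (comb3 x q w A B W) (cst x)) (cst w)) ?dvdp_cont_dotp //.
  by rewrite E dotpDl !dotpZl /det3 /dotp !vec3E; ring.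
rewrite [X in _ %| X](_ : _ = dotp (vprod (comb3 x q w A B W) (cst x)) (cst q)) ?dvdp_cont_dotp //.
by rewrite E dotpDl !dotpZl /det3 /dotp !vec3E; ring.
Qed.

Lemma comb3_inj A B W A' B' W' :
  comb3 x q w A B W = comb3 x q w A' B' W' -> [/\ A = A', B = B' & W = W'].
Proof.
have d0 : det3 (cst x) (cst q) (cst w) != 0 by rewrite -cst_det3 polyC_eq0.
rewrite /comb3 => e; split; apply: (mulIf d0).
- by rewrite -(det3_combl A B W) e det3_combl.
- by rewrite -(det3_combm A B W) e det3_combm.
- by rewrite -(det3_combr A B W) e det3_combr.
Qed.

Lemma ev_comb3_eq0 a A B W : (ev a (comb3 x q w A B W) == 0) =
  [&& root A a, root B a & root W a].
Proof. by rewrite ev_eq0 -[_ - _]expr1 dvdp_comb3 expr1 !dvdp_XsubCl. Qed.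

Lemma ev_comb3_vprod_eq0 a A B W :
  (vprod (ev a (comb3 x q w A B W)) x == 0) = root B a && root W a.
Proof.
have -> : vprod (ev a (comb3 x q w A B W)) x = ev a (vprod (comb3 x q w A B W) (cst x)).
  by rewrite /ev map_vprod -/(ev a (cst x)) ev_cst.
by rewrite ev_eq0 -[_ - _]expr1 dvdp_comb3_vprod expr1 !dvdp_XsubCl.
Qed.

End Basis.
End PolyVectors.

(** * Orders of the common factor at each kind of base point *)

Section LocalOrders.
Variables (K : closedFieldType) (c : 'I_3 -> 'I_3 -> 'I_3 -> K).
Hypothesis K2 : 2%:R != 0 :> K.
Hypothesis smooth_c :
  forall v : 'rV[K]_3, v != 0 -> cub c v = 0 -> exists w, polar c v w != 0.
Implicit Types (z : 'rV[{poly K}]_3) (x y q r w : 'rV[K]_3) (a : K).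

Local Notation F := (cub c).
Local Notation P := (polar c).
Let cP i j k := (c i j k)%:P.
Local Notation FP := (cub cP).
Local Notation PP := (polar cP).
Definition ctau q z := tau cP (cst q) z.

Lemma cst_cub x : FP (cst x) = (F x)%:P.
Proof. by rewrite -(map_cub (f := polyC) (c := c)). Qed.

Lemma cst_polar x y : PP (cst x) (cst y) = (P x y)%:P.
Proof. by rewrite -(map_polar (f := polyC) (c := c)). Qed.

Lemma cst_spol x y w : spol cP (cst x) (cst y) (cst w) = (spol c x y w)%:P.
Proof. by rewrite /spol !rmorphD /= !(map_tri (f := polyC) (c' := cP)). Qed.

Definition cstE := (cst_cub, cst_polar, cst_spol).

Lemma horner_cP a i j k : horner_eval a (cP i j k) = c i j k.
Proof. exact: hornerC. Qed.

Lemma ev_cub a z : (FP z).[a] = F (ev a z).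
Proof. exact: (map_cub (f := horner_eval a) (horner_cP a)). Qed.

Lemma ev_polar a z z' : (PP z z').[a] = P (ev a z) (ev a z').
Proof. exact: (map_polar (f := horner_eval a) (horner_cP a)). Qed.

Lemma ev_tau a q z : ev a (ctau q z) = tau c q (ev a z).
Proof. by rewrite /ev (map_tau (f := horner_eval a) (horner_cP a)) -/(ev a (cst q)) ev_cst. Qed.

Lemma ev_vprod a z x : ev a (vprod z (cst x)) = vprod (ev a z) x.
Proof. by rewrite /ev map_vprod -/(ev a (cst x)) ev_cst. Qed.

(** If [P x q] were nonzero, [x] would be a multiple of [q], whence [F x = 0] and then [x = 0]. The
    conclusion describes the base points of the involution at [q], including [q] itself. *)
Lemma tau_eq0 q x : q != 0 -> F q = 0 -> x != 0 -> tau c q x = 0 ->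
  F x = 0 /\ P x q = 0.
Proof.
move=> q0 Fq x0 /subr0_eq e.
have Px : P x q = 0.
  apply: contraNeq x0 => Px; have xE : x = ((P x q)^-1 * (2%:R * F x)) *: q.
    by rewrite -scalerA -e scalerA mulVf // scale1r.
  have Fx : F x = 0 by rewrite xE cubZ Fq mulr0.
  by rewrite xE Fx !mulr0 scale0r.
split=> //; move/eqP: e; rewrite Px scale0r eq_sym scaler_eq0 (negPf q0) orbF.
by rewrite mulf_eq0 (negPf K2) => /eqP.
Qed.

(* [at_pt a z x]: the point z(a) of the plane is x.                          *)
Definition at_pt a z x := (ev a z != 0) && (vprod (ev a z) x == 0).

Lemma at_ptP a z x : x != 0 -> at_pt a z x -> exists2 l, l != 0 & ev a z = l *: x.
Proof.
move=> x0 /andP[z0 /eqP h]; have [||l e] := @vprod_eq0 _ x (ev a z) => //.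
  by rewrite vprodC h oppr0.
by exists l => //; apply: contraNneq z0 => l0; rewrite e l0 scale0r.
Qed.

(** Modulo the power of ['X - a], [z] is a multiple of [x], where the form vanishes. *)
Lemma dvdp_FP x z a k : F x = 0 -> x != 0 ->
  ('X - a%:P) ^+ k %| cont (vprod z (cst x)) -> ('X - a%:P) ^+ k %| FP z.
Proof.
move=> Fx x0; have [q /det3_compl[w D0]] := vprod_compl x0.
have [A [B [W ->]]] := comb3P D0 z; rewrite dvdp_comb3_vprod //.
set b := _ ^+ k => /andP[/dvdpP[B' ->] /dvdpP[W' ->]].
pose V := B' *: cst q + W' *: cst w.
have -> : comb3 x q w A (B' * b) (W' * b) = A *: cst x + b *: V.
  by rewrite /comb3 /V scalerDr !scalerA addrA ![b * _]mulrC.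
rewrite cub_comb2 cst_cub Fx.
rewrite [X in _ %| X](_ : _ = b * (A ^+ 2 * PP (cst x) V + A * b * PP V (cst x)
  + b ^+ 2 * FP V)); [exact: dvdp_mulr|ring].
Qed.

Section GoodPoint.
Variables (r x : 'rV[K]_3) (a : K) (z : 'rV[{poly K}]_3).
Hypotheses (Fx : F x = 0) (Pxr : P x r != 0) (zx : at_pt a z x).

Let x0 : x != 0.
Proof. by apply: contraNneq Pxr => ->; rewrite -(scale0r 0) polarZl expr0n mul0r. Qed.

Lemma at_pt_tau : at_pt a (ctau r z) x.
Proof.
have [l l0 e] := at_ptP x0 zx; rewrite /at_pt ev_tau e /tau cubZ Fx !mulr0.
rewrite scale0r subr0 polarZl scalerA vprodZl vprodvv scaler0 eqxx andbT.
by rewrite scaler_eq0 (negPf x0) orbF !mulf_neq0 ?expf_neq0.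
Qed.

Lemma dvdp_vprod_tau k : ('X - a%:P) ^+ k %| cont (vprod z (cst x)) ->
  ('X - a%:P) ^+ k %| cont (vprod (ctau r z) (cst x)).
Proof.
move=> h; rewrite /ctau /tau vprodBl !vprodZl dvdp_contD ?dvdp_contZ //.
by rewrite dvdp_contN dvdp_contZl // dvdp_mull // (dvdp_FP Fx x0).
Qed.

End GoodPoint.

(** In the basis [(x, q, w)] the image has coordinates [(E A, G, E W)]. Modulo [W], [E] is [B] times
    a local unit, and [G] is [W] times a local unit. Both sides therefore measure the ideal
    [(B, W)]: [x] is a simple base point. *)
Lemma dvdp_tau_adj x q a z k : adjacent c x q -> at_pt a z x ->
  (('X - a%:P) ^+ k %| cont (ctau q z)) = (('X - a%:P) ^+ k %| cont (vprod z (cst x))).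
Proof.
move=> xq; have /and4P[xq0 /eqP Fx /eqP Fq /eqP Pxq] := xq.
have [w D0] := det3_compl xq0.
have Pxw := adj_grad smooth_c xq D0; have Pqx := adj_tangent smooth_c xq.
have [A [B [W ->]]] := comb3P D0 z.
case/andP; rewrite ev_comb3_eq0 // ev_comb3_vprod_eq0 // => nz /andP[Ba Wa].
have Aa : A.[a] != 0 by move: nz; rewrite Ba Wa !andbT.
move: Ba Wa => /eqP Ba /eqP Wa.
pose Y := A *: cst x + W *: cst w.
pose s1 := A * (spol c x w q)%:P + W * (P w q)%:P.
pose s2 := A ^+ 2 * (P x w)%:P + A * W * (P w x)%:P + W ^+ 2 * (F w)%:P.
have PYq : PP Y (cst q) = W * s1.
  by rewrite polar_comb2 !cstE Pxq /s1; ring.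
have FY : FP Y = W * s2 by rewrite cub_comb2 !cstE Fx /s2; ring.
have PqY : PP (cst q) Y = A * (P q x)%:P + W * (P q w)%:P.
  by rewrite polarD !polarZ !cstE.
have FPq : FP (cst q) = 0 by rewrite cst_cub Fq.
pose E := W * s1 + 2%:R * B * PP (cst q) Y.
pose G := - (W * (2%:R * s2 + B * s1)).
have -> : ctau q (comb3 x q w A B W) = comb3 x q w (E * A) G (E * W).
  have -> : comb3 x q w A B W = 1 *: Y + B *: cst q by rewrite scale1r addrAC.
  rewrite /ctau tau_line // expr1n scale1r PYq FY /comb3 -!scalerA addrAC -scalerDr.
  by congr (_ *: _ + _ *: _); rewrite /E /G; ring.
rewrite dvdp_comb3 // dvdp_comb3_vprod //.
have rE1 : ~~ root A a by [].
have uW : ~~ root (2%:R * s2 + B * s1) a.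
  rewrite /root (_ : _.[a] = 2%:R * (A.[a] ^+ 2 * P x w)) ?mulf_neq0 ?expf_neq0 //.
  by rewrite /s2 -polyC_natr !hevalE Ba Wa; ring.
have uB : ~~ root (2%:R * PP (cst q) Y) a.
  rewrite /root (_ : _.[a] = 2%:R * (A.[a] * P q x)) ?mulf_neq0 //.
  by rewrite PqY -polyC_natr !hevalE Wa; ring.
rewrite [E * A]mulrC (dvdp_nonroot _ _ rE1) /G dvdpNr [W * _]mulrC (dvdp_nonroot _ _ uW).
apply/and3P/andP => [[dE dW _]|[dB dW]].
  split=> //; move: dE; rewrite /E (dvdp_addr _ (dvdp_mulr _ dW)).
  by rewrite mulrAC (dvdp_nonroot _ _ uB).
have dE : ('X - a%:P) ^+ k %| E.
  by rewrite /E dvdp_add ?(dvdp_mulr _ dW) // mulrAC dvdp_mull.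
by split=> //; rewrite ?dvdp_mulr // dvdp_mulr.
Qed.

(* Near q itself, in a basis (q, y1, y0) with y1 on the tangent line at q.    *)
Section AtCenter.
Variables q y1 y0 : 'rV[K]_3.
Hypotheses (D0 : det3 q y1 y0 != 0) (Fq : F q = 0).
Hypotheses (Pq1 : P q y1 = 0) (Pq0 : P q y0 != 0).

(** The blow-up of [q] along the curve: [g] carries the order of contact with [q], and [Y], nonzero
    at [a], the direction of arrival. The factor [g ^+ 2] of the image is the one predicted by
    [tau_line]. *)
Lemma at_center_decomp a z : vprod z (cst q) != 0 -> at_pt a z q ->
  let g := ('X - a%:P) ^+ ordv a (vprod z (cst q)) in
  exists A B W, let Y := A *: cst y1 + W *: cst y0 in
  [/\ g.[a] = 0, B.[a] != 0, (A.[a] != 0) || (W.[a] != 0), z = g *: Y + B *: cst q &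
  ctau q z = g ^+ 2 *: ((g * PP Y (cst q) + 2%:R * B * PP (cst q) Y) *: Y
             + (- (2%:R * g * FP Y + B * PP Y (cst q))) *: cst q)].
Proof.
move=> zq0 zq g; have [B [A' [W' zE]]] := comb3P D0 z.
have m0 : (0 < ordv a (vprod z (cst q)))%N.
  by rewrite ordv_gt0 // ev_vprod; case/andP: zq.
have : g %| cont (vprod z (cst q)) by rewrite -ordv_geq.
rewrite {1}zE dvdp_comb3_vprod // => /andP[/dvdpP[A AE] /dvdpP[W WE]].
have : ~~ (g * ('X - a%:P) %| cont (vprod z (cst q))).
  by rewrite -exprSr -ordv_geq // ltnn.
rewrite {1}zE -exprSr dvdp_comb3_vprod // => nd.
exists A, B, W; set Y := _ + _.
have zY : z = g *: Y + B *: cst q.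
  by rewrite zE /comb3 AE WE /Y scalerDr !scalerA ![g * _]mulrC -addrA [LHS]addrC.
split=> //.
- by rewrite /g horner_exp hornerXsubC subrr expr0n eqn0Ngt m0.
- case/andP: zq; rewrite zE ev_comb3_eq0 // ev_comb3_vprod_eq0 // => h /andP[h1 h2].
  by move: h; rewrite h1 h2 !andbT.
- move: nd; rewrite -negb_and; apply: contra => /andP[A0 W0].
  rewrite AE WE exprSr ![_ * g]mulrC -/g !dvdp_mul2l ?XsubC_exp_neq0 //.
  by rewrite !dvdp_XsubCl; apply/andP.
- by rewrite {1}zY /ctau tau_line // cst_cub Fq.
Qed.

Lemma polar_center A W : PP (cst q) (A *: cst y1 + W *: cst y0) = (P q y0)%:P * W.
Proof. by rewrite polarD !polarZ !cstE Pq1 rmorph0 mulr0 add0r mulrC. Qed.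

(** [P y1 q] vanishes exactly when [q] is a flex. Nothing beyond [g ^+ 2] divides the image: if the
    direction [Y] is not tangent at [a], the coefficient of [Y] survives; if it is tangent, the
    coefficient of [q] survives and is controlled by [P y1 q]. *)
Lemma tau_center_nonflex a z : P y1 q != 0 ->
  vprod z (cst q) != 0 -> at_pt a z q ->
  ctau q z != 0 /\ ordv a (ctau q z) = (2 * ordv a (vprod z (cst q)))%N.
Proof.
move=> P1q zq0 zq; have [A [B [W []]]] := at_center_decomp zq0 zq.
set m := ordv a _; set g := _ ^+ m => /= ga Ba AW _ ->; set Y := A *: cst y1 + W *: cst y0.
set V := _ + _; have Va : ev a V != 0.
  have -> : V = comb3 q y1 y0 (- (2%:R * g * FP Y + B * PP Y (cst q)))
    ((g * PP Y (cst q) + 2%:R * B * PP (cst q) Y) * A)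
    ((g * PP Y (cst q) + 2%:R * B * PP (cst q) Y) * W).
    by rewrite /V /comb3 -[RHS]addrA [RHS]addrC -!scalerA -scalerDr.
  have p1a : (PP Y (cst q)).[a] = P (A.[a] *: y1 + W.[a] *: y0) q.
    by rewrite ev_polar ev_cst evD !evZ !ev_cst.
  rewrite (ev_comb3_eq0 D0) /root [PP (cst q) Y]polar_center -polyC_natr.
  move: (PP Y (cst q)) (FP Y) p1a => p1 f p1a.
  rewrite !(hornerD, hornerN, hornerM, hornerC) ga p1a !mulr0 !mul0r !add0r polar_comb2.
  apply/negP => /and3P[h1 h2 h3]; move: AW h3; have [W0|W0 _] := eqVneq W.[a] 0; last first.
    by apply/negP; rewrite !mulf_neq0.
  rewrite orbF => A0 _; move: h1; rewrite W0 mulr0 mul0r expr0n mul0r !addr0.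
  by apply/negP; rewrite oppr_eq0 !mulf_neq0 ?expf_neq0.
have g20 : g ^+ 2 != 0 by apply/expf_neq0/XsubC_exp_neq0.
split; first by rewrite scalev_neq0 ?(ev_neq0 Va).
by rewrite (ordv_prim g20 Va) /g -exprM mupX mulnC.
Qed.

(** The order is [m + min(2 m, ord P(q, z))]. Once [g ^+ 2] is removed and [Y] is tangent at [a],
    the coordinates generate the local ideal [(g, W)], since [F y1] is nonzero; and [P(q, z)] is
    [g W] up to a constant. *)
Lemma tau_center_flex a z k : P y1 q = 0 ->
  vprod z (cst q) != 0 -> at_pt a z q ->
  let m := ordv a (vprod z (cst q)) in
  (('X - a%:P) ^+ (m + k) %| cont (ctau q z)) =
  (k <= 2 * m)%N && (('X - a%:P) ^+ k %| PP (cst q) z).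
Proof.
move=> P1q zq0 zq m; have [A [B [W []]]] := at_center_decomp zq0 zq.
rewrite -/m; set g := _ ^+ m => /= ga Ba AW zE ->; set Y := A *: cst y1 + W *: cst y0 in zE *.
have Fy1 : F y1 != 0.
  by apply/eqP => F1; apply: (no_line smooth_c (det3_vprod D0).1.1).
pose s := A * (spol c y1 y0 q)%:P + W * (P y0 q)%:P.
have PYq : PP Y (cst q) = W * s by rewrite polar_comb2 !cstE P1q /s; ring.
have PqY : PP (cst q) Y = (P q y0)%:P * W by rewrite /Y polar_center.
have PqC : ~~ root (P q y0)%:P a by rewrite rootC.
pose e := g * s + 2%:R * B * (P q y0)%:P.
have ue : ~~ root e a.
  rewrite /root (_ : _.[a] = 2%:R * B.[a] * P q y0) ?mulf_neq0 //.
  by rewrite /e -polyC_natr !(hornerD, hornerM, hornerC) ga; ring.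
set V := (X in cont (_ *: X)).
have VE : V = comb3 q y1 y0 (- (2%:R * g * FP Y + B * (W * s))) (e * A * W) (e * W * W).
  rewrite /V /comb3 PYq PqY -[RHS]addrA [RHS]addrC; congr (_ + _).
  by rewrite /Y scalerDr !scalerA; congr (_ *: _ + _ *: _); rewrite /e; ring.
have -> : PP (cst q) z = g * ((P q y0)%:P * W).
  by rewrite zE polar_lineq ?PqY // cst_cub Fq.
have gE : g ^+ 2 = ('X - a%:P) ^+ (m + m) by rewrite /g -exprM muln2 addnn.
have [km|mk] := leqP k m.
  rewrite dvdp_contZl ?gE ?dvdp_exp2l ?leq_add2l //.
  by rewrite dvdp_mulr ?dvdp_exp2l // andbT; apply/esym/(leq_trans km)/leq_pmull.
have [j j0 ->] : exists2 j, (0 < j)%N & k = (m + j)%N.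
  by exists (k - m)%N; rewrite ?subn_gt0 // subnKC // ltnW.
have g0 : g != 0 by exact: XsubC_exp_neq0.
rewrite addnA exprD -gE (eqp_dvdr _ (contZ _ _)) dvdp_mul2l ?(expf_neq0 _ g0) //.
rewrite mul2n -addnn leq_add2l exprD -/g dvdp_mul2l // (dvdp_nonroot _ _ PqC).
rewrite VE dvdp_comb3 //.
have [Wa|Wa] := boolP (root W a); last first.
  have nd : ('X - a%:P) ^+ j %| W = false.
    rewrite -[W]mulr1 (dvdp_nonroot _ _ Wa) -(prednK j0) exprS.
    apply/negP => /(dvdp_trans (dvdp_mulr _ (dvdpp _))).
    by rewrite dvdp_XsubCl (negPf (root1 a)).
  by rewrite -!(mulrA e) !(dvdp_nonroot _ _ ue) (dvdp_nonroot _ _ Wa) nd !andbF.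
have uA : ~~ root A a by move: AW; rewrite (eqP Wa) eqxx orbF.
have uF : ~~ root (2%:R * FP Y) a.
  rewrite /root (_ : _.[a] = 2%:R * (A.[a] ^+ 3 * F y1)) ?mulf_neq0 ?expf_neq0 //.
  rewrite -polyC_natr hornerM hornerC ev_cub evD !evZ !ev_cst cub_comb2 (eqP Wa); ring.
rewrite dvdpNr -!(mulrA e) !(dvdp_nonroot _ _ ue) (dvdp_nonroot _ _ uA).
have [dW|dW] := boolP (_ %| W); last by rewrite !andbF.
rewrite dvdp_addl; last by rewrite dvdp_mull // dvdp_mulr.
rewrite mulrAC (dvdp_nonroot _ _ uF) dvdp_Pexp2l ?size_XsubC //.
by rewrite dvdp_mull // !andbT.
Qed.

(** Along [z = g Y + B q], the form equals [B^2 P(q, z)] modulo [g^2]. This serves to carry the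
    extra datum [P(q, z)] of a flex through an involution with another centre. *)
Lemma dvdp_FP_center a z k : vprod z (cst q) != 0 -> at_pt a z q ->
  (k <= 2 * ordv a (vprod z (cst q)))%N ->
  ('X - a%:P) ^+ k %| PP (cst q) z -> ('X - a%:P) ^+ k %| FP z.
Proof.
move=> zq0 zq km h; have [A [B [W []]]] := at_center_decomp zq0 zq.
set m := ordv a _; set g := _ ^+ m => /= ga Ba AW zE _; set Y := A *: cst y1 + W *: cst y0 in zE *.
have cq : FP (cst q) = 0 by rewrite cst_cub Fq.
have -> : FP z = g ^+ 2 * (g * FP Y + B * PP Y (cst q)) + B ^+ 2 * PP (cst q) z.
  by rewrite zE cub_line // polar_lineq //; ring.
apply: dvdp_add; last exact: dvdp_mull.
by apply: dvdp_mulr; rewrite /g -exprM mulnC dvdp_exp2l.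
Qed.

End AtCenter.
End LocalOrders.

(** * Local behaviour of the involutions *)

Section Pairs.
Variables (K : closedFieldType) (c : 'I_3 -> 'I_3 -> 'I_3 -> K).
Hypothesis K2 : 2%:R != 0 :> K.
Hypothesis smooth_c :
  forall v : 'rV[K]_3, v != 0 -> cub c v = 0 -> exists w, polar c v w != 0.
Implicit Types (z : 'rV[{poly K}]_3) (x y q r w : 'rV[K]_3) (a : K).

Local Notation F := (cub c).
Local Notation P := (polar c).
Let cP i j k := (c i j k)%:P.
Local Notation FP := (cub cP).
Local Notation PP := (polar cP).
Local Notation tauP := (ctau c).
Local Notation adj := (adjacent c).

Definition prim z := forall a, ev a z != 0.

Lemma at_pt_eq0 a z x : prim z -> at_pt a z x = (vprod (ev a z) x == 0).
Proof. by move=> pz; rewrite /at_pt pz. Qed.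

Lemma ordv_vprod_eq0 a z x : prim z -> ~~ at_pt a z x -> ordv a (vprod z (cst x)) = 0%N.
Proof. by move=> pz; rewrite at_pt_eq0 // => h; rewrite ordv_eq0 // ev_vprod. Qed.

Lemma at_pt_trans a z z' x y : x != 0 -> at_pt a z x -> at_pt a z' x ->
  at_pt a z y -> at_pt a z' y.
Proof.
move=> x0 zx z'x /andP[_ zy]; have [l l0 e] := at_ptP x0 zx.
have [l' l0' e'] := at_ptP x0 z'x; rewrite /at_pt e' scaler_eq0 negb_or l0' x0 /=.
move: zy; rewrite e !vprodZl !scaler_eq0 (negPf l0) (negPf l0') /=; exact.
Qed.

Definition based a z q := (F (ev a z) == 0) && (P (ev a z) q == 0).

Lemma based_tau a z q : q != 0 -> F q = 0 -> prim z -> ~~ based a z q ->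
  ordv a (tauP q z) = 0%N.
Proof.
move=> q0 Fq pz nb; apply: ordv_eq0; apply: contra nb; rewrite ev_tau => /eqP h.
by have [e1 e2] := tau_eq0 K2 q0 Fq (pz a) h; rewrite /based e1 e2 eqxx.
Qed.

Lemma based_cases a z q : prim z -> F q = 0 -> based a z q ->
  at_pt a z q \/ adj (ev a z) q.
Proof.
move=> pz Fq /andP[e1 e2]; rewrite at_pt_eq0 //.
have [h|h] := eqVneq (vprod (ev a z) q) 0; first by left.
by right; rewrite /adjacent h e1 e2 Fq eqxx.
Qed.

Lemma at_pt_polar a z x r : x != 0 -> at_pt a z x ->
  (P (ev a z) r == 0) = (P x r == 0).
Proof.
move=> x0 zx; have [l l0 ->] := at_ptP x0 zx.
by rewrite polarZl mulf_eq0 expf_eq0 (negPf l0).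
Qed.

Lemma at_ptxx a z : prim z -> at_pt a z (ev a z).
Proof. by move=> pz; rewrite /at_pt pz vprodvv eqxx. Qed.

Section Half.
Variables (r : 'rV[K]_3) (z z' : 'rV[{poly K}]_3) (C : {poly K}).
Hypotheses (pz : prim z) (pz' : prim z') (C0 : C != 0) (CE : C *: z' = tauP r z).

Lemma pair_nonroot a x : F x = 0 -> P x r != 0 -> at_pt a z x ->
  ~~ root C a /\ at_pt a z' x.
Proof.
move=> Fx Pxr zx; have /andP[t0 tx] := at_pt_tau Fx Pxr zx.
move: t0 tx; rewrite -CE evZ scaler_eq0 negb_or => /andP[Ca _].
by rewrite vprodZl scaler_eq0 (negPf Ca) /at_pt pz'; split.
Qed.

Lemma pair_dvdp_vprod a x k : F x = 0 -> P x r != 0 -> at_pt a z x ->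
  ('X - a%:P) ^+ k %| cont (vprod z (cst x)) ->
  ('X - a%:P) ^+ k %| cont (vprod z' (cst x)).
Proof.
move=> Fx Pxr zx h; have [Ca _] := pair_nonroot Fx Pxr zx.
have := dvdp_vprod_tau Fx Pxr h.
by rewrite -CE vprodZl (eqp_dvdr _ (contZ _ _)) dvdp_nonroot.
Qed.

(** [P(q, tau r z) = P(z, r) P(q, z) - 2 F(z) P(q, r)], and [dvdp_FP_center] takes care of the
    second term. *)
Lemma pair_dvdp_polar a q k : F q = 0 -> q != 0 -> P q r != 0 -> at_pt a z q ->
  vprod z (cst q) != 0 -> (k <= 2 * ordv a (vprod z (cst q)))%N ->
  ('X - a%:P) ^+ k %| PP (cst q) z -> ('X - a%:P) ^+ k %| PP (cst q) z'.
Proof.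
move=> Fq q0 Pqr zq zq0 km h; have [Ca _] := pair_nonroot Fq Pqr zq.
have [y0 [y1 [D0 P1 P0]]] := pencil_basis smooth_c q0 Fq.
have dF := dvdp_FP_center D0 Fq zq0 zq km h.
have -> : ('X - a%:P) ^+ k %| PP (cst q) z' = (('X - a%:P) ^+ k %| PP (cst q) (C *: z')).
  by rewrite polarZ dvdp_nonroot.
rewrite CE /ctau /tau -scaleNr polarD !polarZ.
by apply: dvdp_add; [exact: dvdp_mull|apply/dvdp_mulr; rewrite dvdpNr dvdp_mull].
Qed.

End Half.

Section Both.
Variables (r : 'rV[K]_3) (z z' : 'rV[{poly K}]_3) (C C' : {poly K}).
Hypotheses (pz : prim z) (pz' : prim z').
Hypotheses (C0 : C != 0) (CE : C *: z' = tauP r z).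
Hypotheses (C0' : C' != 0) (CE' : C' *: z = tauP r z').
Hypotheses (r0 : r != 0) (Fr : F r = 0).

Lemma pair_vprod_eq a x k : F x = 0 -> P x r != 0 -> at_pt a z x ->
  (('X - a%:P) ^+ k %| cont (vprod z (cst x))) =
  (('X - a%:P) ^+ k %| cont (vprod z' (cst x))).
Proof.
move=> Fx Pxr zx; have [_ zx'] := pair_nonroot pz' CE Fx Pxr zx.
by apply/idP/idP; [apply: (pair_dvdp_vprod pz' CE)|apply: (pair_dvdp_vprod pz CE')].
Qed.

Lemma pair_ordv_eq a x : F x = 0 -> P x r != 0 -> at_pt a z x ->
  vprod z (cst x) != 0 -> vprod z' (cst x) != 0 ->
  ordv a (vprod z (cst x)) = ordv a (vprod z' (cst x)).
Proof.
by move=> Fx Pxr zx n0 n0'; apply: ordv_eq => // k; apply: pair_vprod_eq.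
Qed.

(** At a point that is not a base point of the involution at [r], every quantity deciding the order
    of [tauP q] is preserved: the contact with an adjacent base point, the contact with [q], and for
    a flex also the order of [P(q, z)]. *)
Lemma pair_tau_transfer a q : q != 0 -> F q = 0 ->
  vprod z (cst q) != 0 -> vprod z' (cst q) != 0 ->
  tauP q z != 0 -> tauP q z' != 0 ->
  based a z q -> P (ev a z) r != 0 -> ordv a (tauP q z) = ordv a (tauP q z').
Proof.
move=> q0 Fq zq0 zq0' tq0 tq0' b Pr.
suff h k : (('X - a%:P) ^+ k %| cont (tauP q z)) = (('X - a%:P) ^+ k %| cont (tauP q z')).
  exact: ordv_eq.
have zz := at_ptxx a pz; have Fx : F (ev a z) = 0 by case/andP: b => /eqP.
have [_ zz'] := pair_nonroot pz' CE Fx Pr zz.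
have [zq|xq] := based_cases pz Fq b; last first.
  rewrite (dvdp_tau_adj K2 smooth_c _ xq zz) (dvdp_tau_adj K2 smooth_c _ xq zz').
  exact: pair_vprod_eq.
have zq' : at_pt a z' q by apply: at_pt_trans zz zz' zq.
have Pqr : P q r != 0 by rewrite -(at_pt_polar _ q0 zq).
have mE := pair_ordv_eq Fq Pqr zq zq0 zq0'.
have [y0 [y1 [D0 P1 P0]]] := pencil_basis smooth_c q0 Fq.
have [fl|nfl] := eqVneq (P y1 q) 0; last first.
  have [_ e1] := tau_center_nonflex K2 D0 Fq P1 P0 nfl zq0 zq.
  have [_ e2] := tau_center_nonflex K2 D0 Fq P1 P0 nfl zq0' zq'.
  by rewrite -!ordv_geq // e1 e2 mE.
have [|mk] := leqP (ordv a (vprod z (cst q))) k; last first.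
  have d1 : ('X - a%:P) ^+ (ordv a (vprod z (cst q)) + 0) %| cont (tauP q z).
    by rewrite (tau_center_flex K2 smooth_c D0) // leq0n expr0 dvd1p.
  have d2 : ('X - a%:P) ^+ (ordv a (vprod z' (cst q)) + 0) %| cont (tauP q z').
    by rewrite (tau_center_flex K2 smooth_c D0) // leq0n expr0 dvd1p.
  rewrite !(dvdp_trans _ d1) ?(dvdp_trans _ d2) // dvdp_exp2l // addn0 -?mE ltnW //.
move=> /subnKC <-; set j := (k - _)%N.
rewrite (tau_center_flex K2 smooth_c D0) // mE (tau_center_flex K2 smooth_c D0) //.
have [jm|//] := leqP j _; rewrite /=; apply/idP/idP.
  by apply: (pair_dvdp_polar pz' CE) => //; rewrite mE.
exact: (pair_dvdp_polar pz CE').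
Qed.

(** By [adj_inj] no third point is a base point for both centres. A common base point must therefore
    be [q] with an edge to [r], or [r] with an edge to [q]; the two disjunctions exclude this. *)
Lemma adj_shared a q : based a z q -> F q = 0 -> vprod q r != 0 ->
  ~~ adj q r || ~~ at_pt a z q -> ~~ adj r q || ~~ at_pt a z r -> q != 0 ->
  P (ev a z) r != 0.
Proof.
move=> b Fq qr nq nr q0; apply/negP => /eqP Pr.
have Fx : F (ev a z) = 0 by case/andP: b => /eqP.
have [zq|xq] := based_cases pz Fq b.
  move: nq; rewrite zq orbF => /negP[]; rewrite /adjacent qr Fq Fr eqxx.
  by rewrite -(at_pt_polar _ q0 zq) Pr eqxx.
have [e|xr0] := eqVneq (vprod (ev a z) r) 0; last first.
  have xr : adj (ev a z) r by rewrite /adjacent xr0 Fx Fr Pr eqxx.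
  by move: qr; rewrite (adj_inj smooth_c xq xr) eqxx.
have zr : at_pt a z r by rewrite at_pt_eq0 // e.
move: nr; rewrite zr orbF => /negP[]; rewrite /adjacent vprodC oppr_eq0 qr Fq Fr eqxx.
by rewrite -(at_pt_polar _ r0 zr); case/andP: b.
Qed.

End Both.

Definition linked r z z' :=
  [/\ prim z, prim z', (exists2 C, C != 0 & C *: z' = tauP r z)
    & (exists2 C, C != 0 & C *: z = tauP r z')].

Lemma linked_sym r z z' : linked r z z' -> linked r z' z.
Proof. by case. Qed.

Section Linked.
Variable r : 'rV[K]_3.
Hypotheses (r0 : r != 0) (Fr : F r = 0).

Lemma linked_vprod z z' a x : linked r z z' -> F x = 0 ->
  vprod x r != 0 -> ~~ adj x r -> vprod z (cst x) != 0 -> vprod z' (cst x) != 0 ->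
  ordv a (vprod z (cst x)) = ordv a (vprod z' (cst x)).
Proof.
move=> l Fx xr nxr z0 z0'.
have Pxr : P x r != 0 by apply: contra nxr => e; rewrite /adjacent xr Fx Fr e eqxx.
have [pz pz' [C C0 CE] [C' C0' CE']] := l.
have [zx|nzx] := boolP (at_pt a z x); first exact: (pair_ordv_eq pz pz' CE CE').
have [zx'|nzx'] := boolP (at_pt a z' x); last by rewrite !ordv_vprod_eq0.
exact/esym/(pair_ordv_eq pz' pz CE' CE).
Qed.

Lemma linked_transfer z z' a q : linked r z z' -> q != 0 -> F q = 0 ->
  vprod z (cst q) != 0 -> vprod z' (cst q) != 0 ->
  tauP q z != 0 -> tauP q z' != 0 -> vprod q r != 0 -> based a z q ->
  ~~ adj q r || ~~ at_pt a z q -> ~~ adj r q || ~~ at_pt a z r ->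
  ordv a (tauP q z) = ordv a (tauP q z') /\
  forall x, x != 0 -> at_pt a z' x = at_pt a z x.
Proof.
move=> [pz pz' [C C0 CE] [C' C0' CE']] q0 Fq zq zq' tq tq' qr b n1 n2.
have Pr := adj_shared pz r0 Fr b Fq qr n1 n2 q0.
split; first exact: (pair_tau_transfer pz pz' CE CE').
have zz := at_ptxx a pz; have Fx : F (ev a z) = 0 by case/andP: b => /eqP.
have [_ zz'] := pair_nonroot pz' CE Fx Pr zz.
by move=> x x0; apply/idP/idP => h; [apply: at_pt_trans zz' zz h|apply: at_pt_trans zz zz' h].
Qed.

Lemma linked_tau z z' a q : linked r z z' -> q != 0 -> F q = 0 ->
  vprod z (cst q) != 0 -> vprod z' (cst q) != 0 ->
  tauP q z != 0 -> tauP q z' != 0 -> vprod q r != 0 -> ~~ adj q r -> ~~ adj r q ->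
  ordv a (tauP q z) = ordv a (tauP q z').
Proof.
move=> l q0 Fq zq zq' tq tq' qr n1 n2; have [pz pz' _ _] := l.
have [b|nb] := boolP (based a z q).
  by case: (linked_transfer l q0 Fq zq zq' tq tq' qr b); rewrite ?n1 ?n2.
have [b|nb'] := boolP (based a z' q); last by rewrite !based_tau.
by case: (linked_transfer (linked_sym l) q0 Fq zq' zq tq' tq qr b); rewrite ?n1 ?n2.
Qed.

(** Here [r] is a base point for [q]. Where the curve passes through [r], the common factor for [q]
    is the contact with [r] by [dvdp_tau_adj]; at other base points for [q], both orders
    transfer. *)
Lemma linked_tau_fiber z z' a q : linked r z z' -> q != 0 -> F q = 0 ->
  vprod z (cst q) != 0 -> vprod z' (cst q) != 0 ->
  vprod z (cst r) != 0 -> vprod z' (cst r) != 0 ->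
  tauP q z != 0 -> tauP q z' != 0 -> vprod q r != 0 -> adj r q ->
  (ordv a (tauP q z) + ordv a (vprod z' (cst r)) =
   ordv a (tauP q z') + ordv a (vprod z (cst r)))%N.
Proof.
move=> l q0 Fq zq zq' zr zr' tq tq' qr rq; have [pz pz' _ _] := l.
have n1 := adj_asym smooth_c rq.
have H (y : 'rV[{poly K}]_3) : prim y -> vprod y (cst r) != 0 -> tauP q y != 0 ->
    ~~ based a y q || at_pt a y r -> ordv a (tauP q y) = ordv a (vprod y (cst r)).
  move=> py yr ty; have [yar _|nyr] := boolP (at_pt a y r); last first.
    rewrite orbF => nb; rewrite based_tau // ordv_vprod_eq0 //.
  by apply: ordv_eq => // k; apply: dvdp_tau_adj.
have T (y y' : 'rV[{poly K}]_3) : linked r y y' -> vprod y (cst q) != 0 -> vprod y' (cst q) != 0 ->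
    tauP q y != 0 -> tauP q y' != 0 -> based a y q -> ~~ at_pt a y r ->
    ordv a (tauP q y) = ordv a (tauP q y') /\
    ordv a (vprod y (cst r)) = ordv a (vprod y' (cst r)).
  move=> ly yq yq' ty ty' b nyr; have [py py' _ _] := ly.
  have [||-> e] := linked_transfer ly q0 Fq yq yq' ty ty' qr b; rewrite ?n1 ?nyr ?orbT //.
  by rewrite !ordv_vprod_eq0 // e.
have [h|] := boolP (~~ based a z q || at_pt a z r); last first.
  rewrite negb_or negbK => /andP[b nzr].
  by have [-> ->] := T z z' l zq zq' tq tq' b nzr.
have [h'|] := boolP (~~ based a z' q || at_pt a z' r).
  by rewrite (H z) // (H z') // addnC.
rewrite negb_or negbK => /andP[b nzr].
by have [-> ->] := T z' z (linked_sym l) zq' zq tq' tq b nzr.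
Qed.

(** Here [q] is a base point for [r], and it is not a flex since its tangent line meets the cubic
    again at [r]. Where the curve passes through [q] the common factor is twice the contact; at
    other base points for [q], orders transfer. The vector [r] plays the role of [y1]. *)
Lemma linked_tau_base z z' a q : linked r z z' -> q != 0 -> F q = 0 ->
  vprod z (cst q) != 0 -> vprod z' (cst q) != 0 ->
  tauP q z != 0 -> tauP q z' != 0 -> vprod q r != 0 -> adj q r ->
  (ordv a (tauP q z) + 2 * ordv a (vprod z' (cst q)) =
   ordv a (tauP q z') + 2 * ordv a (vprod z (cst q)))%N.
Proof.
move=> l q0 Fq zq zq' tq tq' qr qr'; have [pz pz' _ _] := l.
have n2 := adj_asym smooth_c qr'.
have [y0 D0] := det3_compl qr.
have Pqr : P q r = 0 by case/and4P: qr' => _ _ _ /eqP.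
have H (y : 'rV[{poly K}]_3) : prim y -> vprod y (cst q) != 0 -> tauP q y != 0 ->
    ~~ based a y q || at_pt a y q -> ordv a (tauP q y) = (2 * ordv a (vprod y (cst q)))%N.
  move=> py yq ty; have [yaq _|nyq] := boolP (at_pt a y q); last first.
    by rewrite orbF => nb; rewrite based_tau // ordv_vprod_eq0.
  by case: (tau_center_nonflex K2 D0 Fq Pqr (adj_grad smooth_c qr' D0)
      (adj_tangent smooth_c qr') yq yaq).
have T (y y' : 'rV[{poly K}]_3) : linked r y y' -> vprod y (cst q) != 0 -> vprod y' (cst q) != 0 ->
    tauP q y != 0 -> tauP q y' != 0 -> based a y q -> ~~ at_pt a y q ->
    ordv a (tauP q y) = ordv a (tauP q y') /\
    ordv a (vprod y (cst q)) = ordv a (vprod y' (cst q)).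
  move=> ly yq yq' ty ty' b nyq; have [py py' _ _] := ly.
  have [||-> e] := linked_transfer ly q0 Fq yq yq' ty ty' qr b; rewrite ?n2 ?nyq ?orbT //.
  by rewrite !ordv_vprod_eq0 // e.
have [h|] := boolP (~~ based a z q || at_pt a z q); last first.
  rewrite negb_or negbK => /andP[b nzr].
  by have [-> ->] := T z z' l zq zq' tq tq' b nzr.
have [h'|] := boolP (~~ based a z' q || at_pt a z' q).
  by rewrite (H z) // (H z') // addnC.
rewrite negb_or negbK => /andP[b nzr].
by have [-> ->] := T z' z (linked_sym l) zq' zq tq' tq b nzr.
Qed.

(* With z = g Y + B r, the orders of contact of z and of its image with x add *)
(* up to the order of contact of Y with the line through r and x.             *)
Lemma linked_tangent z z' a x : linked r z z' -> adj x r ->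
  PP (cst x) z != 0 -> vprod z (cst x) != 0 -> vprod z' (cst x) != 0 ->
  vprod z (cst r) != 0 -> PP z (cst r) != 0 ->
  mup a (PP (cst x) z) = (ordv a (vprod z (cst x)) + ordv a (vprod z' (cst x))
                         + ordv a (vprod z (cst r)))%N.
Proof.
move=> [pz pz' [C C0 CE] _] xr Pxz zx zx' zr Pzr.
have /and4P[xr0 /eqP Fx _ /eqP Pxr] := xr.
have [w D0] := det3_compl xr0.
have D0' : det3 r x w != 0.
  by rewrite (_ : det3 r x w = - det3 x r w) ?oppr_eq0 // /det3 /dotp !vec3E; ring.
have Pxw := adj_grad smooth_c xr D0; have Prx := adj_tangent smooth_c xr.
have [A [B [W zE]]] := comb3P D0 z; have [A' [B' [W' zE']]] := comb3P D0 z'.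
have swap U1 U2 U3 : comb3 x r w U1 U2 U3 = comb3 r x w U2 U1 U3.
  by rewrite /comb3 [X in X + _]addrC.
have PxzE : PP (cst x) z = W * (P x w)%:P.
  by rewrite zE !polarD !polarZ !cstE polarvv Fx Pxr mulr0 rmorph0 !mulr0 !add0r.
have W0 : W != 0 by apply: contraNneq Pxz => e; rewrite PxzE e mul0r.
have -> : mup a (PP (cst x) z) = mup a W by rewrite PxzE mupMl // rootC.
have kx k : (('X - a%:P) ^+ k %| cont (vprod z (cst x))) =
    (('X - a%:P) ^+ k %| B) && (('X - a%:P) ^+ k %| W) by rewrite zE dvdp_comb3_vprod.
have kr k : (('X - a%:P) ^+ k %| cont (vprod z (cst r))) =
    (('X - a%:P) ^+ k %| A) && (('X - a%:P) ^+ k %| W).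
  by rewrite zE swap dvdp_comb3_vprod.
set m := ordv a (vprod z (cst r)); set n := mup a W.
have [W1 W1a WE] := mup_decomp a W0; rewrite -/n in WE.
have : ('X - a%:P) ^+ m %| cont (vprod z (cst r)) by rewrite -ordv_geq.
rewrite kr => /andP[/dvdpP[A1 AE] mW].
have mn : (m <= n)%N by rewrite mup_geq.
have at_x (y : 'rV[{poly K}]_3) U1 U2 U3 : prim y -> y = comb3 x r w U1 U2 U3 -> at_pt a y x ->
    [&& ~~ root U1 a, root U2 a & root U3 a].
  move=> py yE; rewrite (at_pt_eq0 _ _ py) yE ev_comb3_vprod_eq0 // => /andP[h2 h3].
  by have := py a; rewrite yE ev_comb3_eq0 // h2 h3 !andbT.
(* If [m = n], then [Y] is off the line through [r] and [x] at [a], and neither [z] nor [z'] passes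
   through [x] there: both contacts are zero. *)
have [mnE|] := eqVneq m n.
  rewrite !ordv_vprod_eq0 // ?mnE //; last first.
    apply/negP => /(at_x _ _ _ _ pz zE)/and3P[rA _ rW]; case/negP: rA.
    have n0 : (0 < n)%N by rewrite -XsubC_dvd // dvdp_XsubCl.
    rewrite AE rootM mnE -(prednK n0) exprS rootM root_XsubC eqxx !orbT //.
  apply/negP => /(at_x _ _ _ _ pz' zE')/and3P[rA _ rW].
  have [eA _ eW] : [/\ C * A' = PP z (cst r) * A,
      C * B' = PP z (cst r) * B - 2%:R * FP z & C * W' = PP z (cst r) * W].
    apply: (comb3_inj D0); rewrite /comb3 -!scalerA -!scalerDr -/(comb3 x r w A' B' W') -zE' CE.
    rewrite /ctau /tau {2}zE /comb3 scalerBl !scalerDr !scalerA.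
    by rewrite -!addrA; congr (_ + (_ + _)); rewrite addrC.
  have AW : A' * W = A * W'.
    by apply: (mulfI C0); rewrite mulrA eA mulrCA eW; ring.
  have : A' * W1 = A1 * W'.
    apply: (mulfI (XsubC_exp_neq0 a n)); rewrite mulrCA -WE AW AE mnE; ring.
  move/(congr1 (fun p => root p a)); rewrite !rootM rW orbT (negPf W1a) orbF.
  by rewrite (negPf rA).
(* Otherwise [om = W / g] vanishes at [a] and [A1] does not, so that [Y] points towards [x]. *)
move=> mn'; have {mn mn'} mn : (m < n)%N by rewrite ltn_neqAle mn' mn.
pose g : {poly K} := ('X - a%:P) ^+ m; pose om := ('X - a%:P) ^+ (n - m) * W1.
have WgE : W = g * om by rewrite mulrA -exprD subnKC 1?ltnW.
have om0 : om != 0 by apply: contraNneq W0 => e; rewrite WgE e mulr0.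
have mup_om : mup a om = (n - m)%N by rewrite /om mupMl // mupX.
have om_a : om.[a] = 0.
  apply/eqP; rewrite -/(root _ _) -dvdp_XsubCl XsubC_dvd // mup_om subn_gt0 //.
clearbody om.
have W_a : root W a by rewrite WgE rootM /root om_a eqxx orbT.
have A1a : ~~ root A1 a.
  apply/negP; rewrite -dvdp_XsubCl => dA; have := ltnn m; rewrite {2}/m ordv_geq // kr.
  by rewrite AE exprS dvdp_mul // -exprS -mup_geq // mn.
pose Y := A1 *: cst x + om *: cst w.
have zY : z = g *: Y + B *: cst r.
  by rewrite zE /comb3 AE WgE /Y scalerDr !scalerA [g * A1]mulrC addrAC.
pose s1 := A1 * (spol c x w r)%:P + om * (P w r)%:P.
pose s2 := A1 ^+ 2 * (P x w)%:P + A1 * om * (P w x)%:P + om ^+ 2 * (F w)%:P.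
have PYr : PP Y (cst r) = om * s1 by rewrite polar_comb2 !cstE Pxr /s1; ring.
have FY : FP Y = om * s2 by rewrite cub_comb2 !cstE Fx /s2; ring.
have PrY : PP (cst r) Y = A1 * (P r x)%:P + om * (P r w)%:P.
  by rewrite polarD !polarZ !cstE.
pose E := g * (om * s1) + 2%:R * B * PP (cst r) Y.
pose t := - (2%:R * g * s2 + B * s1).
have tauE : tauP r z = g ^+ 2 *: comb3 x r w (E * A1) (om * t) (om * E).
  rewrite {1}zY /ctau tau_line ?cst_cub ?Fr // PYr FY -/E; congr (_ *: _).
  rewrite /comb3 addrAC /Y scalerDr !scalerA [E * om]mulrC; congr (_ + _ *: _).
  by rewrite /t; ring.
have g0 : g != 0 := XsubC_exp_neq0 a m.
have g20 : g ^+ 2 != 0 by rewrite expf_neq0.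
have mup_g2 : mup a (g ^+ 2) = (2 * m)%N by rewrite -exprM mupX mulnC.
have uB : ~~ root (2%:R * PP (cst r) Y) a.
  rewrite PrY /root -polyC_natr !(hornerM, hornerD, hornerC) om_a mul0r addr0.
  by rewrite !mulf_neq0.
have E_a : root E a = root B a.
  rewrite /root (_ : E.[a] = B.[a] * (2%:R * PP (cst r) Y).[a]).
    by rewrite mulf_eq0 -/(root (2%:R * PP (cst r) Y) a) (negPf uB) orbF.
  rewrite /E mulrAC; move: (2%:R * _) => p.
  by rewrite !(hornerM, hornerD) om_a mul0r mulr0 add0r mulrC.
(* If [B] vanishes at [a], then [z], being primitive, is at [x] and cannot be at [r]. *)
have tB : root B a -> m = 0%N.
  move=> Ba; apply/eqP; rewrite -leqn0 leqNgt; apply/negP => m0.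
  have := pz a; rewrite zE ev_comb3_eq0 // Ba W_a !andbT AE.
  by rewrite rootM -(prednK m0) exprS rootM root_XsubC eqxx !orbT.
have Vx k : (('X - a%:P) ^+ k %| cont (vprod (comb3 x r w (E * A1) (om * t) (om * E)) (cst x)))
    = (('X - a%:P) ^+ k %| om).
  rewrite dvdp_comb3_vprod //.
  apply/andP/idP => [[h1 h2]|h]; last by split; apply: dvdp_mulr.
  have [Ba|Ba] := boolP (root B a); last first.
    by rewrite mulrC dvdp_nonroot ?E_a // in h2.
  move: h1; rewrite mulrC dvdp_nonroot //.
  rewrite /t /g tB // expr0 mulr1 rootN /root.
  have -> : (2%:R * s2 + B * s1).[a] = 2%:R * (A1.[a] ^+ 2 * P x w).
    rewrite -polyC_natr hornerD 2!hornerM (eqP Ba) mul0r addr0 hornerC /s2.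
    by rewrite !(hornerD, hornerM, hornerC, horner_exp) om_a; ring.
  by rewrite !mulf_neq0 ?expf_neq0.
set V := comb3 x r w _ _ _ in tauE Vx.
have Vx0 : vprod V (cst x) != 0.
  have : ~~ (('X - a%:P) ^+ (n - m).+1 %| om) by rewrite -mup_geq // mup_om ltnn.
  by rewrite -Vx; apply: contraNneq => ->; rewrite cont0 dvdp0.
have V0 : V != 0 by apply: contraNneq Vx0 => ->; rewrite /vprod !mxE; apply/eqP/row3P; rewrite !vec3E mxE; ring.
have oV : ordv a (vprod V (cst x)) = (n - m)%N.
  apply/eqP; rewrite eqn_leq -ltnS; apply/andP; split.
    by rewrite ltnNge ordv_geq // Vx -mup_geq // mup_om ltnn.
  by rewrite ordv_geq // Vx -mup_geq // mup_om.
have mupC : mup a C = ordv a (tauP r z) by rewrite -CE ordv_prim.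
have oC : mup a C = (2 * m + ordv a (vprod z (cst x)))%N.
  rewrite mupC; have [Ba|Ba] := boolP (root B a); last first.
    rewrite (ordv_vprod_eq0 pz) ?addn0 ?tauE ?ordv_prim //; last first.
      by apply: contra Ba => /(at_x _ _ _ _ pz zE)/and3P[].
    by rewrite ev_comb3_eq0 // !rootM negb_and E_a (negPf Ba) (negPf A1a).
  rewrite tB // muln0 add0n; apply: ordv_eq => //.
    by rewrite tauE scalev_neq0.
  move=> k; apply: dvdp_tau_adj => //; rewrite at_pt_eq0 // zE ev_comb3_vprod_eq0 //.
  by rewrite Ba W_a.
have : ordv a (C *: vprod z' (cst x)) = ordv a (g ^+ 2 *: vprod V (cst x)).
  by rewrite -!vprodZl CE tauE.
rewrite !ordvZ // oC mup_g2 oV -addnA => /addnI ->.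
by rewrite subnK // ltnW.
Qed.

End Linked.
End Pairs.

(** * Degrees of parametrized curves *)

Section Tops.
Variable R : idomainType.
Implicit Types (p s : {poly R}) (d n : nat) (z : 'rV[{poly R}]_3) (v : 'rV[R]_3).

(** [l] may be zero: [d] acts as a homogeneous degree and [l] as the value at the parameter at
    infinity. The degree is exact once [l] is nonzero. *)
Definition top d p (l : R) := (size p <= d.+1)%N /\ p`_d = l.

Lemma top0 d : top d 0 0.
Proof. by split; rewrite ?size_poly0 ?coef0. Qed.

Lemma topD d p s l l' : top d p l -> top d s l' -> top d (p + s) (l + l').
Proof.
move=> [hp <-] [hs <-]; split; last by rewrite coefD.
by apply: leq_trans (size_polyD _ _) _; rewrite geq_max hp.
Qed.

Lemma topN d p l : top d p l -> top d (- p) (- l).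
Proof. by move=> [hp <-]; split; rewrite ?size_polyN ?coefN. Qed.

Lemma topC (l : R) : top 0 l%:P l.
Proof. by split; rewrite ?size_polyC ?coefC //; case: (l != 0). Qed.

Lemma topM d n p s l l' : top d p l -> top n s l' -> top (d + n) (p * s) (l * l').
Proof.
move=> [hp <-] [hs <-]; split.
  by apply: leq_trans (size_polyMleq _ _) _; move: hp hs; lia.
have dn : (d < (d + n).+1)%N by lia.
rewrite coefM (bigD1 (Ordinal dn)) //= addKn big1 ?addr0 // => i.
rewrite -val_eqE /= => ne; case: (ltnP i d) => id.
  by rewrite [s`__]nth_default ?mulr0 //; apply: leq_trans hs _; lia.
by rewrite nth_default ?mul0r //; apply: leq_trans hp _; lia.
Qed.

Lemma top_sum (I : Type) (r : seq I) d (f : I -> {poly R}) (l : I -> R) :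
  (forall i, top d (f i) (l i)) -> top d (\sum_(i <- r) f i) (\sum_(i <- r) l i).
Proof.
move=> h; elim: r => [|i r IH]; first by rewrite !big_nil; apply: top0.
by rewrite !big_cons; apply: topD.
Qed.

Lemma top_neq0 d p l : top d p l -> l != 0 -> p != 0 /\ size p = d.+1.
Proof.
move=> [hp <-] pd; have p0 : p != 0 by apply: contraNneq pd => ->; rewrite coef0.
split=> //; apply/eqP; rewrite eqn_leq hp ltnNge; apply: contra pd => h.
by rewrite nth_default.
Qed.

Definition topv d z (v : 'rV[R]_3) := forall i, top d (z 0 i) (v 0 i).

Lemma topvZ d n p l z v : top d p l -> topv n z v -> topv (d + n) (p *: z) (l *: v).
Proof. by move=> hp hz i; rewrite !mxE; apply: topM. Qed.

Lemma topvB d z z' v v' : topv d z v -> topv d z' v' -> topv d (z - z') (v - v').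
Proof. by move=> h h' i; rewrite !mxE; apply: topD => //; apply: topN. Qed.

Lemma topv_vprod d n z z' v v' : topv d z v -> topv n z' v' ->
  topv (d + n) (vprod z z') (vprod v v').
Proof.
by move=> h h'; apply: ord3P; rewrite !vec3E; apply: topD; try apply: topN;
  apply: topM.
Qed.

Lemma topv_neq0 d z v : topv d z v -> v != 0 -> z != 0.
Proof.
move=> h /row3_neq0[i vi]; have [z0 _] := top_neq0 (h i) vi.
by apply: contraNneq z0 => ->; rewrite mxE.
Qed.

Lemma topv_div d p z v : p != 0 -> v != 0 -> topv d (p *: z) v ->
  exists2 n, d = ((size p).-1 + n)%N &
  exists2 v', v' != 0 & topv n z v' /\ lead_coef p *: v' = v.
Proof.
move=> p0 /row3_neq0[i vi] h; have sp : (0 < size p)%N by rewrite size_poly_gt0.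
have [pz0 spz] := top_neq0 (h i) vi; rewrite mxE in pz0 spz.
have zi0 : z 0 i != 0 by apply: contraNneq pz0 => ->; rewrite mulr0.
have szi : (0 < size (z 0 i)%R)%N by rewrite size_poly_gt0.
rewrite size_mul // in spz.
have dE : d = ((size p).-1 + (d - (size p).-1))%N.
  by move: sp szi spz; move: (size p) (size (z 0 i)) => a b; lia.
exists (d - (size p).-1)%N => //.
pose v' := \row_j (z 0 j)`_(d - (size p).-1).
have hz : topv (d - (size p).-1) z v'.
  move=> j; rewrite mxE; split=> //; have [->|zj0] := eqVneq (z 0 j) 0.
    by rewrite size_poly0.
  have [] := h j; rewrite mxE size_mul // => + _; move: sp dE.
  by move: (size p) (size (z 0 j)) => a b; lia.
have e : lead_coef p *: v' = v.
  apply/rowP => j; have [_ <-] := h j; have tp : top (size p).-1 p (lead_coef p).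
    by split; rewrite ?prednK.
  by have [_ e1] := topM tp (hz j); rewrite -dE in e1; rewrite [LHS]mxE -e1 [in RHS]mxE.
exists v' => //; apply: contraNneq vi => v0.
by rewrite -e v0 scaler0 mxE.
Qed.

Variable c : 'I_3 -> 'I_3 -> 'I_3 -> R.
Let cP i j k := (c i j k)%:P.

Lemma top_tri d1 d2 d3 z1 z2 z3 v1 v2 v3 :
  topv d1 z1 v1 -> topv d2 z2 v2 -> topv d3 z3 v3 ->
  top (d1 + d2 + d3) (tri cP z1 z2 z3) (tri c v1 v2 v3).
Proof.
move=> h1 h2 h3; do 3 apply: top_sum => ?; rewrite -[(_ + _ + _)%N]add0n.
by apply: topM; [exact: topC|do 2 apply: topM => //].
Qed.

Lemma top_cub d z v : topv d z v -> top (d + d + d) (cub cP z) (cub c v).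
Proof. by move=> h; apply: top_tri. Qed.

Lemma top_polar d n z z' v v' : topv d z v -> topv n z' v' ->
  top (d + d + n) (polar cP z z') (polar c v v').
Proof.
move=> h h'; apply: topD; [apply: topD|exact: top_tri].
  by rewrite addnC addnA; apply: top_tri.
by rewrite addnAC; apply: top_tri.
Qed.

Lemma topv_cst (v : 'rV[R]_3) : topv 0 (map_mx polyC v) v.
Proof. by move=> i; rewrite mxE; apply: topC. Qed.

Lemma topv_tau d z q v : topv d z v ->
  topv (d + d + d) (tau cP (map_mx polyC q) z) (tau c q v).
Proof.
move=> h; have hq := topv_cst q; apply: topvB.
  by apply: topvZ => //; rewrite -[(d + d)%N]addn0; apply: top_polar.
rewrite -[(_ + _)%N]addn0; apply: topvZ => //; rewrite -[(_ + _)%N]add0n.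
by apply: topM; [rewrite -polyC_natr; apply: topC|apply: top_cub].
Qed.

Lemma top_discr d z q v : topv d z v ->
  top (d + d + (d + d)) (discr cP (map_mx polyC q) z) (discr c q v).
Proof.
move=> h; have hq := topv_cst q; apply: topD; last apply: topN.
  have hp := top_polar h hq; rewrite addn0 in hp.
  exact: topM.
rewrite [X in top X](_ : _ = (0 + (d + d + d) + (0 + 0 + d))%N); last by rewrite !add0n addnA.
apply: topM; last exact: top_polar.
by apply: topM; [rewrite -polyC_natr; apply: topC|apply: top_cub].
Qed.

End Tops.

(** * Global laws for degrees, passages and common factors *)

Section Heights.
Variables (K : closedFieldType) (c : 'I_3 -> 'I_3 -> 'I_3 -> K).
Hypothesis K2 : 2%:R != 0 :> K.
Hypothesis smooth_c :
  forall v : 'rV[K]_3, v != 0 -> cub c v = 0 -> exists w, polar c v w != 0.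
Implicit Types (z : 'rV[{poly K}]_3) (x y q r w : 'rV[K]_3) (a : K).

Local Notation F := (cub c).
Local Notation P := (polar c).
Let cP i j k := (c i j k)%:P.
Local Notation FP := (cub cP).
Local Notation PP := (polar cP).
Local Notation tauP := (ctau c).
Local Notation adj := (adjacent c).

Definition dg (p : {poly K}) := (size p).-1.

Lemma dgM (p s : {poly K}) : p != 0 -> s != 0 -> dg (p * s) = (dg p + dg s)%N.
Proof.
move=> p0 s0; rewrite /dg size_mul //.
move: p0 s0; rewrite -!size_poly_gt0; move: (size p) (size s) => m n; lia.
Qed.

Lemma dg_mup (p s : {poly K}) : p != 0 -> s != 0 -> (forall a, mup a p = mup a s) ->
  dg p = dg s.
Proof. by move=> p0 s0 h; rewrite /dg (eqp_mup_size p0 s0 h). Qed.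

Lemma top_dg d (p : {poly K}) l : top d p l -> l != 0 -> p != 0 /\ dg p = d.
Proof. by move=> h l0; have [p0 e] := top_neq0 h l0; rewrite /dg e. Qed.

Lemma dg_contZ (p : {poly K}) z : p != 0 -> z != 0 ->
  dg (cont (p *: z)) = (dg p + dg (cont z))%N.
Proof.
by move=> p0 z0; rewrite -dgM ?cont_eq0 // /dg (eqp_size (contZ p z)).
Qed.

Lemma prim_cont z : prim z <-> size (cont z) = 1%N.
Proof.
split=> [pz|s1 a].
  apply/eqP; apply: contraT => /closed_rootP[a]; rewrite -dvdp_XsubCl -ev_eq0.
  by rewrite (negPf (pz a)).
by rewrite ev_eq0 dvdp_XsubCl; have /eqP/size_poly1P[l l0 ->] := s1; rewrite rootC.
Qed.

(* For a rational curve parametrized by z: the number of passages through x, *)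
(* and the degree of the factor to be removed from its image under tau q.    *)
Definition mult z x := dg (cont (vprod z (cst x))).
Definition hits z q := dg (cont (tauP q z)).

Variable o : 'rV[K]_3.
Hypothesis Fo : F o = 0.

(* The parameter at infinity gives the point o of the cubic. All involutions *)
(* fix o, so that no cancellation of leading coefficients occurs.            *)
Definition good d z := prim z /\ exists2 l, l != 0 & topv d z (l *: o).
(** These conditions keep the values at infinity of [tau], [P(z, q)] and [P(q, z)] nonzero, so that
    their degrees are exact. *)
Definition avoids q := [&& F q == 0, P o q != 0 & P q o != 0].

Section Letter.
Variable q : 'rV[K]_3.
Hypothesis qA : avoids q.

Lemma avoids_cub : F q = 0. Proof. by case/and3P: qA => /eqP. Qed.

Lemma avoids_oq : P o q != 0. Proof. by case/and3P: qA. Qed.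

Lemma avoids_qo : P q o != 0. Proof. by case/and3P: qA. Qed.

Lemma avoids_vprod : vprod o q != 0.
Proof.
apply/eqP => e; have o0 : o != 0.
  by apply: contraNneq avoids_oq => ->; rewrite -(scale0r 0) polarZl expr0n mul0r.
have [t qE] := vprod_eq0 o0 e; have := avoids_oq.
by rewrite qE polarZ polarvv Fo !mulr0 eqxx.
Qed.

Lemma avoids_neq0 : q != 0. Proof. by case: (vprod_neq0 avoids_vprod). Qed.

Variables (d : nat) (z : 'rV[{poly K}]_3).
Hypothesis gz : good d z.

Lemma good_vprod : vprod z (cst q) != 0.
Proof.
have [_ [l l0 h]] := gz; have := topv_vprod h (topv_cst q).
move/topv_neq0; apply; rewrite vprodZl scaler_eq0 (negPf l0) /=.
exact: avoids_vprod.
Qed.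

Lemma good_tau : exists2 v, v != 0 & topv (d + d + d) (tauP q z) v /\
  exists2 m, m != 0 & v = m *: o.
Proof.
have [_ [l l0 h]] := gz; exists (tau c q (l *: o)); last first.
  split; first exact: topv_tau.
  exists (l ^+ 3 * P o q); first by rewrite mulf_neq0 ?expf_neq0 ?avoids_oq.
  by rewrite tauZ /tau Fo mulr0 scale0r subr0 scalerA.
rewrite tauZ scaler_eq0 expf_eq0 (negPf l0) /= /tau Fo mulr0 scale0r subr0.
by rewrite scaler_eq0 (negPf avoids_oq) (vprod_neq0 avoids_vprod).1.
Qed.

Lemma good_tau_neq0 : tauP q z != 0.
Proof. by have [v v0 [h _]] := good_tau; apply: topv_neq0 h v0. Qed.

Lemma good_polar_tangent : PP (cst q) z != 0 /\ dg (PP (cst q) z) = d.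
Proof.
have [_ [l l0 h]] := gz; apply: (top_dg (top_polar c (topv_cst q) h)).
by rewrite polarZ mulf_neq0 ?avoids_qo.
Qed.

Lemma good_polar : PP z (cst q) != 0 /\ dg (PP z (cst q)) = (d + d)%N.
Proof.
have [_ [l l0 h]] := gz; have := top_polar c h (topv_cst q).
rewrite addn0 => /top_dg; apply.
by rewrite polarZl mulf_neq0 ?expf_neq0 ?avoids_oq.
Qed.

Lemma good_discr : discr cP (cst q) z != 0.
Proof.
have [_ [l l0 h]] := gz; have /top_dg[|//] := top_discr c q h.
rewrite /discr cubZ Fo !mulr0 mul0r subr0 polarZl.
by rewrite expf_neq0 // mulf_neq0 ?expf_neq0 ?avoids_oq.
Qed.

Lemma good_step : exists d' z', [/\ good d' z', linked c q z z',
  (d' + hits z q = 3 * d)%N & (mult z' q + hits z q = 2 * d + mult z q)%N].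
Proof.
have [z' CE] := dvdp_contP (dvdpp (cont (tauP q z))).
set C := cont _ in CE; have C0 : C != 0 by rewrite cont_eq0 good_tau_neq0.
have [v v0 [hv [m m0 vE]]] := good_tau; rewrite CE in hv.
have [d' dE [v' v'0 [hv' v'E]]] := topv_div C0 v0 hv.
have pz' : prim z'.
  apply/prim_cont; have := eqp_size (contZ C z'); rewrite -CE -/C.
  have c0 : cont z' != 0.
    rewrite cont_eq0; apply: contraNneq good_tau_neq0 => e.
    by rewrite CE e scaler0.
  rewrite size_mul //; move: C0 c0; rewrite -!size_poly_gt0.
  by move: (size C) (size (cont z')) => i j; lia.
have [pz _] := gz; have gz' : good d' z'.
  split=> //; exists ((lead_coef C)^-1 * m); last first.
    by rewrite -scalerA -vE -v'E scalerA mulVf ?scale1r ?lead_coef_eq0.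
  by rewrite mulf_neq0 // invr_eq0 lead_coef_eq0.
(* A second application returns to [z] by [tauK]. As [z] is primitive, [C ^+ 3] must divide the
   scalar, and the quotient is the factor of the return trip. *)
have CE3 : C ^+ 3 *: tauP q z' = (PP z (cst q) ^+ 2 * discr cP (cst q) z) *: z.
  by rewrite -tauZ -CE tauK // cst_cub avoids_cub.
have E0 : PP z (cst q) ^+ 2 * discr cP (cst q) z != 0.
  by rewrite mulf_neq0 ?expf_neq0 ?good_polar.1 ?good_discr.
have : C ^+ 3 %| PP z (cst q) ^+ 2 * discr cP (cst q) z.
  have : C ^+ 3 %| cont (C ^+ 3 *: tauP q z') by rewrite dvdp_contZl.
  rewrite CE3 (eqp_dvdr _ (contZ _ _)).
  have /size_poly1P[l l0 ->] : size (cont z) == 1%N by apply/eqP/prim_cont.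
  by rewrite mulrC mul_polyC dvdpZr.
move=> /dvdpP[C' C'E].
have C30 : C ^+ 3 != 0 by rewrite expf_neq0.
exists d', z'; split=> //.
- split=> //; first by exists C.
  exists C'; first by apply: contraNneq E0 => e; rewrite C'E e mul0r.
  have inj (u u' : 'rV[{poly K}]_3) : C ^+ 3 *: u = C ^+ 3 *: u' -> u = u'.
    move=> e; apply/rowP => i; apply: (mulfI C30).
    by have := congr1 (fun v : 'rV_3 => v 0 i) e; rewrite !mxE.
  by apply: inj; rewrite CE3 C'E scalerA mulrC.
- have -> : hits z q = (size C).-1 by [].
  by move: dE; move: (size C) => j; lia.
(* The term along [q] dies in the product with [q], which leaves [C (z' x q) = P(z, q) (z x q)];
   comparison of degrees gives the second law. *)
have : dg (cont (C *: vprod z' (cst q))) = dg (cont (PP z (cst q) *: vprod z (cst q))).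
  by rewrite -(vprodZl C z') -CE /ctau /tau vprodBl !vprodZl vprodvv scaler0 subr0.
have zq0' : vprod z' (cst q) != 0.
  have [_ [l l0 h]] := gz'; have := topv_vprod h (topv_cst q).
  by move/topv_neq0; apply; rewrite vprodZl scaler_eq0 (negPf l0) avoids_vprod.
rewrite !dg_contZ ?good_polar.1 ?good_vprod // good_polar.2 -/(mult z q) -/(mult z' q).
rewrite /hits -/C; move: (dg C) (mult z q) (mult z' q) => *; lia.
Qed.

End Letter.

Section Laws.
Variables (q : 'rV[K]_3) (d d' : nat) (z z' : 'rV[{poly K}]_3).
Hypotheses (qA : avoids q) (gz : good d z) (gz' : good d' z') (l : linked c q z z').

(** [d] counts the intersections with the tangent line at [x], the zeros of [P(x, z)]. By
    [linked_tangent] each is a passage of [z] through [x] or through [q], or a passage of [z']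
    through [x]. *)
Lemma mult_fiber x : avoids x -> adj x q ->
  (mult z x + mult z' x + mult z q = d)%N.
Proof.
move=> xA xq; have [p0 <-] := good_polar_tangent xA gz.
have [[zx zx'] zq] := (good_vprod xA gz, good_vprod xA gz', good_vprod qA gz).
rewrite /mult -!dgM ?mulf_neq0 ?cont_eq0 //; apply/esym/dg_mup; rewrite ?mulf_neq0 ?cont_eq0 //.
move=> a; rewrite !mupM ?mulf_neq0 ?cont_eq0 //.
by apply: (linked_tangent K2 smooth_c (avoids_cub qA) a l xq) => //; apply: (good_polar qA gz).1.
Qed.

Lemma mult_other x : avoids x -> vprod x q != 0 -> ~~ adj x q -> mult z' x = mult z x.
Proof.
move=> xA xq nx; have [zx zx'] := (good_vprod xA gz, good_vprod xA gz').
apply/esym/dg_mup; rewrite ?cont_eq0 // => a.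
exact: (linked_vprod (avoids_cub qA) a l (avoids_cub xA)).
Qed.

Lemma hits_other x : avoids x -> vprod x q != 0 -> ~~ adj x q -> ~~ adj q x ->
  hits z' x = hits z x.
Proof.
move=> xA xq nx nq; have [zx zx'] := (good_vprod xA gz, good_vprod xA gz').
have [tx tx'] := (good_tau_neq0 xA gz, good_tau_neq0 xA gz').
apply/esym/dg_mup; rewrite ?cont_eq0 // => a.
exact: (linked_tau K2 smooth_c (avoids_neq0 qA) (avoids_cub qA) a l
  (avoids_neq0 xA) (avoids_cub xA)).
Qed.

Lemma hits_fiber x : avoids x -> vprod x q != 0 -> adj q x ->
  (hits z' x + mult z q = hits z x + mult z' q)%N.
Proof.
move=> xA xq qx; have [zx zx'] := (good_vprod xA gz, good_vprod xA gz').
have [zq zq'] := (good_vprod qA gz, good_vprod qA gz').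
have [tx tx'] := (good_tau_neq0 xA gz, good_tau_neq0 xA gz').
rewrite /hits /mult -!dgM ?cont_eq0 //; apply/esym/dg_mup; rewrite ?mulf_neq0 ?cont_eq0 // => a.
rewrite !mupM ?cont_eq0 //.
exact: (linked_tau_fiber K2 smooth_c (avoids_neq0 qA) (avoids_cub qA) a l
  (avoids_neq0 xA) (avoids_cub xA)).
Qed.

Lemma hits_base x : avoids x -> vprod x q != 0 -> adj x q ->
  (hits z' x + 2 * mult z x = hits z x + 2 * mult z' x)%N.
Proof.
move=> xA xq qx; have [zx zx'] := (good_vprod xA gz, good_vprod xA gz').
have [tx tx'] := (good_tau_neq0 xA gz, good_tau_neq0 xA gz').
rewrite /hits /mult !mul2n -!addnn -!dgM ?mulf_neq0 ?cont_eq0 //.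
apply/esym/dg_mup; rewrite ?mulf_neq0 ?cont_eq0 // => a.
rewrite !mupM ?mulf_neq0 ?cont_eq0 // !addnn -!mul2n.
exact: (linked_tau_base K2 smooth_c (avoids_neq0 qA) (avoids_cub qA) a l
  (avoids_neq0 xA) (avoids_cub xA)).
Qed.

End Laws.
End Heights.

(** * Growth of degrees along reduced words *)

Section Growth.
Import Order.TTheory Num.Theory.
Variables (I : eqType) (adj : rel I).
Hypothesis adj_neq : forall x y, adj x y -> x != y.
Hypothesis adj_fun : forall x y z, adj x y -> adj x z -> y = z.
Hypothesis adj_asym : forall x y, adj x y -> ~~ adj y x.
Implicit Types (d : int) (m k : I -> int) (p q r t x : I).

(* [gain d k q] is the increment of the degree under the involution of index *)
(* q; for [adj q r], the involution of r changes the gain of q into [gain] of *)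
(* r plus [weight q r] (lemma gain_down).                                    *)
Definition gain d k q := 2%:Z * d - k q.

Definition weight d m k q r :=
  (d - k q + 2%:Z * m q) + (d - k r + 2%:Z * m r) + 2%:Z * m q.

(** [l] is the last letter applied. The exception [adj p r] is forced: after [p], the sum in
    question is the previous gain of [r] by [gain_up], negative if [r] came just before [p]. For a
    similar reason the third clause omits the edges into the last letter, whose weight is a sum of
    two previous gains by [weight_center]. The last two clauses bound weights together with other
    gains, which makes the invariant inductive. *)
Definition growth_inv (l : option I) d m k :=
  [/\ forall p, l = Some p -> gain d k p < 0,
      forall r, Some r != l -> 0 < gain d k r /\
        (forall p, l = Some p -> 0 < gain d k r + gain d k p \/ adj p r),
      forall q r, adj q r -> Some r != l -> 0 < weight d m k q r,
      forall q p t, l = Some p -> adj q p -> t != p ->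
        0 < weight d m k q p + gain d k t
    & forall q t r, adj q r -> adj t r ->
        0 < weight d m k q r + gain d k t + gain d k r].

(** The laws of the previous part with the geometry removed: [d] is the degree, [m] counts passages,
    [k] is the degree of the common factor. The third equation is the first one read backwards. *)
Definition growth_step r d m k d' m' k' :=
  [/\ d' + k r = 3%:Z * d, m' r + k r = 2%:Z * d + m r, d + k' r = 3%:Z * d',
      forall x, adj x r -> m x + m' x + m r = d
    & [/\ forall x, x != r -> ~~ adj x r -> m' x = m x,
      forall x, x != r -> ~~ adj x r -> ~~ adj r x -> k' x = k x,
      forall x, adj r x -> k' x + m r = k x + m' r
    & forall x, adj x r -> k' x + 2%:Z * m x = k x + 2%:Z * m' x]].

Section Step.
Variables (r : I) (d d' : int) (m m' k k' : I -> int).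
Hypothesis st : growth_step r d m k d' m' k'.

Lemma gain_same : gain d' k' r = - gain d k r.
Proof. by case: st => e1 e2 e3 _ _; rewrite /gain; lia. Qed.

Lemma gain_generic x : x != r -> ~~ adj x r -> ~~ adj r x ->
  gain d' k' x = gain d k x + 2%:Z * gain d k r.
Proof. by case: st => e1 _ _ _ [_ e _ _] h1 h2 h3; rewrite /gain e //; lia. Qed.

Lemma gain_up x : adj r x -> gain d' k' x = gain d k x + gain d k r.
Proof. by case: st => e1 e2 _ _ [_ _ e _] /e h; rewrite /gain; lia. Qed.

Lemma gain_down x : adj x r -> gain d' k' x = gain d k r + weight d m k x r.
Proof.
by case: st => e1 e2 _ e [_ _ _ e'] h; move: (e x h) (e' x h); rewrite /gain /weight; lia.
Qed.

Lemma weight_center q : adj q r -> weight d' m' k' q r = gain d k r + gain d k q.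
Proof.
by case: st => e1 e2 e3 e [_ _ _ e'] h; move: (e q h) (e' q h); rewrite /gain /weight; lia.
Qed.

Lemma weight_self t : adj r t -> weight d' m' k' r t = weight d m k r t + gain d k r.
Proof.
case: st => e1 e2 e3 _ [e4 _ e _] h; have := e _ h; have := e4 t.
rewrite eq_sym (adj_neq h) (adj_asym h) /gain /weight => /(_ isT isT); lia.
Qed.

Lemma weight_fiber q t : adj q t -> adj r t -> q != r ->
  weight d' m' k' q t = weight d m k q t + gain d k r.
Proof.
case: st => e1 e2 e3 _ [e4 e5 e _] h h' ne; have := e _ h'.
have nq : ~~ adj q r.
  by apply/negP => qr; have := adj_neq h'; rewrite (adj_fun qr h) eqxx.
have := e4 t; rewrite eq_sym (adj_neq h') (adj_asym h') => /(_ isT isT).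
have := e4 q ne nq.
have [rq|rq] := boolP (adj r q).
  by have := adj_neq h; rewrite (adj_fun rq h') eqxx.
have := e5 q ne nq rq; rewrite /gain /weight; lia.
Qed.

Lemma weight_other q t : adj q t -> q != r -> t != r ->
  weight d' m' k' q t = weight d m k q t + gain d k r \/
  weight d' m' k' q t = weight d m k q t + 2%:Z * gain d k r.
Proof.
move=> h ne ne'; have [rt|rt] := boolP (adj r t).
  by left; apply: weight_fiber.
case: st => e1 e2 e3 e4 [e5 e6 e7 e8].
have nq : ~~ adj q r by apply/negP => qr; move: ne'; rewrite (adj_fun h qr) eqxx.
have mq := e5 q ne nq.
have [tr|tr] := boolP (adj t r).
  have := e4 t tr; have := e8 t tr; have [rq|rq] := boolP (adj r q).
    by have := e7 q rq; rewrite /gain /weight; lia.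
  by have := e6 q ne nq rq; rewrite /gain /weight; lia.
have := e5 t ne' tr; have := e6 t ne' tr rt; have [rq|rq] := boolP (adj r q).
  by have := e7 q rq; rewrite /gain /weight; lia.
by have := e6 q ne nq rq; rewrite /gain /weight; lia.
Qed.

Lemma growth_invP l : growth_inv l d m k -> Some r != l ->
  0 < gain d k r /\ growth_inv (Some r) d' m' k'.
Proof.
case=> I0 I1 I2 I3 J rl; have [gr gl] := I1 r rl; split=> //.
have Sne (x y : I) : (Some x == Some y) = (x == y) by [].
have lP x : Some x != l \/ l = Some x.
  by have [<-|] := eqVneq (Some x) l; [right|left].
have G1 t : t != r -> 0 < gain d' k' t /\
    (0 < gain d' k' t + gain d' k' r \/ adj r t).
  move=> tr; rewrite gain_same; have [rt|rt] := boolP (adj r t).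
    rewrite gain_up //; split; last by right.
    case: (lP t) => [/I1[]|lt]; first by lia.
    by case: (gl t lt) => [|/adj_asym]; [lia|rewrite rt].
  have [htr|htr] := boolP (adj t r).
    rewrite gain_down //; have := I2 t r htr rl; split; last left; lia.
  rewrite gain_generic //; case: (lP t) => [/I1[]|lt]; first by split; last left; lia.
  case: (gl t lt) => [h|]; last by rewrite (negPf htr).
  have := I0 t lt; split; last left; lia.
split.
- by move=> p [<-]; rewrite gain_same oppr_lt0.
- move=> t; rewrite Sne => tr; have [h1 h2] := G1 t tr; split=> //.
  by move=> p [<-].
- move=> q t qt; rewrite Sne => tr; have [qr|qr] := eqVneq q r.
    rewrite qr in qt *; rewrite weight_self //; case: (lP t) => [lt|lt].
      by have := I2 _ _ qt lt; lia.
    by have := I3 r t r lt qt; rewrite eq_sym tr => /(_ isT).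
  have : 0 < weight d m k q t + gain d k r.
    case: (lP t) => [lt|lt]; first by have := I2 _ _ qt lt; lia.
    by apply: I3 => //; rewrite eq_sym.
  by case: (weight_other qt qr tr) => ->; lia.
- move=> q p t [<-] qr tr; rewrite weight_center //.
  have [htr|htr] := boolP (adj t r).
    by rewrite gain_down //; have := J t q r htr qr; lia.
  have [h1 h2] := G1 t tr; case: (lP q) => [/I1[]|lq]; first by lia.
  have gt : 0 < gain d k t + gain d k q.
    have [|_ /(_ q lq)[|]] := I1 t; first by rewrite lq Sne; apply: contraNneq htr => ->.
      by [].
    by move=> qt; have := adj_fun qr qt => e; rewrite e eqxx in tr.
  have [rt|rt] := boolP (adj r t); first by rewrite gain_up //; lia.
  by rewrite gain_generic //; lia.
(* The common target [s] is [r], or the successor of [r], or neither. In the last case no source is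
   [r], and the weight and the gain of [t] both rise by at least the gain of [r]. *)
- move=> q t s qs ts; have [sr|sr] := eqVneq s r.
    rewrite sr in qs ts *; rewrite weight_center // gain_same gain_down //.
    by have := J t q r ts qs; lia.
  have W : 0 < weight d m k q s + gain d k r.
    case: (lP s) => [ls|ls]; first by have := I2 _ _ qs ls; lia.
    by apply: I3 => //; rewrite eq_sym.
  have [rs|rs] := boolP (adj r s).
    rewrite [gain d' k' s]gain_up //.
    have wE : weight d' m' k' q s = weight d m k q s + gain d k r.
      by have [->|qr] := eqVneq q r; [apply: weight_self|apply: weight_fiber].
    have [->|tr] := eqVneq t r.
      by rewrite gain_same wE; have := J q r s qs rs; lia.
    rewrite gain_generic //; first by rewrite wE; have := J q t s qs ts; lia.
      by apply/negP => htr; have := adj_neq rs; rewrite (adj_fun ts htr) eqxx.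
    by apply/negP => rt; have := adj_neq ts; rewrite (adj_fun rt rs) eqxx.
  have tr : t != r by apply: contraNneq rs => <-.
  have qr : q != r by apply: contraNneq rs => <-.
  have ntr : ~~ adj t r.
    by apply/negP => htr; move: sr; rewrite (adj_fun ts htr) eqxx.
  have tE : gain d k t + gain d k r <= gain d' k' t.
    have [rt|rt] := boolP (adj r t); first by rewrite gain_up.
    by rewrite gain_generic //; lia.
  have wE : weight d m k q s + gain d k r <= weight d' m' k' q s.
    by case: (weight_other qs qr sr) => ->; lia.
  have [hsr|hsr] := boolP (adj s r).
    rewrite [gain d' k' s]gain_down //; have w2 := I2 s r hsr rl.
    case: (lP t) => [/I1[h _]|lt]; first lia.
    have w1 : 0 < weight d m k q s.
      by apply: I2 => //; rewrite lt Sne eq_sym; apply: adj_neq.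
    by case: (gl t lt) => [|h]; [lia|rewrite (negPf ntr) in h].
  rewrite [gain d' k' s]gain_generic //; have := J q t s qs ts; lia.
Qed.

End Step.
End Growth.

(** * Reduced words act nontrivially on a suitable line *)

Section Words.
Variables (K : closedFieldType) (c : 'I_3 -> 'I_3 -> 'I_3 -> K).
Hypothesis K2 : 2%:R != 0 :> K.
Hypothesis smooth_c :
  forall v : 'rV[K]_3, v != 0 -> cub c v = 0 -> exists w, polar c v w != 0.
Implicit Types (z : 'rV[{poly K}]_3) (x y q r w : 'rV[K]_3) (a : K).

Local Notation F := (cub c).
Local Notation P := (polar c).
Local Notation tauP := (ctau c).
Local Notation adj := (adjacent c).

Lemma tangent_finite q : q != 0 -> F q = 0 -> exists L : seq 'rV[K]_3,
  forall x, F x = 0 -> P q x = 0 -> covers L x.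
Proof.
move=> q0 Fq; have [y0 [y1 [D0 P1 P0]]] := pencil_basis smooth_c q0 Fq.
have [L LP] := line_finite smooth_c (det3_vprod D0).1.1.
exists L => x Fx Px; have [a [b [d [xE _ _ _]]]] := cramer3K x D0.
have d0 : d = 0.
  move: Px; rewrite xE !polarD !polarZ polarvv Fq P1 !mulr0 !add0r => /eqP.
  by rewrite mulf_eq0 (negPf P0) orbF => /eqP.
by rewrite xE d0 scale0r addr0 in Fx *; apply: LP.
Qed.

(** On the conic of vectors [(1, s, s^2)] each linear form becomes a nonzero polynomial in [s], with
    finitely many roots to avoid. *)
Lemma common_nonzero (L : seq 'rV[K]_3) : (forall u : 'rV[K]_3, u \in L -> u != 0) ->
  exists y, forall u : 'rV[K]_3, u \in L -> dotp u y != 0.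
Proof.
pose pu (u : 'rV[K]_3) : {poly K} := (u 0 i0)%:P + u 0 i1 *: 'X + u 0 i2 *: 'X^2.
move=> L0; have [rs rsP] : exists rs : seq K, forall u : 'rV[K]_3, u \in L -> forall s, root (pu u) s -> s \in rs.
  elim: L L0 => [|u L IH] L0; first by exists [::].
  have [|rs rsP] := IH; first by move=> v vL; apply: L0; rewrite inE vL orbT.
  have pu0 : pu u != 0.
    apply: contraNneq (L0 u (mem_head _ _)) => p0.
    have pi i : (pu u)`_i = 0 by rewrite p0 coef0.
    move: (pi 0) (pi 1) (pi 2%N); rewrite /pu !coefE /= !mulr0 !mulr1 !addr0 !add0r.
    by move=> h0 h1 h2; apply/eqP/row3P; rewrite mxE.
  have [rs' rsP'] := poly_roots_seq pu0.
  exists (rs' ++ rs) => v; rewrite inE => /orP[/eqP->|vL] s h; rewrite mem_cat.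
    by rewrite rsP'.
  by rewrite (rsP v) ?orbT.
have [s sP] := fresh_scalar rs; exists (vec3 1 s (s ^+ 2)) => u uL.
apply: contra sP => /eqP e; apply: (rsP u uL).
rewrite /root /pu !hevalE; apply/eqP; rewrite -[RHS]e /dotp !vec3E; ring.
Qed.

Lemma covers_cat (I : finType) (Q : I -> 'rV[K]_3 -> Prop) :
  (forall i, exists L, forall x, Q i x -> covers L x) ->
  exists L, forall i x, Q i x -> covers L x.
Proof.
move=> h; suff [L LP] : exists L, forall i x, i \in enum I -> Q i x -> covers L x.
  by exists L => i x; apply: LP; rewrite mem_enum.
elim: (enum I) => [|i s [L LP]]; first by exists [::].
have [L' LP'] := h i; exists (L' ++ L) => j x; rewrite inE => /orP[/eqP->|js] Qx.
  by have [u uL e] := LP' x Qx; exists u; rewrite ?mem_cat ?uL.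
by have [u uL e] := LP j x js Qx; exists u; rewrite ?mem_cat ?uL ?orbT.
Qed.

(** The degree is read off at infinity, so any [d'] for which [z'] is good obeys the law. With [z]
    and [z'] exchanged this supplies the backward degree equation of [growth_step]. *)
Lemma linked_degree o q d d' z z' : F o = 0 -> avoids c o q ->
  good o d z -> good o d' z' -> linked c q z z' -> (d' + hits c z q = 3 * d)%N.
Proof.
move=> Fo qA gz gz' [_ pz' [C C0 CE] _].
have [v v0 [hv _]] := good_tau Fo qA gz; rewrite -CE in hv.
have [n dE [v' v'0 [hz' _]]] := topv_div C0 v0 hv.
have -> : hits c z q = (size C).-1.
  have z0' := ev_neq0 (pz' 0).
  by rewrite /hits -CE dg_contZ // {2}/dg (proj1 (prim_cont _) pz') addn0.
have -> : d' = n; last by move: dE; move: (size C) => j; lia.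
have [_ [l l0 h]] := gz'; have o0 := (vprod_neq0 (avoids_vprod Fo qA)).1.
have [i vi] := row3_neq0 v'0; have [_ s1] := top_neq0 (hz' i) vi.
have [j lj] : exists j, (l *: o) 0 j != 0.
  by apply: row3_neq0; rewrite scaler_eq0 negb_or l0.
have [_ s2] := top_neq0 (h j) lj; have [s3 _] := h i; have [s4 _] := hz' j.
by move: s1 s2 s3 s4; move: (size (z' 0 i)) (size (z' 0 j)) => m1 m2; lia.
Qed.

Variables (I : finType) (V : I -> 'rV[K]_3).
Hypothesis V0 : forall i, V i != 0.
Hypothesis FV : forall i, F (V i) = 0.
Hypothesis Vinj : forall i j, i != j -> vprod (V i) (V j) != 0.

Lemma V_eq i j : vprod (V i) (V j) = 0 -> i = j.
Proof. by move=> h; apply: contraTeq isT => /Vinj; rewrite h eqxx. Qed.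

Definition adjV : rel I := fun i j => adj (V i) (V j).

Lemma adjV_neq i j : adjV i j -> i != j.
Proof.
by move=> /and4P[h _ _ _]; apply: contraNneq h => ->; rewrite vprodvv.
Qed.

Lemma adjV_fun i j k : adjV i j -> adjV i k -> j = k.
Proof. by move=> h h'; apply/V_eq/(adj_inj smooth_c h h'). Qed.

Lemma adjV_asym i j : adjV i j -> ~~ adjV j i.
Proof. exact: adj_asym. Qed.

Lemma good_start : exists o z, [/\ F o = 0, forall i, avoids c o (V i), good o 1 z,
  forall i, hits c z (V i) = 0%N & forall i, mult z (V i) = 0%N].
Proof.
have [B BP] : exists B, forall i x, F x = 0 /\ P x (V i) = 0 -> covers B x.
  apply: covers_cat => i; have [L LP] := base_finite K2 smooth_c (V0 i) (FV i).
  by exists L => x []; apply: LP.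
have [T TP] : exists T, forall i x, F x = 0 /\ P (V i) x = 0 -> covers T x.
  apply: covers_cat => i; have [L LP] := tangent_finite (V0 i) (FV i).
  by exists L => x []; apply: LP.
have [o o0 [Fo oBT]] := curve_infinite smooth_c (B ++ T).
have oA i : avoids c o (V i).
  apply/and3P; split; first by rewrite FV.
    apply: contra_notN oBT => /eqP h; have [b bB e] := BP i o (conj Fo h).
    by exists b; rewrite // mem_cat bB.
  apply: contra_notN oBT => /eqP h; have [b bB e] := TP i o (conj Fo h).
  by exists b; rewrite // mem_cat bB orbT.
have [b0 ob0] := vprod_compl o0.
(* [y] is chosen off the lines joining [o] to the base points, so that the line through [y] and [o]
   meets none of them; [b0] serves to keep [y] away from [o] itself. *)
have [y yP] := @common_nonzero [seq vprod b o | b <- b0 :: B & vprod b o != 0]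
  (fun u h => let: ex_intro2 b hb e := mapP h in
   eq_ind_r (fun u => u != 0) (proj1 (andP (eq_ind _ is_true hb _ (mem_filter _ _ _)))) e).
have yb b : b \in b0 :: B -> vprod b o != 0 -> dotp (vprod b o) y != 0.
  by move=> bB h; apply: yP; apply: map_f; rewrite mem_filter h.
have oy a : vprod (y + a *: o) o != 0.
  have : dotp (vprod b0 o) y != 0 by rewrite yb ?mem_head // vprodC oppr_eq0.
  apply: contraNneq => h; rewrite (_ : dotp _ _ = - dotp (vprod (y + a *: o) o) b0).
    by rewrite h dot0p oppr0.
  by rewrite /dotp !vec3E !mxE; ring.
pose z := cst y + 'X *: cst o.
have evz a : ev a z = y + a *: o by rewrite evD evZ !ev_cst hornerX.
have pz : prim z by move=> a; rewrite evz (vprod_neq0 (oy a)).1.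
have nb i a : P (ev a z) (V i) = 0 -> F (ev a z) != 0.
  move=> Pz; apply/eqP => Fz; have [b bB [t e]] := BP i _ (conj Fz Pz).
  rewrite evz in e; have tb : t *: vprod b o != 0 by rewrite -vprodZl -e.
  have bo : vprod b o != 0 by apply: contraNneq tb => ->; rewrite scaler0.
  have := yb b; rewrite inE bB orbT => /(_ isT bo) /eqP[].
  have t0 : t != 0 by apply: contraNneq tb => ->; rewrite scale0r.
  apply: (mulfI t0); rewrite mulr0 -dotpZl -vprodZl -e.
  by rewrite /dotp !vec3E !mxE; ring.
have dg0 u : prim u -> dg (cont u) = 0%N by move=> /prim_cont h; rewrite /dg h.
exists o, z; split=> // [|i|i].
- split=> //; exists 1; rewrite ?oner_neq0 // => i; rewrite !mxE mul1r; split.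
    apply: leq_trans (size_polyD _ _) _; rewrite geq_max size_polyC.
    rewrite (leq_trans (size_polyMleq _ _)) ?size_polyX ?size_polyC; last by case: (o 0 i != 0).
    by case: (y 0 i != 0).
  by rewrite coefD coefC coefXM coefC /= add0r.
- apply: dg0 => a; rewrite ev_tau; apply/eqP => h.
  by have [Fz Pz] := tau_eq0 K2 (V0 i) (FV i) (pz a) h; have := nb i a Pz; rewrite Fz eqxx.
apply: dg0 => a; rewrite ev_vprod; apply/eqP => h.
have [||t e] := @vprod_eq0 _ (V i) (ev a z); rewrite ?V0 //.
  by rewrite vprodC h oppr0.
by have := nb i a; rewrite e polarZl polarvv cubZ FV !mulr0 eqxx => /(_ (erefl _)).
Qed.

Lemma word_neq (l : seq I) : l != [::] -> sorted (fun i j => i != j) l ->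
  exists z, vprod (foldr (fun i => tauP (V i)) z l) z != 0.
Proof.
have [o [z0 [Fo oA gz0 h0 m0]]] := good_start.
pose f l := foldr (fun i => tauP (V i)) z0 l.
(* The image of [z0] is kept as a factor [B] times a primitive [z] of degree [d]. Since [foldr]
   applies the head last, [ohead l] is the last letter of the invariant. *)
have main : sorted (fun i j => i != j) l -> exists d z B, [/\ B != 0, f l = B *: z,
    good o d z, (if l is [::] then d = 1 else (1 < d)%N) &
    growth_inv adjV (ohead l) d%:Z (fun i => (mult z (V i))%:Z) (fun i => (hits c z (V i))%:Z)].
  elim: l => [_|i l IH] /=.
    (* The starting line has degree 1 and meets no base point, so all gains and weights equal 2. *)
    exists 1%N, z0, 1; split=> //; rewrite ?oner_neq0 ?scale1r //.
    split=> // [p _|q r _ _|q t r _ _]; rewrite /weight /gain ?h0 ?m0 //.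
  move=> pl; have /IH[d [z [B [B0 fE gz dl inv]]]] : sorted (fun i j => i != j) l.
    exact: path_sorted pl.
  have il : Some i != ohead l.
    by case: (l) pl => //= j l' /andP[ij _].
  have [d' [z' [gz' lz e1 e2]]] := good_step K2 Fo (oA i) gz.
  have e3 := linked_degree Fo (oA i) gz' gz (linked_sym lz).
  have st : growth_step adjV i d%:Z (fun i => (mult z (V i))%:Z) (fun i => (hits c z (V i))%:Z)
      d'%:Z (fun i => (mult z' (V i))%:Z) (fun i => (hits c z' (V i))%:Z).
    split; [lia|lia|lia| |split].
    - by move=> x xi; have := mult_fiber K2 smooth_c Fo (oA i) gz gz' lz (oA x) xi; lia.
    - by move=> x xi nx; rewrite (mult_other Fo (oA i) gz gz' lz (oA x) (Vinj xi) nx).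
    - by move=> x xi nx nx'; rewrite (hits_other K2 smooth_c Fo (oA i) gz gz' lz (oA x) (Vinj xi)).
    - move=> x ix; have xi : x != i by rewrite eq_sym; apply: adjV_neq.
      by have := hits_fiber K2 smooth_c Fo (oA i) gz gz' lz (oA x) (Vinj xi) ix; lia.
    - move=> x xi; have := hits_base K2 smooth_c Fo (oA i) gz gz' lz (oA x)
        (Vinj (adjV_neq xi)) xi; lia.
  have [gi inv'] := growth_invP adjV_neq adjV_fun adjV_asym st inv il.
  have [_ _ [C C0 CE] _] := lz.
  exists d', z', (B ^+ 3 * C); split=> //.
  - by rewrite mulf_neq0 ?expf_neq0.
  - by rewrite /f /= -/(f l) fE /ctau tauZ -/(ctau c (V i) z) -CE scalerA.
  by move: gi dl; rewrite /gain; case: (l); lia.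
move=> l0 sl; have [d [z [B [B0 fE gz dl _]]]] := main sl.
exists z0; rewrite -/(f l) fE vprodZl scalev_neq0 //; apply/eqP => e.
have [[pz [k k0 h]] [pz0 [k' k0' h']]] := (gz, gz0).
have o0 : o != 0 by case: l l0 {main sl fE dl} => // i l _; exact: (vprod_neq0 (avoids_vprod Fo (oA i))).1.
have [i oi] := row3_neq0 o0.
have [p0 sp] : z 0 i != 0 /\ size (z 0 i) = d.+1.
  by apply: (top_neq0 (h i)); rewrite mxE mulf_neq0.
have [s0 ss] : z0 0 i != 0 /\ size (z0 0 i) = 2%N.
  by apply: (top_neq0 (h' i)); rewrite mxE mulf_neq0.
have ez j k1 : z 0 j * z0 0 k1 = z 0 k1 * z0 0 j.
  move: j k1; have e' n := congr1 (fun v : 'rV_3 => v 0 n) e.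
  have h2 := e' i0; have h1 := e' i1; have h3 := e' i2.
  move: h1 h2 h3; rewrite !vec3E !mxE => /subr0_eq h1 /subr0_eq h2 /subr0_eq h3.
  by apply: ord3P; apply: ord3P.
(* Proportional primitive vectors have the same degree, but one degree is 1 and the other exceeds
   1. *)
have eq_z : z 0 i *: z0 = z0 0 i *: z.
  by apply/rowP => j; rewrite !mxE ez mulrC.
have := congr1 (fun v => size (cont v)) eq_z.
rewrite (eqp_size (contZ _ _)) (eqp_size (contZ _ _)).
have c0 (v : 'rV_3) : prim v -> cont v != 0.
  by move=> pv; rewrite cont_eq0 (ev_neq0 (pv 0)).
rewrite !size_mul ?c0 // !(proj1 (prim_cont _)) // !addn1 /= sp ss.
by case: l l0 dl {main sl fE} => // _ _ _ d1 [e1]; rewrite e1 in d1.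
Qed.

End Words.

Lemma tri_delta (R : comNzRingType) (a : R) i j k (x y z : 'rV[R]_3) :
  tri (fun i' j' k' => a *+ [&& i' == i, j' == j & k' == k]) x y z
  = a * (x 0 i * y 0 j * z 0 k).
Proof.
rewrite /tri (bigD1 i) //= (bigD1 j) //= (bigD1 k) //= !eqxx mulr1n.
rewrite !big1 ?addr0 // => [i' /negPf->|j' /negPf->|k' /negPf->].
- by rewrite big1 // => j' _; rewrite big1 // => k' _; rewrite mul0r.
- by rewrite big1 // => k' _; rewrite andbF mul0r.
- by rewrite !andbF mul0r.
Qed.

Lemma triD_tensor (R : comNzRingType) (c c' : 'I_3 -> 'I_3 -> 'I_3 -> R) x y z :
  tri (fun i j k => c i j k + c' i j k) x y z = tri c x y z + tri c' x y z.
Proof.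
rewrite /tri -big_split; apply: eq_bigr => i _; rewrite -big_split.
by apply: eq_bigr => j _; rewrite -big_split; apply: eq_bigr => k _; rewrite /= mulrDl.
Qed.

Lemma eq_tri (R : comNzRingType) (c c' : 'I_3 -> 'I_3 -> 'I_3 -> R) x y z :
  (forall i j k, c i j k = c' i j k) -> tri c x y z = tri c' x y z.
Proof.
by move=> e; apply: eq_bigr => i _; apply: eq_bigr => j _; apply: eq_bigr => k _; rewrite e.
Qed.

(** * Cubic involutions as birational maps *)

Section Tensor.
Variable K : fieldType.
Implicit Types (F G : {mpoly K[3]}) (c : 'I_3 -> 'I_3 -> 'I_3 -> K).

Definition varX : 'rV[{mpoly K[3]}]_3 := \row_i 'X_i.
Definition mC (c : 'I_3 -> 'I_3 -> 'I_3 -> K) i j k : {mpoly K[3]} := (c i j k)%:MP.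

Lemma monomial_split n (m : 'X_{1..n}) d : mdeg m = d.+1 ->
  exists i m', m = (U_(i) + m')%MM /\ mdeg m' = d.
Proof.
move=> md; have [/existsP[i mi]|/existsPn h] := boolP [exists i, m i != 0%N]; last first.
  by move: md; rewrite mdegE big1 // => i _; apply/eqP/negPn/h.
exists i, (m - U_(i))%MM; have mE : m = (U_(i) + (m - U_(i)))%MM.
  by rewrite addmC submK // lep1mP.
by split=> //; move: md; rewrite {1}mE mdegD mdeg1 => -[].
Qed.

(** Each monomial is charged to one ordered triple of indices; symmetrizing would divide by 6. *)
Lemma cubic_tensor F : F \is 3.-homog -> exists c, F = cub (mC c) varX.
Proof.
move=> /dhomogP hF; rewrite [F]mpolyE.
have : forall m, m \in msupp F -> mdeg m = 3%N by move=> m /hF.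
elim: (msupp F) => [_|m s IH h].
  exists (fun _ _ _ => 0); rewrite big_nil /cub /tri big1 // => i _.
  by rewrite big1 // => j _; rewrite big1 // => k _; rewrite /mC mpolyC0 mul0r.
have [|c cE] := IH; first by move=> m' m's; apply: h; rewrite inE m's orbT.
have [i [m1 [mE /monomial_split[j [m2 [m1E /monomial_split[k [m3 [m2E m3d]]]]]]]]] :=
  monomial_split (h m (mem_head _ _)).
have mX : 'X_[m] = 'X_i * 'X_j * 'X_k :> {mpoly K[3]}.
  rewrite mE m1E m2E (_ : m3 = 0%MM); last by apply/eqP; rewrite -mdeg_eq0 m3d.
  by rewrite addm0 !mpolyXD mulrA.
exists (fun i' j' k' => F@_m *+ [&& i' == i, j' == j & k' == k] + c i' j' k').
rewrite big_cons cE mX /cub [RHS](@eq_tri _ _ (fun i' j' k' =>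
  (F@_m)%:MP *+ [&& i' == i, j' == j & k' == k] + mC c i' j' k')) => [|i' j' k'].
  by rewrite triD_tensor tri_delta !mxE mul_mpolyC.
by rewrite /mC mpolyCD mpolyCMn.
Qed.

Variable c : 'I_3 -> 'I_3 -> 'I_3 -> K.

Lemma mC_meval (v : 'I_3 -> K) i j k : meval v (mC c i j k) = c i j k.
Proof. exact: mevalC. Qed.

Lemma varX_meval (v : 'rV[K]_3) : map_mx (meval (v 0)) varX = v.
Proof. by apply/rowP => i; rewrite !mxE mevalXU. Qed.

Lemma meval_cub (v : 'rV[K]_3) : (cub (mC c) varX).@[v 0] = cub c v.
Proof. by rewrite (map_cub (f := meval (v 0)) (mC_meval (v 0))) varX_meval. Qed.

Lemma mderiv_tri i (x y z : 'rV[{mpoly K[3]}]_3) :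
  (tri (mC c) x y z)^`M(i) = tri (mC c) (map_mx (mderiv i) x) y z
    + tri (mC c) x (map_mx (mderiv i) y) z + tri (mC c) x y (map_mx (mderiv i) z).
Proof.
rewrite /tri raddf_sum -!big_split; apply: eq_bigr => i' _.
rewrite /= raddf_sum -!big_split; apply: eq_bigr => j' _.
rewrite /= raddf_sum -!big_split; apply: eq_bigr => k' _ /=.
by rewrite !mderivM mderivC !mxE; ring.
Qed.

Lemma mderiv_varX i : map_mx (mderiv i) varX = map_mx (@mpolyC 3 K) (delta_mx 0 i).
Proof.
apply/rowP => j; rewrite !mxE eqxx /= mderivX mnm1E.
have [->|ne] := eqVneq j i; last by rewrite scale0r mpolyC0.
have -> : (U_(i) - U_(i))%MM = 0%MM by apply/mnmP => k; rewrite mnmBE mnm0E subnn.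
by rewrite scale1r mpolyX0 mpolyC1.
Qed.

Lemma meval_mderiv (v : 'rV[K]_3) i : (cub (mC c) varX)^`M(i).@[v 0] = polar c v (delta_mx 0 i).
Proof.
rewrite /cub mderiv_tri -/(polar (mC c) varX (map_mx (mderiv i) varX)) mderiv_varX.
rewrite (map_polar (f := meval (v 0)) (mC_meval (v 0))) varX_meval; congr polar.
by apply/rowP => j; rewrite !mxE; exact: mevalC.
Qed.

End Tensor.

(** * The homogeneous triple of a cubic involution *)

Section Triples.
Variables (K : closedFieldType) (c : 'I_3 -> 'I_3 -> 'I_3 -> K).
Implicit Types (q v : 'rV[K]_3) (t : triple K) (z : 'rV[{poly K}]_3).

Definition row_of t : 'rV[{mpoly K[3]}]_3 := \row_i tnth t i.
Definition mcst q : 'rV[{mpoly K[3]}]_3 := map_mx (@mpolyC 3 K) q.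
Definition tau_triple q : triple K := [tuple tau (mC c) (mcst q) (varX K) 0 i | i < 3].
Definition evP t z : 'rV[{poly K}]_3 := map_mx (mmap polyC (z 0)) (row_of t).

Lemma row_of_id : row_of (id_triple K) = varX K.
Proof. by apply/rowP => i; rewrite !mxE tnth_id. Qed.

Lemma row_of_tau q : row_of (tau_triple q) = tau (mC c) (mcst q) (varX K).
Proof. by apply/rowP => i; rewrite [LHS]mxE tnth_mktuple. Qed.

Lemma tevalE t v : teval t v = map_mx (meval (v 0)) (row_of t).
Proof. by apply/rowP => i; rewrite !mxE. Qed.

Lemma mcst_comp q t : map_mx (comp_mpoly t) (mcst q) = mcst q.
Proof. by apply/rowP => i; rewrite /mcst !mxE; apply: comp_mpolyC. Qed.

Lemma varX_comp t : map_mx (comp_mpoly t) (varX K) = row_of t.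
Proof. by apply/rowP => i; rewrite !mxE comp_mpolyXU -tnth_nth. Qed.

Lemma mcst_meval q (v : 'I_3 -> K) : map_mx (meval v) (mcst q) = q.
Proof. by apply/rowP => i; rewrite /mcst !mxE; apply: mevalC. Qed.

Lemma mcst_mmap q (h : 'I_3 -> {poly K}) : map_mx (mmap polyC h) (mcst q) = cst q.
Proof. by apply/rowP => i; rewrite /mcst /cst !mxE; apply: mmapC. Qed.

Lemma row_of_comp q t :
  row_of (comp_triple (tau_triple q) t) = tau (mC c) (mcst q) (row_of t).
Proof.
have -> : row_of (comp_triple (tau_triple q) t)
    = map_mx (comp_mpoly t) (row_of (tau_triple q)).
  by apply/rowP => i; rewrite [LHS]mxE tnth_comp [RHS]mxE mxE.
rewrite row_of_tau (map_tau (f := comp_mpoly t) (c' := mC c)) => [|i j k].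
  by rewrite mcst_comp varX_comp.
exact: comp_mpolyC.
Qed.

Lemma teval_tau q v : teval (tau_triple q) v = tau c q v.
Proof.
by rewrite tevalE row_of_tau (map_tau (f := meval (v 0)) (mC_meval c (v 0))) varX_meval mcst_meval.
Qed.

Lemma teval_comp q t v : teval (comp_triple (tau_triple q) t) v = tau c q (teval t v).
Proof.
by rewrite !tevalE row_of_comp (map_tau (f := meval (v 0)) (mC_meval c (v 0))) mcst_meval.
Qed.

Lemma evP_comp q t z : evP (comp_triple (tau_triple q) t) z = ctau c q (evP t z).
Proof.
rewrite /evP row_of_comp (map_tau (f := mmap polyC (z 0)) (c' := fun i j k => (c i j k)%:P)).
  by rewrite mcst_mmap.
by move=> i j k; exact: mmapC.
Qed.

Lemma evP_id z : evP (id_triple K) z = z.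
Proof. by apply/rowP => i; rewrite !mxE tnth_id mmapX mmap1U. Qed.

Lemma cross_vprod s t : cross s t <-> vprod (row_of s) (row_of t) = 0.
Proof.
split=> [/crossP h|h].
  by apply: row3P; rewrite !vec3E !mxE h subrr.
apply/crossP => i j; have e n := congr1 (fun v : 'rV_3 => v 0 n) h.
have h1 := e i0; have h2 := e i1; have h3 := e i2.
move: h1 h2 h3; rewrite !vec3E !mxE => /subr0_eq h1 /subr0_eq h2 /subr0_eq h3.
by move: i j; apply: ord3P; apply: ord3P.
Qed.

Lemma cross_teval s t v : cross s t -> vprod (teval s v) (teval t v) = 0.
Proof.
by move/cross_vprod=> h; rewrite !tevalE -map_vprod h map_mx0.
Qed.

Lemma cross_evP s t z : cross s t -> vprod (evP s z) (evP t z) = 0.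
Proof.
by move/cross_vprod=> h; rewrite -map_vprod h map_mx0.
Qed.

Lemma dhomog_const (a : K) : a%:MP_[3] \is 0.-homog.
Proof. by rewrite -[_%:MP]mulr1 mul_mpolyC dhomogZ // dhomog1. Qed.

Lemma dhomog_tri d1 d2 d3 (x y z : 'rV[{mpoly K[3]}]_3) :
  (forall i, x 0 i \is d1.-homog) -> (forall i, y 0 i \is d2.-homog) ->
  (forall i, z 0 i \is d3.-homog) -> tri (mC c) x y z \is (d1 + d2 + d3).-homog.
Proof.
move=> hx hy hz; do 3 apply: rpred_sum => ? _.
by rewrite -[(_ + _ + _)%N]add0n; apply: dhomogM (dhomog_const _) _; do 2 apply: dhomogM => //.
Qed.

Lemma homog_tau q : homog_triple (tau_triple q).
Proof.
apply/homog_tripleP; exists 3 => i; rewrite tnth_mktuple.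
have hX j : varX K 0 j \is 1.-homog by rewrite mxE dhomogX /= mdeg1.
have hq j : mcst q 0 j \is 0.-homog by rewrite mxE dhomog_const.
have hP : polar (mC c) (varX K) (mcst q) \is 2.-homog.
  apply: rpredD; [apply: rpredD|].
  - exact: (dhomog_tri hq hX hX).
  - exact: (dhomog_tri hX hq hX).
  - exact: (dhomog_tri hX hX hq).
have hF : cub (mC c) (varX K) \is 3.-homog := dhomog_tri hX hX hX.
rewrite /tau -scaleNr mxE [X in X + _]mxE [X in _ + X]mxE; apply: rpredD; first exact: (dhomogM hP (hX i)).
apply: (@dhomogM _ _ _ 3 _ 0 _ _ (hq i)).
by rewrite rpredN mulr_natl rpredMn.
Qed.

Hypothesis K2 : 2%:R != 0 :> K.
Hypothesis smooth_c :
  forall v : 'rV[K]_3, v != 0 -> cub c v = 0 -> exists w, polar c v w != 0.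

Local Notation F := (cub c).
Local Notation P := (polar c).

Lemma teval_nonzero t v : teval t v != 0 -> nonzero t.
Proof.
move=> /row3_neq0[i]; rewrite mxE => h; apply/nonzeroP; exists i.
by apply: contraNneq h => ->; rewrite meval0.
Qed.

Section Involution.
Variable q : 'rV[K]_3.
Hypotheses (q0 : q != 0) (Fq : F q = 0).

Lemma generic_point : exists2 x, x != 0 & F x = 0 /\ P x q != 0.
Proof.
have [L LP] := base_finite K2 smooth_c q0 Fq.
have [x x0 [Fx nx]] := curve_infinite smooth_c L.
by exists x => //; split=> //; apply/eqP => /(LP x Fx).
Qed.

Lemma nonzero_tau : nonzero (tau_triple q).
Proof.
have [x x0 [Fx Px]] := generic_point; apply: (@teval_nonzero _ x).
by rewrite teval_tau /tau Fx mulr0 scale0r subr0 scaler_eq0 negb_or Px.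
Qed.

Lemma inverts_tau : inverts (tau_triple q) (tau_triple q).
Proof.
apply/andP; split.
  have [x x0 [Fx Px]] := generic_point; apply: (@teval_nonzero _ x).
  rewrite teval_comp teval_tau tauK // scaler_eq0 negb_or x0 andbT.
  by rewrite /discr Fx mulr0 mul0r subr0 mulf_neq0 ?expf_neq0.
have Fq' : cub (mC c) (mcst q) = 0.
  by rewrite -(map_cub (f := @mpolyC 3 K) (c := c)) // Fq raddf0.
apply/cross_vprod; rewrite row_of_comp row_of_tau tauK // row_of_id vprodZl.
by rewrite vprodvv scaler0.
Qed.

Definition tau_ratmap : ratmap K := mk_ratmap (homog_tau q) nonzero_tau.
Definition tau_pair : birpair K := @mk_birpair K tau_ratmap tau_ratmap inverts_tau inverts_tau.

End Involution.
End Triples.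

(** * Generic vanishing *)

Section Vanishing.
Variable K : closedFieldType.
Implicit Types (G : {mpoly K[3]}) (v u y : 'rV[K]_3).

Lemma poly_eq0_generic (p : {poly K}) (ts : seq K) :
  (forall t, t \notin ts -> p.[t] = 0) -> p = 0.
Proof.
move=> h; apply/eqP; apply: contraT => p0.
have : p * \prod_(t <- ts) ('X - t%:P) != 0.
  by rewrite mulf_neq0 // monic_neq0 // monic_prod_XsubC.
case/closed_nonrootP => s; rewrite rootM root_prod_XsubC => /norP[ps /h s0].
by rewrite /root s0 eqxx in ps.
Qed.

(* Kronecker's substitution X_i := t^(N^i) is injective on monomials of       *)
(* degree less than N.                                                        *)
Lemma mpoly_eq0_meval G : (forall v, G.@[v 0] = 0) -> G = 0.
Proof.
move=> h; apply/eqP; apply: contraT => G0.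
pose N := msize G; pose e (m : 'X_{1..3}) := (m i0 + N * (m i1 + N * m i2))%N.
pose p := \sum_(m <- msupp G) G@_m *: 'X^(e m) : {poly K}.
have p0 : p = 0.
  apply: (@poly_eq0_generic _ [::]) => s _; rewrite -[RHS](h (vec3 s (s ^+ N) (s ^+ (N * N)))).
  rewrite mevalE horner_sum; apply: eq_bigr => m _; rewrite hornerZ hornerXn; congr (_ * _).
  rewrite !big_ord_recl big_ord0 mulr1 /e.
  rewrite (_ : ord0 = i0); last exact: val_inj.
  rewrite (_ : lift i0 ord0 = i1); last exact: val_inj.
  rewrite (_ : lift i0 (lift ord0 ord0) = i2); last exact: val_inj.
  by rewrite !vec3E -!exprM -!exprD; congr (_ ^+ _); lia.
have mN (m : 'X_{1..3}) i : m \in msupp G -> (m i < N)%N.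
  move/msize_mdeg_lt; apply: leq_ltn_trans.
  by rewrite mdegE (bigD1 i) //= leq_addr.
have e_inj m m' : m \in msupp G -> m' \in msupp G -> e m = e m' -> m = m'.
  move=> mG mG' ee; have N0 : (0 < N)%N := leq_ltn_trans (leq0n _) (mN m i0 mG).
  have m0 : m i0 = m' i0.
    have := congr1 (modn^~ N) ee; rewrite /e ![(N * _)%N]mulnC ![(_ + _ * N)%N]addnC.
    by rewrite !modnMDl !modn_small ?mN.
  have ee1 : (m i1 + N * m i2 = m' i1 + N * m' i2)%N.
    by apply/eqP; rewrite -(eqn_pmul2l N0) -(eqn_add2l (m i0)) {2}m0; apply/eqP.
  have m1 : m i1 = m' i1.
    have := congr1 (modn^~ N) ee1; rewrite ![(N * _)%N]mulnC ![(_ + _ * N)%N]addnC.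
    by rewrite !modnMDl !modn_small ?mN.
  have m2 : m i2 = m' i2.
    by apply/eqP; rewrite -(eqn_pmul2l N0) -(eqn_add2l (m i1)) {2}m1; apply/eqP.
  by apply/mnmP; apply: ord3P.
have mG := mlead_supp G0; have := congr1 (fun q : {poly K} => q`_(e (mlead G))) p0.
rewrite coef0 coef_sum (bigD1_seq (mlead G)) ?msupp_uniq //= big1_seq => [|m /andP[ne mG']].
  by rewrite coefZ coefXn eqxx mulr1 addr0 => /eqP; rewrite mleadc_eq0 (negPf G0).
rewrite coefZ coefXn; case: eqP => [ee|_]; last by rewrite mulr0.
by move: ne; rewrite (e_inj _ _ mG' mG (esym ee)) eqxx.
Qed.

(** The product of [G] with the linear forms in [L] vanishes everywhere, and the ring of polynomials
    is a domain. *)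
Lemma mpoly_eq0_generic G (L : seq 'rV[K]_3) : (forall u, u \in L -> u != 0) ->
  (forall y, (forall u, u \in L -> dotp u y != 0) -> G.@[y 0] = 0) -> G = 0.
Proof.
move=> L0 h; pose lin u : {mpoly K[3]} := \sum_i u 0 i *: 'X_i.
have linE u y : (lin u).@[y 0] = dotp u y.
  rewrite /lin raddf_sum !big_ord_recl big_ord0 addr0 /= !mevalZ !mevalXU /dotp addrA.
  by congr (_ * _ + _ * _ + _ * _); congr (_ 0 _); apply: val_inj.
have lin0 u : u != 0 -> lin u != 0.
  by case/dotp_neq0=> w; rewrite -linE; apply: contraNneq => ->; rewrite meval0.
have Z : G * \prod_(u <- L) lin u = 0.
  apply: mpoly_eq0_meval => y; rewrite mevalM rmorph_prod /=.
  have [/hasP[u uL /eqP uy]|/hasPn hy] := boolP (has (fun u => dotp u y == 0) L).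
    by rewrite (big_rem u uL) /= linE uy mul0r mulr0.
  by rewrite h ?mul0r.
have P0 : \prod_(u <- L) lin u != 0.
  by rewrite prodf_seq_neq0; apply/allP => u uL; apply/implyP => _; apply/lin0/L0.
by move/eqP: Z; rewrite mulf_eq0 (negPf P0) orbF => /eqP.
Qed.

End Vanishing.

(** * Existence and uniqueness of cubic involutions *)

Section PointsLines.
Local Open Scope quotient_scope.
Variable K : fieldType.
Implicit Types (u v x y w : 'rV[K]_3) (p q : point K) (D : line K).

Definition vp p : 'rV[K]_3 := vpick (val p).

Lemma vpE p : val p = <[vp p]>%VS. Proof. exact: point_vpick. Qed.

Lemma vline_neq0 p v : val p = <[v]>%VS -> v != 0.
Proof.
by move=> pv; have := valP p; rewrite pv dim_vline; case: (v != 0).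
Qed.

Lemma vp_neq0 p : vp p != 0. Proof. exact: vline_neq0 (vpE p). Qed.

Lemma vlineZ k v : k != 0 -> <[k *: v]>%VS = <[v]>%VS.
Proof.
move=> k0; apply/eqP; rewrite eqEsubv -!memvE memvZ ?memv_line //=.
by rewrite -[X in X \in _]scale1r -(mulVf k0) -scalerA memvZ ?memv_line.
Qed.

Lemma vline_vprod u v : u != 0 -> v != 0 -> (<[u]>%VS == <[v]>%VS) = (vprod u v == 0).
Proof.
move=> u0 v0; apply/eqP/eqP => [e|/(vprod_eq0 u0)[t e]].
  have /vlineP[t vE] : v \in <[u]>%VS by rewrite e memv_line.
  by apply: vprodZ_eq0; exists t.
by rewrite e vlineZ //; apply: contraNneq v0 => t0; rewrite e t0 scale0r.
Qed.

Lemma point_eq p q u v : val p = <[u]>%VS -> val q = <[v]>%VS ->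
  (p == q) = (vprod u v == 0).
Proof.
by move=> pu qv; rewrite -val_eqE pu qv vline_vprod ?(vline_neq0 pu) ?(vline_neq0 qv).
Qed.

Lemma mkpoint_subproof v : v != 0 -> \dim <[v]>%VS == 1%N.
Proof. by move=> v0; rewrite dim_vline v0. Qed.

Definition mkpoint v (v0 : v != 0) : point K := exist _ <[v]>%VS (mkpoint_subproof v0).

Lemma mem_point p v : (v \in val p) -> exists k, v = k *: vp p.
Proof. by rewrite {1}vpE => /vlineP. Qed.

Lemma vline_vp p v : val p = <[v]>%VS -> exists2 k, k != 0 & v = k *: vp p.
Proof.
move=> pv; have [|k vE] := @mem_point p v; first by rewrite pv memv_line.
exists k => //; apply: contraNneq (vline_neq0 pv) => k0.
by rewrite vE k0 scale0r.
Qed.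

Definition span2 u v : {vspace 'rV[K]_3} := (<[u]> + <[v]>)%VS.

Lemma mem_span2 u v x : reflect (exists a b, x = a *: u + b *: v) (x \in span2 u v).
Proof.
apply: (iffP memv_addP) => [[y /vlineP[a ->] [z /vlineP[b ->] ->]]|[a [b ->]]].
  by exists a, b.
exists (a *: u); first by rewrite memvZ ?memv_line.
by exists (b *: v); rewrite // memvZ ?memv_line.
Qed.

Lemma dim_span2 u v : vprod u v != 0 -> \dim (span2 u v) = 2.
Proof.
move=> uv; have [u0 v0] := vprod_neq0 uv.
rewrite dimv_disjoint_sum ?dim_vline ?u0 ?v0 //; apply/eqP; rewrite -subv0.
apply/subvP => x; rewrite memv_cap => /andP[/vlineP[a ->] /vlineP[b e]].
have [->|a0] := eqVneq a 0; first by rewrite scale0r mem0v.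
case/eqP: uv; have -> : u = (a^-1 * b) *: v by rewrite -scalerA -e scalerA mulVf ?scale1r.
by rewrite vprodZl vprodvv scaler0.
Qed.

Lemma line_spanE D u v : vprod u v != 0 -> u \in val D -> v \in val D ->
  val D = span2 u v.
Proof.
move=> uv uD vD; apply/eqP; rewrite eq_sym eqEdim (dim_span2 uv) (eqP (valP D)) leqnn.
by rewrite andbT subv_add -!memvE uD.
Qed.

Lemma line_second p D : line_through p D -> exists2 y, y \in val D & vprod y (vp p) != 0.
Proof.
move=> pD; have : ~~ (val D <= val p)%VS.
  by apply/negP => /dimvS; rewrite (eqP (valP D)) (eqP (valP p)).
case/subvPn=> y yD yp; exists y => //; apply: contraNneq yp => e.
have [||t ->] := @vprod_eq0 _ (vp p) y; first exact: vp_neq0.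
  by rewrite vprodC e oppr0.
by rewrite vpE memvZ ?memv_line.
Qed.

Lemma linear2 u v u' v' : vprod u v != 0 ->
  exists A : 'End('rV[K]_3), A u = u' /\ A v = v'.
Proof.
move=> /det3_compl[w D0].
pose M := (det3 u v w)^-1 *: ((vprod v w)^T *m u' + (vprod w u)^T *m v').
have ME x : x *m M = (det3 u v w)^-1 *: (dotp x (vprod v w) *: u' + dotp x (vprod w u) *: v').
  have dE y : x *m y^T = (dotp x y)%:M.
    apply/rowP => j; rewrite ord1 !mxE !big_ord_recl big_ord0 addr0 mulr1n /dotp !mxE addrA.
    by congr (_ * _ + _ * _ + _ * _); congr (_ 0 _); apply: val_inj.
  by rewrite -scalemxAr mulmxDr !mulmxA !dE !mul_scalar_mx.
exists (linfun (mulmxr M)); rewrite !lfunE /= !ME.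
split.
  have -> : dotp u (vprod w u) = 0 by rewrite /dotp !vec3E; ring.
  by rewrite scale0r addr0 -det3_dotpl scalerA mulVf ?scale1r.
have -> : dotp v (vprod v w) = 0 by rewrite /dotp !vec3E; ring.
have -> : dotp v (vprod w u) = det3 u v w by rewrite /det3 /dotp !vec3E; ring.
by rewrite scale0r add0r scalerA mulVf ?scale1r.
Qed.

End PointsLines.

Section Involutions.
Local Open Scope quotient_scope.
Variables (K : closedFieldType) (c : 'I_3 -> 'I_3 -> 'I_3 -> K).
Hypothesis K2 : 2%:R != 0 :> K.
Hypothesis smooth_c :
  forall v : 'rV[K]_3, v != 0 -> cub c v = 0 -> exists w, polar c v w != 0.
Implicit Types (u v x y w : 'rV[K]_3) (p q : point K) (D : line K).

Local Notation F := (cub c).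
Local Notation P := (polar c).
Local Notation curveF := (curve (cub (mC c) (varX K))).

Lemma curveE p v : val p = <[v]>%VS -> (p \in curveF) = (F v == 0).
Proof.
move=> pv; have [k k0 ->] := vline_vp pv.
by rewrite unfold_in meval_cub cubZ mulf_eq0 expf_eq0 (negPf k0).
Qed.

Lemma quadratic_split (a b d : K) : a != 0 -> exists b1 b2,
  [/\ forall s, a * s ^+ 2 + b * s + d = a * (s - b1) * (s - b2),
      (b ^+ 2 - 4%:R * d * a != 0 -> b1 != b2) & (b = - a * (b1 + b2)) /\ d = a * b1 * b2].
Proof.
move=> a0; have [b1 r1] := quadratic_root b d a0.
pose b2 := - b / a - b1.
have bE : b = - a * (b1 + b2) by rewrite /b2; field.
have dE : d = a * b1 * b2.
  by apply: (@addrI _ (a * b1 ^+ 2 + b * b1)); rewrite r1 bE; ring.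
exists b1, b2; split=> //; first by move=> s; rewrite dE [in LHS]bE; ring.
by apply: contraNneq => e; rewrite dE bE -e; apply/eqP; ring.
Qed.

Section AtPoint.
Variables (p : point K) (pC : p \in curveF).
Local Notation q := (vp p).

Lemma vp_cub : F q = 0. Proof. by apply/eqP; rewrite -(curveE (vpE p)). Qed.

Let sg := \pi_(Bir K) (tau_pair K2 smooth_c (vp_neq0 p) vp_cub).

Lemma sigma_sends (y y' : point K) v : val y = <[v]>%VS -> tau c q v != 0 ->
  val y' = <[tau c q v]>%VS -> bir_sends sg y y'.
Proof.
move=> yv t0 yw; exists (tau_pair K2 smooth_c (vp_neq0 p) vp_cub) => //.
by exists v; rewrite teval_tau.
Qed.

(** A nonzero [discr] makes the two residual points distinct, and [P q x] nonzero makes both differ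
    from [p]. *)
Lemma pencil_lines : exists S : seq (line K), forall D, line_through p D -> D \notin S ->
  exists x, [/\ val D = span2 x q, vprod x q != 0, discr c q x != 0 & P q x != 0].
Proof.
have [Ys Ys0 YsP] := pencil_finite K2 smooth_c (vp_neq0 p) vp_cub.
exists (pmap insub [seq span2 y q | y <- Ys]) => D pD; rewrite mem_pmap_sub => nD.
have [x xD xq] := line_second pD.
have qD : q \in val D by apply: (subvP pD); rewrite vpE memv_line.
have DE := line_spanE xq xD qD.
exists x; split=> //; apply: contra nD => /eqP h.
  have [||y [a [b [yY xE]]]] := YsP x; [by rewrite vprodC oppr_eq0|by left|].
  have yx : val D = span2 y q.
    apply: line_spanE => //; first by rewrite vprodC oppr_eq0 Ys0.
    have a0 : a != 0.
      by apply: contraNneq xq => a0; rewrite xE a0 scale0r add0r vprodZl vprodvv scaler0.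
    have -> : y = a^-1 *: (x - b *: q) by rewrite xE addrK scalerA mulVf ?scale1r.
    by rewrite memvZ // memvB // memvZ.
  by rewrite yx; apply: map_f.
have [||y [a [b [yY xE]]]] := YsP x; [by rewrite vprodC oppr_eq0|by right|].
have yx : val D = span2 y q.
  apply: line_spanE => //; first by rewrite vprodC oppr_eq0 Ys0.
  have a0 : a != 0.
    by apply: contraNneq xq => a0; rewrite xE a0 scale0r add0r vprodZl vprodvv scaler0.
  have -> : y = a^-1 *: (x - b *: q) by rewrite xE addrK scalerA mulVf ?scale1r.
  by rewrite memvZ // memvB // memvZ.
by rewrite yx; apply: map_f.
Qed.

Lemma cubic_involution_sigma : cubic_involution (cub (mC c) (varX K)) p sg.
Proof.
have [S SP] := pencil_lines; exists S => D pD nD.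
have [x [DE xq dx Pqx]] := SP D pD nD; have Fq := vp_cub.
have [b1 [b2 [bs b12 [PE FE]]]] := quadratic_split (P x q) (F x) Pqx.
have {}b12 : b1 != b2 by apply: b12; exact: dx.
have x0 b : x + b *: q != 0.
  apply: contraNneq xq => e; have -> : x = (- b) *: q by apply/eqP; rewrite scaleNr -addr_eq0 e.
  by rewrite vprodZl vprodvv scaler0.
(* [A] is the matrix of [tau_line] without its factor [a ^+ 2], so that its square is
   [discr c q x]. *)
have [A [Ax Aq]] := linear2 (P x q *: x + (- (2%:R * F x)) *: q)
  ((2%:R * P q x) *: x + (- P x q) *: q) xq.
have AE a b : A (a *: x + b *: q) =
    (a * P x q + 2%:R * b * P q x) *: x + (- (2%:R * a * F x + b * P x q)) *: q.
  rewrite linearD !linearZ /= Ax Aq !scalerDr !scalerA addrACA -!scalerDl.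
  by congr (_ *: _ + _ *: _); ring.
have AA a b : A (A (a *: x + b *: q)) = discr c q x *: (a *: x + b *: q).
  rewrite AE AE scalerDr !scalerA; congr (_ *: _ + _ *: _); rewrite /discr; ring.
have qD : q \in val D by rewrite DE; apply/mem_span2; exists 0, 1; rewrite scale0r add0r scale1r.
have xD : x \in val D by rewrite DE; apply/mem_span2; exists 1, 0; rewrite scale0r addr0 scale1r.
have ptD (y : point K) v : val y = <[v]>%VS -> (y \in on_line D) = (v \in val D).
  by move=> yv; rewrite unfold_in yv -memvE.
have mD b : x + b *: q \in val D by rewrite memvD // memvZ.
have neD (y : point K) a b : val y = <[a *: x + b *: q]>%VS -> y != p -> a != 0.
  move=> yv; apply: contraNneq => a0; rewrite (point_eq yv (vpE p)).
  by rewrite a0 scale0r add0r vprodZl vprodvv scaler0.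
pose y1 := mkpoint (x0 b1); pose y2 := mkpoint (x0 b2).
have FxE b : F (x + b *: q) = P q x * (b - b1) * (b - b2).
  have -> : x + b *: q = 1 *: x + b *: q by rewrite scale1r.
  by rewrite cub_line // -bs; ring.
exists y1, y2; split.
- rewrite (@point_eq _ y1 y2 (x + b1 *: q) (x + b2 *: q)) //.
  have -> : vprod (x + b1 *: q) (x + b2 *: q) = (b2 - b1) *: vprod x q.
    by apply: row3P; rewrite /vprod !(vec3E, mxE) /=; ring.
  by rewrite scaler_eq0 negb_or subr_eq0 eq_sym b12.
- move=> y; apply/idP/idP.
    rewrite (ptD y _ (vpE y)) (curveE (vpE y)) DE -andbA => /and3P[/mem_span2[a [b ye]]].
    rewrite ye => Fy yp; have yv := vpE y; rewrite ye in yv.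
    have a0 := neD y a b yv yp.
    have yv' : val y = <[x + (b / a) *: q]>%VS.
      by rewrite yv -[RHS](vlineZ _ a0) scalerDr !scalerA mulrCA divff // mulr1.
    have : F (x + (b / a) *: q) == 0 by rewrite -(curveE yv') (curveE yv).
    rewrite FxE !mulf_eq0 (negPf Pqx) /= !subr_eq0 => /orP[] /eqP e; rewrite e in yv'.
      by rewrite -val_eqE yv' eqxx.
    by rewrite -[y == y2]val_eqE yv' eqxx orbT.
  have good (w : point K) b : b = b1 \/ b = b2 -> val w = <[x + b *: q]>%VS ->
      (w \in on_line D) && (w \in curveF) && (w != p).
    move=> hb yv; rewrite (ptD w _ yv) mD (curveE yv) FxE (point_eq yv (vpE p)) /=.
    have -> : vprod (x + b *: q) q = vprod x q.
      by rewrite vprodDl vprodZl vprodvv scaler0 addr0.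
    by rewrite xq andbT; case: hb => ->; rewrite subrr ?mulr0 ?mul0r eqxx.
  by case/orP=> /eqP ->; [apply: (good y1 b1); [left|]|apply: (good y2 b2); [right|]].
(* The eigenvalue is the derivative of the residual quadratic at its root [b], and its square is the
   discriminant. *)
have Afix b : b = b1 \/ b = b2 -> (A @: <[x + b *: q]> = <[x + b *: q]>)%VS.
  move=> hb; have r0 : F x = - (b * P x q + b ^+ 2 * P q x).
    by rewrite PE FE; case: hb => ->; ring.
  have Ab : A (x + b *: q) = (P x q + 2%:R * b * P q x) *: (x + b *: q).
    have -> : x + b *: q = 1 *: x + b *: q by rewrite scale1r.
    rewrite AE scalerDr !scalerA; congr (_ *: _ + _ *: _); first by ring.
    by rewrite r0; ring.
  rewrite limg_line Ab vlineZ //; apply: contraNneq dx => e.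
  rewrite (_ : discr c q x = (P x q + 2%:R * b * P q x) ^+ 2); first by rewrite e expr0n.
  by rewrite /discr r0; ring.
exists A; split; [split|..].
- rewrite {1}DE /span2 limgD !limg_line; apply/esym; apply: line_spanE; first last.
  + by rewrite Aq memvD // memvZ.
  + by rewrite Ax memvD // memvZ.
  have -> : vprod (A x) (A q) = - discr c q x *: vprod x q.
    by rewrite Ax Aq; apply: row3P; rewrite /vprod !(vec3E, mxE) /= /discr; ring.
  by rewrite scaler_eq0 oppr_eq0 negb_or dx.
(* The only exception is [p]: on this line the triple is [a ^+ 2] times [A], and [a] vanishes at
   [p]. *)
- exists [:: p] => y yD; rewrite inE => yp.
  have : y \in on_line D := yD; rewrite (ptD y _ (vpE y)) DE => /mem_span2[a [b ye]].
  have yv := vpE y; rewrite ye in yv; have a0 := neD y a b yv yp.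
  have ty : tau c q (a *: x + b *: q) = a ^+ 2 *: A (a *: x + b *: q).
    by rewrite tau_line // AE; congr (_ *: (_ *: _ + _ *: _)); ring.
  have Ay0 : A (a *: x + b *: q) != 0.
    apply/eqP => e; have := AA a b; rewrite e linear0 => /esym/eqP.
    by rewrite scaler_eq0 (negPf dx) -ye (negPf (vp_neq0 y)).
  have a20 : a ^+ 2 != 0 by rewrite expf_neq0.
  exists (mkpoint Ay0); first by rewrite yv limg_line.
  apply: (sigma_sends yv); rewrite ty ?vlineZ //.
  by rewrite scaler_eq0 negb_or a20.
- move=> y; rewrite (ptD y _ (vpE y)) DE => /mem_span2[a [b ye]].
  by rewrite (vpE y) ye !limg_line AA vlineZ.
- exists p; first by rewrite (ptD p _ (vpE p)).
  rewrite (vpE p) limg_line Aq.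
  have n0 : (2%:R * P q x) *: x + - P x q *: q != 0.
    apply: contraNneq xq => e.
    have : (2%:R * P q x) *: vprod x q = vprod ((2%:R * P q x) *: x + - P x q *: q) q.
      by rewrite vprodDl !vprodZl vprodvv scaler0 addr0.
    rewrite e (_ : vprod 0 q = 0); last by apply: row3P; rewrite /vprod !(vec3E, mxE) /=; ring.
    by move/eqP; rewrite scaler_eq0 (negPf (mulf_neq0 K2 Pqx)).
  rewrite (vline_vprod n0 (vp_neq0 p)) vprodDl !vprodZl vprodvv scaler0 addr0.
  by rewrite scaler_eq0 negb_or xq mulf_neq0.
- exact: (Afix b1 (or_introl _)).
- exact: (Afix b2 (or_intror _)).
Qed.

End AtPoint.
End Involutions.

Section Avoidance.
Local Open Scope quotient_scope.
Variable K : closedFieldType.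
Implicit Types (u v x y w : 'rV[K]_3) (p q : point K) (D : line K).

Lemma mkline_subproof u v : vprod u v != 0 -> \dim (span2 u v) == 2%N.
Proof. by move/dim_span2/eqP. Qed.

Definition mkline u v (uv : vprod u v != 0) : line K := exist _ (span2 u v) (mkline_subproof uv).

(** This turns a general line through [p] into an open condition on a vector [y]: each excluded line
    of the pencil is the zero set of one linear form, and a further form keeps [y] off [p]. *)
Lemma lines_avoid p (S : seq (line K)) : exists2 L : seq 'rV[K]_3,
  forall u, u \in L -> u != 0 &
  forall y, (forall u, u \in L -> dotp u y != 0) ->
    vprod y (vp p) != 0 /\ forall D, D \in S -> line_through p D -> y \notin val D.
Proof.
elim: S => [|D S [L L0 LP]].
  have [e qe] := vprod_compl (vp_neq0 p); exists [:: vprod (vp p) e].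
    by move=> u; rewrite inE => /eqP ->.
  move=> y /(_ _ (mem_head _ _)) h; split=> //; apply: contraNneq h => h.
  have -> : dotp (vprod (vp p) e) y = dotp (vprod y (vp p)) e.
    by rewrite /dotp !vec3E; ring.
  by rewrite h dot0p.
have [pD|npD] := boolP (line_through p D); last first.
  exists L => // y /LP[y0 h]; split=> // E; rewrite inE => /orP[/eqP->|/h//].
  by rewrite (negPf npD).
have [x xD xq] := line_second pD; exists (vprod x (vp p) :: L).
  by move=> u; rewrite inE => /orP[/eqP->|/L0].
move=> y h; have [|y0 hS] := LP y.
  by move=> u uL; apply: h; rewrite inE uL orbT.
split=> // E; rewrite inE => /orP[/eqP-> _|/hS//].
have qD : vp p \in val D by apply: (subvP pD); rewrite vpE memv_line.
rewrite (line_spanE xq xD qD); apply: contra (h _ (mem_head _ _)) => /mem_span2[a [b ->]].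
by apply/eqP; rewrite /dotp !vec3E !mxE; ring.
Qed.

Lemma points_avoid y q (S : seq (point K)) : vprod y (vp q) != 0 ->
  exists ts : seq K, forall t, t \notin ts ->
  forall s, s \in S -> val s != <[y + t *: vp q]>%VS.
Proof.
move=> /det3_compl[w D0].
exists [seq det3 y (vp s) w / det3 (vp s) (vp q) w | s <- S] => t tn s sS.
apply: contra tn => /eqP sv; apply/mapP; exists s => //.
have [k k0 e] := vline_vp sv.
have e1 : k * det3 (vp s) (vp q) w = det3 y (vp q) w.
  rewrite -[RHS](_ : det3 (y + t *: vp q) (vp q) w = _); last by rewrite /det3 /dotp !vec3E !mxE; ring.
  by rewrite e /det3 /dotp !vec3E !mxE; ring.
have e2 : k * det3 y (vp s) w = t * det3 y (vp q) w.
  rewrite -[RHS](_ : det3 y (y + t *: vp q) w = _); last by rewrite /det3 /dotp !vec3E !mxE; ring.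
  by rewrite e /det3 /dotp !vec3E !mxE; ring.
have d0 : det3 (vp s) (vp q) w != 0 by apply: contraNneq D0 => d0; rewrite -e1 d0 mulr0.
by apply: (mulIf d0); rewrite divfK //; apply: (mulfI k0); rewrite e2 -e1; ring.
Qed.

Lemma horner_mmap (G : {mpoly K[3]}) (h : 'I_3 -> {poly K}) t :
  (mmap polyC h G).[t] = G.@[fun i => (h i).[t]].
Proof.
rewrite mevalE /mmap horner_sum; apply: eq_bigr => m _.
rewrite hornerM hornerC /mmap1 horner_prod; congr (_ * _).
by apply: eq_bigr => i _; rewrite horner_exp.
Qed.

Lemma meval_line_eq0 (G : {mpoly K[3]}) y v (ts : seq K) :
  (forall t, t \notin ts -> G.@[(y + t *: v) 0] = 0) -> G.@[y 0] = 0.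
Proof.
move=> h; pose l i : {poly K} := (y 0 i)%:P + v 0 i *: 'X.
have gE t : (mmap polyC l G).[t] = G.@[(y + t *: v) 0].
  rewrite horner_mmap; apply: meval_eq => i.
  by rewrite !hevalE !mxE mulrC.
suff : G.@[(y + 0 *: v) 0] = 0 by rewrite scale0r addr0.
have g0 : mmap polyC l G = 0.
  by apply: (@poly_eq0_generic _ _ ts) => t /h; rewrite gE.
by rewrite -gE g0 horner0.
Qed.

Lemma teval_scale (t : triple K) : homog_triple t ->
  exists d, forall k v, teval t (k *: v) = k ^+ d *: teval t v.
Proof.
move=> /homog_tripleP[d hd]; exists d => k v; apply/rowP => i.
by rewrite !mxE (meval_dhomogZ _ _ (hd i)).
Qed.

End Avoidance.

(** * Uniqueness of the cubic involution at a point *)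

Section Uniqueness.
Local Open Scope quotient_scope.
Variables (K : closedFieldType) (c : 'I_3 -> 'I_3 -> 'I_3 -> K).
Hypothesis K2 : 2%:R != 0 :> K.
Hypothesis smooth_c :
  forall v : 'rV[K]_3, v != 0 -> cub c v = 0 -> exists w, polar c v w != 0.
Implicit Types (u v x y w : 'rV[K]_3) (p q : point K) (D : line K).

Local Notation F := (cub c).
Local Notation P := (polar c).
Local Notation curveF := (curve (cub (mC c) (varX K))).

(* [c1 * b + c2 * a = 0]: up to a scalar, a u1 + b u2 is sent to its harmonic *)
(* conjugate a u1 - b u2.                                                    *)
Lemma tau_chord u1 u2 al be a b : F u1 = 0 -> F u2 = 0 ->
  al * P u1 u2 + be * P u2 u1 = 0 ->
  exists c1 c2, tau c (al *: u1 + be *: u2) (a *: u1 + b *: u2) = c1 *: u1 + c2 *: u2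
    /\ c1 * b + c2 * a = 0.
Proof.
move=> F1 F2 e; set q := _ + be *: u2; set v := a *: u1 + _.
exists (P v q * a - 2%:R * F v * al), (P v q * b - 2%:R * F v * be); split.
  by rewrite /tau /v /q !scalerDr !scalerA opprD addrACA -!scalerBl.
have -> : P v q = a ^+ 2 * be * P u1 u2 + b ^+ 2 * al * P u2 u1.
  rewrite /v /q polarD !polarZ !polar_comb2 !polarvv F1 F2.
  rewrite (spolC _ u1 u2 u1) !spolyxx.
  transitivity (a ^+ 2 * be * P u1 u2 + b ^+ 2 * al * P u2 u1
    + 2%:R * a * b * (al * P u1 u2 + be * P u2 u1)); first by ring.
  by rewrite e mulr0 addr0.
rewrite /v cub_comb2 F1 F2.
transitivity (- 2%:R * a ^+ 2 * b ^+ 2 * (al * P u1 u2 + be * P u2 u1)); first by ring.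
by rewrite e mulr0.
Qed.

Section AtPoint.
Variables (p : point K) (pC : p \in curveF).
Local Notation q := (vp p).

Definition sigma_at : Bir K := \pi_(Bir K) (tau_pair K2 smooth_c (vp_neq0 p) (vp_cub pC)).

(** [A] is diagonal on [u1], [u2]. As it is an involution at the point [u1 + u2], its eigenvalues
    have equal squares; equal eigenvalues would fix every point of the line, so they are
    opposite. *)
Lemma involution_chord D u1 u2 (A : 'End('rV[K]_3)) :
  val D = span2 u1 u2 -> vprod u1 u2 != 0 ->
  (forall r, r \in on_line D -> (A @: (A @: val r) = val r)%VS) ->
  (exists2 r, r \in on_line D & (A @: val r)%VS != val r) ->
  (A @: <[u1]> = <[u1]>)%VS -> (A @: <[u2]> = <[u2]>)%VS ->
  exists2 l, l != 0 & forall a b, A (a *: u1 + b *: u2) = l *: (a *: u1 - b *: u2).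
Proof.
move=> DE u12 Ainv [r rD Ar] A1 A2; have [u10 u20] := vprod_neq0 u12.
have eig u : u != 0 -> (A @: <[u]> = <[u]>)%VS -> exists2 l, l != 0 & A u = l *: u.
  move=> u0; rewrite limg_line => e; have /vlineP[l Au] : A u \in <[u]>%VS by rewrite -e memv_line.
  exists l => //; apply: contraNneq u0 => l0.
  by have := memv_line u; rewrite -e Au l0 scale0r => /vlineP[k ->]; rewrite scaler0.
have [l1 l10 Au1] := eig _ u10 A1; have [l2 l20 Au2] := eig _ u20 A2.
have AE a b : A (a *: u1 + b *: u2) = (a * l1) *: u1 + (b * l2) *: u2.
  by rewrite linearD !linearZ /= Au1 Au2 !scalerA.
have ind a b : a *: u1 + b *: u2 = 0 -> a = 0 /\ b = 0.
  move=> e; have z0 : vprod 0 u2 = 0 :> 'rV[K]_3 by apply: row3P; rewrite /vprod !(vec3E, mxE) /=; ring.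
  have z1 : vprod 0 u1 = 0 :> 'rV[K]_3 by apply: row3P; rewrite /vprod !(vec3E, mxE) /=; ring.
  have /eqP : a *: vprod u1 u2 = 0.
    by rewrite -z0 -e vprodDl !vprodZl vprodvv scaler0 addr0.
  have /eqP : b *: vprod u2 u1 = 0.
    by rewrite -z1 -e vprodDl !vprodZl vprodvv scaler0 add0r.
  by rewrite !scaler_eq0 [vprod u2 u1]vprodC oppr_eq0 (negPf u12) !orbF => /eqP-> /eqP->.
have s0 : u1 + u2 != 0.
  apply/eqP => e; have [|/eqP] := ind 1 1; first by rewrite !scale1r.
  by rewrite oner_eq0.
have sq : l1 ^+ 2 = l2 ^+ 2.
  have := Ainv (mkpoint s0); rewrite unfold_in /= -memvE DE => /(_ _)/esym.
  have sD : u1 + u2 \in span2 u1 u2 by apply/mem_span2; exists 1, 1; rewrite !scale1r.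
  move=> /(_ sD); rewrite !limg_line => e.
  have : A (A (u1 + u2)) \in <[u1 + u2]>%VS by rewrite e memv_line.
  case/vlineP => k; rewrite -{1}[u1]scale1r -{1}[u2]scale1r !AE => /eqP.
  rewrite scalerDr -subr_eq0 opprD addrACA -!scalerBl => /eqP /ind[].
  by rewrite !mul1r -!expr2 => /subr0_eq -> /subr0_eq ->.
have l12 : l2 = - l1.
  apply/eqP; move/eqP: sq; rewrite eq_sym eqf_sqr => /orP[/eqP e|//].
  case/negP: Ar; have := rD; rewrite unfold_in (vpE r) -memvE DE => /mem_span2[a [b ->]].
  by rewrite limg_line AE e [a * _]mulrC [b * _]mulrC -!scalerA -scalerDr vlineZ.
exists l1 => // a b; rewrite AE l12 scalerBr !scalerA mulrN scaleNr.
by congr (_ *: _ - _ *: _); rewrite mulrC.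
Qed.

(** Equality in [Bir] is the vanishing of the minors of two triples. These are polynomials, so it
    suffices to test vectors [y] whose line through [p] is not exceptional. *)
Lemma cubic_involution_unique s :
  cubic_involution (cub (mC c) (varX K)) p s -> s = sigma_at.
Proof.
elim/quotW: s => x0 [S SP]; apply/pi_birP/cross_vprod.
have [L L0 LP] := lines_avoid p S.
suff gen n (y : 'rV[K]_3) : (forall u, u \in L -> dotp u y != 0) ->
    (vprod (row_of (fwd x0)) (row_of (tau_triple c q)) 0 n).@[y 0] = 0.
  by apply/rowP => n; rewrite [RHS]mxE; apply: (mpoly_eq0_generic L0); apply: gen.
have mE (z : 'rV[K]_3) : (vprod (row_of (fwd x0)) (row_of (tau_triple c q)) 0 n).@[z 0] =
    vprod (teval (fwd x0) z) (tau c q z) 0 n.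
  by rewrite -(teval_tau c) !tevalE -map_vprod [RHS]mxE.
move=> /LP[yq yS]; pose D := mkline yq.
have DE : val D = span2 y q by [].
have qD : q \in val D by apply/mem_span2; exists 0, 1; rewrite scale0r add0r scale1r.
have yD : y \in val D by apply/mem_span2; exists 1, 0; rewrite scale0r addr0 scale1r.
have pD : line_through p D by rewrite /line_through (vpE p) -memvE.
have nS : D \notin S.
  by apply: contraL yD => DS; apply: yS.
have [q1 [q2 [q12 qP [A [[_ [Sy SyP]] Ainv Ant A1 A2]]]]] := SP D pD nS.
have /andP[/andP[q1D q1C] q1p] : (q1 \in on_line D) && (q1 \in curveF) && (q1 != p).
  by rewrite qP eqxx.
have /andP[/andP[q2D q2C] q2p] : (q2 \in on_line D) && (q2 \in curveF) && (q2 != p).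
  by rewrite qP eqxx orbT.
pose u1 := vp q1; pose u2 := vp q2.
have u12 : vprod u1 u2 != 0 by rewrite -(point_eq (vpE q1) (vpE q2)).
have u1D : u1 \in val D by move: q1D; rewrite unfold_in (vpE q1) -memvE.
have u2D : u2 \in val D by move: q2D; rewrite unfold_in (vpE q2) -memvE.
have DE12 := line_spanE u12 u1D u2D.
have F1 : F u1 = 0 := vp_cub q1C; have F2 : F u2 = 0 := vp_cub q2C.
have [al [be qE]] : exists al be, q = al *: u1 + be *: u2.
  by apply/mem_span2; rewrite -DE12.
have al0 : al != 0.
  apply: contraNneq q2p => al0; rewrite (point_eq (vpE q2) (vpE p)) qE al0 scale0r add0r.
  by rewrite vprodC vprodZl vprodvv scaler0 oppr0.
have be0 : be != 0.
  apply: contraNneq q1p => be0; rewrite (point_eq (vpE q1) (vpE p)) qE be0 scale0r addr0.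
  by rewrite vprodC vprodZl vprodvv scaler0 oppr0.
(* Since [u1] and [u2] lie on the cubic, [F q] is [al * be] times this expression, with [al] and
   [be] nonzero. *)
have rel : al * P u1 u2 + be * P u2 u1 = 0.
  have : F q = 0 by apply: vp_cub.
  rewrite qE cub_comb2 F1 F2 => e; apply: (mulfI al0); apply: (mulfI be0).
  by rewrite !mulr0 -[RHS]e; ring.
have [l l0 AE] := involution_chord DE12 u12 Ainv Ant
  (etrans (congr1 _ (esym (vpE q1))) (etrans A1 (vpE q1)))
  (etrans (congr1 _ (esym (vpE q2))) (etrans A2 (vpE q2))).
have [ts tsP] := points_avoid Sy yq.
(* [y] may be one of the finitely many exceptional points of its line; vanishing at the other points
   [y + t *: q] of that line forces vanishing at [y]. *)
apply: (@meval_line_eq0 _ _ y q ts) => t /tsP tS; rewrite mE.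
set v := y + t *: q.
have vD : v \in val D by rewrite memvD // memvZ.
have v0 : v != 0.
  apply/eqP => e; case/eqP: (yq); have -> : y = (- t) *: q by apply/eqP; rewrite scaleNr -addr_eq0 -/v e.
  by rewrite vprodZl vprodvv scaler0.
have [||y' y'E] := SyP (mkpoint v0).
- by rewrite /on_line /= -memvE.
- by apply/negP => /tS /eqP.
rewrite /= limg_line in y'E *; case=> x /pi_birP xs [v' [/= vv' tx0 y'E']].
have [k vE] : exists k, v' = k *: v by apply/vlineP; rewrite vv' memv_line.
have k0 : k != 0.
  by apply: contraNneq (vline_neq0 (vv' : val (mkpoint v0) = _)) => e; rewrite vE e scale0r.
have [m tE] : exists m, teval (fwd x) v' = m *: A v.
  by apply/vlineP; rewrite -y'E y'E' memv_line.
have m0 : m != 0 by apply: contraNneq tx0 => e; rewrite tE e scale0r.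
have Av0 : A v != 0 by apply: contraNneq tx0 => e; rewrite tE e scaler0.
have [d dE] := teval_scale (fwd_homog x0).
have AT : vprod (A v) (teval (fwd x0) v) = 0.
  apply/eqP; have /eqP := cross_teval v' xs; rewrite tE vprodZl scaler_eq0 (negPf m0) /=.
  by rewrite vE dE vprodC vprodZl oppr_eq0 scaler_eq0 expf_eq0 (negPf k0) andbF /= vprodC oppr_eq0.
have [h TE] := vprod_eq0 Av0 AT.
have [a [b vE12]] : exists a b, v = a *: u1 + b *: u2.
  by apply/mem_span2; rewrite -DE12.
have [c1 [c2 [tauE c12]]] := tau_chord a b F1 F2 rel.
rewrite TE vprodZl {2}vE12 qE tauE vE12 AE.
rewrite (_ : vprod _ _ = (l * (c1 * b + c2 * a)) *: vprod u1 u2).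
  by rewrite c12 mulr0 scale0r scaler0 mxE.
by apply: row3P; rewrite /vprod !(vec3E, mxE) /=; ring.
Qed.

End AtPoint.
End Uniqueness.

(** * Words of involutions and inertia *)

Section Continuity.
Local Open Scope quotient_scope.
Variables (K : closedFieldType) (c : 'I_3 -> 'I_3 -> 'I_3 -> K).
Hypothesis K2 : 2%:R != 0 :> K.
Hypothesis smooth_c :
  forall v : 'rV[K]_3, v != 0 -> cub c v = 0 -> exists w, polar c v w != 0.
Implicit Types (u v x y w : 'rV[K]_3).

Local Notation F := (cub c).
Local Notation P := (polar c).

Lemma dvdp_prod_XsubC (g : {poly K}) (rs : seq K) : (forall z, z \in rs -> root g z) ->
  \prod_(z <- rs) ('X - z%:P) %| g ^+ size rs.
Proof.
elim: rs => [|z rs IH] h; first by rewrite big_nil dvd1p.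
rewrite big_cons exprS dvdp_mul // ?dvdp_XsubCl ?h ?mem_head //.
by apply: IH => y yr; apply: h; rewrite inE yr orbT.
Qed.

(* Near x, parametrize the curve by a branched cover of the u-line:           *)
(* G^3 is divisible by the monic cubic F(x + u w + t o) in t for almost all u, *)
(* hence for u = 0.                                                           *)
Lemma curve_continuity (G : {mpoly K[3]}) (L : seq 'rV[K]_3) :
  (forall x, x != 0 -> F x = 0 -> ~ covers L x -> G.@[x 0] = 0) ->
  forall x, x != 0 -> F x = 0 -> G.@[x 0] = 0.
Proof.
move=> GL x x0 Fx; have [o Fo] := off_cubic smooth_c.
have xo : vprod x o != 0.
  by apply: contraNneq Fo => /(vprod_eq0 x0)[t ->]; rewrite cubZ Fx mulr0.
have [w D0] := det3_compl xo.
pose y : 'rV[{poly K}]_3 := cst x + 'X *: cst w.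
pose cP i j k := (c i j k)%:P.
pose f : {poly {poly K}} := 'X^3 + ((F o)^-1%:P * polar cP (cst o) y) *: 'X^2
  + ((F o)^-1%:P * polar cP y (cst o)) *: 'X + ((F o)^-1%:P * cub cP y)%:P.
pose h i : {poly {poly K}} := (y 0 i)%:P + (o 0 i)%:P%:P * 'X.
pose g : {poly {poly K}} := mmap (fun a => a%:P%:P) h G.
have evy (u : K) : ev u y = x + u *: w by rewrite evD evZ !ev_cst hornerX.
pose ph (u : K) := map_poly (horner_eval u).
have phf (u t : K) : (ph u f).[t] = (F o)^-1 * F (x + u *: w + t *: o).
  rewrite /ph /f !rmorphD /= !map_polyZ !map_polyXn map_polyX map_polyC /= !hevalE.
  rewrite /horner_eval !hornerM !hornerC !ev_polar ev_cub evy ev_cst.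
  have -> : x + u *: w + t *: o = 1 *: (x + u *: w) + t *: o by rewrite scale1r.
  by rewrite [RHS](congr1 _ (cub_comb2 _ _ _ _ _)); field.
have phg (u t : K) : (ph u g).[t] = G.@[(x + u *: w + t *: o) 0].
  rewrite /ph /g /mmap rmorph_sum horner_sum mevalE; apply: eq_bigr => m _.
  rewrite rmorphM rmorph_prod /= map_polyC hornerM horner_prod /= hornerC horner_evalE hornerC.
  congr (_ * _); apply: eq_bigr => i _; rewrite rmorphXn /= horner_exp; congr (_ ^+ _).
  rewrite /h rmorphD rmorphM /= map_polyX !map_polyC /= !hevalE /horner_eval !hornerC.
  by rewrite -evE evy !mxE; ring.
have fmon : f \is monic.
  rewrite /f -!addrA monicE lead_coefDl ?lead_coefXn // size_polyXn.
  apply: leq_ltn_trans (size_polyD _ _) _.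
  rewrite gtn_max (leq_ltn_trans (size_scale_leq _ _)) ?size_polyXn //=.
  apply: leq_ltn_trans (size_polyD _ _) _; rewrite gtn_max.
  rewrite (leq_ltn_trans (size_scale_leq _ _)) ?size_polyX //=.
  by rewrite (leq_ltn_trans (size_polyC_leq1 _)).
have sf : size f = 4%N.
  rewrite /f -!addrA size_polyDl ?size_polyXn //.
  apply: leq_ltn_trans (size_polyD _ _) _.
  rewrite gtn_max (leq_ltn_trans (size_scale_leq _ _)) ?size_polyXn //=.
  apply: leq_ltn_trans (size_polyD _ _) _; rewrite gtn_max.
  rewrite (leq_ltn_trans (size_scale_leq _ _)) ?size_polyX //=.
  by rewrite (leq_ltn_trans (size_polyC_leq1 _)).
have phmon (u : K) : ph u f \is monic by apply: monic_map.
have sphf (u : K) : size (ph u f) = 4%N.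
  rewrite /ph size_map_poly_id0 // (monicP fmon).
  by rewrite rmorph1 oner_neq0.
have divE := Pdiv.IdomainMonic.divp_eq fmon (g ^+ 3).
set Q := (X in X * f) in divE; set r := (X in _ + X) in divE.
have sr : (size r < 4)%N by rewrite -sf ltn_modpN0 // monic_neq0.
have phdiv (u : K) : ph u g ^+ 3 = ph u Q * ph u f + ph u r.
  by rewrite /ph -rmorphXn divE rmorphD rmorphM.
(* The excluded [u] are those over which a member of [L] lies. For the others, each root of the
   cubic in [t] is a root of [ph u g], and the third power allows for coinciding roots. *)
have fdiv (u : K) : u \notin [seq det3 x o l / det3 l o w | l <- L] -> ph u f %| ph u g ^+ 3.
  move=> uL; have [rs rsE] := closed_field_poly_normal (ph u f).
  rewrite (monicP (phmon u)) scale1r in rsE.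
  have <- : size rs = 3%N.
    by have := sphf u; rewrite rsE size_prod_XsubC => -[].
  rewrite rsE; apply: dvdp_prod_XsubC => t trs.
  have : root (ph u f) t by rewrite rsE root_prod_XsubC.
  rewrite /root phf mulf_eq0 invr_eq0 (negPf Fo) /= => /eqP Ft.
  have d1 : det3 (x + u *: w + t *: o) o w = det3 x o w.
    by rewrite /det3 /dotp !vec3E !mxE; ring.
  have d2 : det3 x o (x + u *: w + t *: o) = u * det3 x o w.
    by rewrite /det3 /dotp !vec3E !mxE; ring.
  apply/eqP; rewrite phg; apply: GL => //.
    apply: contraNneq D0 => e; rewrite -d1 e; apply/eqP.
    by rewrite /det3 /dotp !vec3E !mxE; ring.
  case=> l lL [k e]; case/negP: uL; apply/mapP; exists l => //.
  rewrite e in d1 d2.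
  have e1 : k * det3 l o w = det3 x o w by rewrite -d1 /det3 /dotp !vec3E !mxE; ring.
  have e2 : k * det3 x o l = u * det3 x o w by rewrite -d2 /det3 /dotp !vec3E !mxE; ring.
  have l0 : det3 l o w != 0 by apply: contraNneq D0 => h0; rewrite -e1 h0 mulr0.
  have k0 : k != 0 by apply: contraNneq D0 => h0; rewrite -e1 h0 mul0r.
  by apply: (mulIf l0); rewrite divfK //; apply: (mulfI k0); rewrite e2 mulrCA e1.
(* Each coefficient of the remainder is a polynomial in [u] with all but finitely many values
   zero. *)
have r0 : r = 0.
  apply/polyP => i; rewrite coef0.
  apply: (@poly_eq0_generic _ _ [seq det3 x o l / det3 l o w | l <- L]) => u /fdiv.
  rewrite phdiv dvdp_addr ?dvdp_mull // => d.
  have : ph u r = 0.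
    apply/eqP; apply: contraT => /dvdp_leq/(_ d); rewrite sphf leqNgt.
    by rewrite (leq_ltn_trans (size_poly _ _)).
  by move/(congr1 (fun p : {poly K} => p`_i)); rewrite coef_map coef0.
have := phg 0 0; rewrite !scale0r !addr0 => <-; apply/eqP.
have ph0 : ph 0 r = 0 by rewrite /ph r0 rmorph0.
have := congr1 (horner^~ 0) (phdiv 0); rewrite ph0 addr0 horner_exp hornerM.
rewrite phf !scale0r !addr0 Fx !mulr0 => /eqP; by rewrite expf_eq0.
Qed.

End Continuity.

Section BirWords.
Local Open Scope quotient_scope.
Variables (K : closedFieldType) (c : 'I_3 -> 'I_3 -> 'I_3 -> K).
Hypothesis K2 : 2%:R != 0 :> K.
Hypothesis smooth_c :
  forall v : 'rV[K]_3, v != 0 -> cub c v = 0 -> exists w, polar c v w != 0.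
Implicit Types (u v x y w : 'rV[K]_3).

Local Notation F := (cub c).
Local Notation P := (polar c).
Local Notation FX := (cub (mC c) (varX K)).
Local Notation I := {p : point K | p \in curve FX}.
Implicit Types (i : I) (l : seq I).

Definition sigma_pair i : birpair K :=
  tau_pair K2 smooth_c (vp_neq0 (val i)) (vp_cub (valP i)).

Definition word_pair l : birpair K :=
  foldr (fun i => birpair_mul (sigma_pair i)) (birpair_one K) l.

Lemma pi_word l : \pi_(Bir K) (word_pair l) = (\prod_(i <- l) \pi_(Bir K) (sigma_pair i))%g.
Proof.
elim: l => [|i l IH]; first by rewrite big_nil.
by rewrite big_cons -IH /= -bir_mulE.
Qed.

Lemma fwd_word_cons i l : fwd (word_pair (i :: l)) =
  comp_triple (tau_triple c (vp (val i))) (fwd (word_pair l)).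
Proof. by []. Qed.

Lemma evP_word l z : evP (fwd (word_pair l)) z =
  foldr (fun i => ctau c (vp (val i))) z l.
Proof.
elim: l => [|i l IH]; first exact: evP_id.
by rewrite fwd_word_cons evP_comp IH.
Qed.

Lemma vp_inj i j : i != j -> vprod (vp (val i)) (vp (val j)) != 0.
Proof. by rewrite -(point_eq (vpE (val i)) (vpE (val j))) val_eqE. Qed.

(** The growth argument needs finitely many centres, since the point at infinity must avoid all
    their base points; the letters of [l] suffice. *)
Lemma word_neq1 l : l != [::] -> sorted (fun i j => i != j) l ->
  \pi_(Bir K) (word_pair l) <> 1%g.
Proof.
move=> l0 sl /pi_birP cr.
pose V (j : seq_sub l) := vp (val (val j)).
have V0 j : V j != 0 by apply: vp_neq0.
have FV j : F (V j) = 0 by apply: vp_cub (valP (val j)).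
have Vinj (j k : seq_sub l) : j != k -> vprod (V j) (V k) != 0.
  by move=> jk; apply: vp_inj; rewrite val_eqE.
pose l' : seq (seq_sub l) := pmap insub l.
have lE : map val l' = l.
  by rewrite /l' pmap_filter; [apply/all_filterP/allP => j jl; rewrite insubT|exact: insubK].
have l'0 : l' != [::] by apply: contraNneq l0 => e; rewrite -lE e.
have sl' : sorted (fun i j : seq_sub l => i != j) l'.
  by move: sl; rewrite -{1}lE sorted_map; apply: sub_sorted => j k; rewrite /= val_eqE.
have [z /eqP[]] := word_neq K2 smooth_c V0 FV Vinj l'0 sl'.
have := cross_evP z cr; rewrite evP_word evP_id -{1}lE.
by rewrite foldr_map.
Qed.

Lemma sigma_sqr i : (\pi_(Bir K) (sigma_pair i) * \pi_(Bir K) (sigma_pair i))%g = 1%g.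
Proof.
have -> : (\pi_(Bir K) (sigma_pair i) * \pi_(Bir K) (sigma_pair i))%g =
  \pi_(Bir K) (birpair_mul (sigma_pair i) (sigma_pair i)) by exact: bir_mulE.
by apply/pi_birP; have /andP[_] := inverts_tau K2 smooth_c (vp_neq0 (val i)) (vp_cub (valP i)).
Qed.

Lemma word_fixes l : exists L : seq 'rV[K]_3, forall x, x != 0 -> F x = 0 -> ~ covers L x ->
  exists2 k, k != 0 & teval (fwd (word_pair l)) x = k *: x.
Proof.
elim: l => [|i l [L LP]].
  exists [::] => x x0 _ _; exists 1; rewrite ?oner_neq0 // scale1r.
  by apply/rowP => j; rewrite mxE tnth_id mevalXU.
have [B BP] := base_finite K2 smooth_c (vp_neq0 (val i)) (vp_cub (valP i)).
exists (B ++ L) => x x0 Fx nx.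
have [|k k0 e] := LP x x0 Fx.
  by case=> b bL e; apply: nx; exists b; rewrite // mem_cat bL orbT.
exists (k ^+ 3 * P x (vp (val i))).
  rewrite mulf_neq0 ?expf_neq0 //; apply/eqP => Px; apply: nx.
  by have [b bB eb] := BP x Fx Px; exists b; rewrite // mem_cat bB.
by rewrite fwd_word_cons teval_comp e tauZ /tau Fx mulr0 scale0r subr0 scalerA.
Qed.

Lemma covers_points (L : seq 'rV[K]_3) : exists S : seq (point K),
  forall p, p \notin S -> ~ covers L (vp p).
Proof.
exists (pmap insub [seq <[b]>%VS | b : 'rV[K]_3 <- L]) => p; rewrite mem_pmap_sub => np [b bL [t e]].
case/negP: np; have -> : val p = <[b]>%VS.
  rewrite vpE e vlineZ //; apply: contraNneq (vp_neq0 p) => t0.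
  by rewrite e t0 scale0r.
exact: map_f.
Qed.

Lemma word_inertia l : inertia FX (\pi_(Bir K) (word_pair l)).
Proof.
have [L LP] := word_fixes l; have [S SP] := covers_points L.
have fix_p p : p \in curve FX -> p \notin S ->
    bir_sends (\pi_(Bir K) (word_pair l)) p p.
  move=> pC pS; have [k k0 e] := LP _ (vp_neq0 p) (vp_cub pC) (SP p pS).
  exists (word_pair l) => //; exists (vp p); rewrite e vlineZ // -vpE; split=> //.
  by rewrite scaler_eq0 negb_or k0 vp_neq0.
split; last by exists S => p pC pS; apply: fix_p.
(* The representative [x] may be defined at [p] where the triple of the word vanishes. That the
   image is proportional to the argument is a closed condition, so it extends from general points of
   the curve and gives [q = p]. *)
- move=> p q pC [x /pi_birP xs [v [pv tv0 qv]]].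
  have v0 := vline_neq0 pv.
  have Fv : F v = 0 by apply/eqP; rewrite -(curveE c pv).
  suff h : vprod (teval (fwd x) v) v = 0.
    have tv : vprod v (teval (fwd x) v) = 0 by rewrite vprodC h oppr0.
    have [t e] := vprod_eq0 v0 tv; suff -> : q = p by [].
    apply/val_inj; rewrite qv pv e vlineZ //.
    by apply: contraNneq tv0 => t0; rewrite e t0 scale0r.
  have mE (y : 'rV[K]_3) n : (vprod (row_of (fwd x)) (varX K) 0 n).@[y 0] =
      vprod (teval (fwd x) y) y 0 n.
    transitivity (vprod (teval (fwd x) y) (map_mx (meval (y 0)) (varX K)) 0 n).
      by rewrite tevalE -map_vprod [RHS]mxE.
    by rewrite varX_meval.
  apply/rowP => n; rewrite -mE [RHS]mxE.
  apply: (curve_continuity smooth_c (L := L)) => // y y0 Fy nL; rewrite mE.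
  have [k k0 e] := LP y y0 Fy nL; have := cross_teval y xs.
  rewrite e vprodC vprodZl vprodC => /eqP; rewrite oppr_eq0 scaler_eq0 (negPf k0) oppr_eq0 /=.
  by move/eqP => ->; rewrite mxE.
have idr : homog_triple (id_triple K) && nonzero (id_triple K).
  by rewrite homog_id nonzero_id.
exists (exist _ (id_triple K) idr).
have id_p p : triple_sends (id_triple K) p p.
  have e v : teval (id_triple K) v = v by apply/rowP => j; rewrite mxE tnth_id mevalXU.
  by exists (vp p); rewrite e vp_neq0 -vpE.
by split; exists S => p pC pS; exists p => //; split=> //; apply: fix_p.
Qed.

End BirWords.

(** * Free products of groups of order two *)

Section FreeInvolutions.
Local Open Scope group_scope.
Variables (I : eqType) (G : groupType) (s : I -> G).
Hypothesis ss : forall i, s i * s i = 1.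
Local Notation H := (fun i => generated (eq (s i))).
Implicit Types (l : seq I) (u v w : seq (I * G)).

Definition letters l : seq (I * G) := [seq (i, s i) | i <- l].

Lemma invg_s i : (s i)^-1 = s i.
Proof. by rewrite -[LHS]mulg1 -(ss i) mulgA mulVg mul1g. Qed.

Lemma generated_s i x : H i x -> x = 1 \/ x = s i.
Proof.
elim=> [y <-||y z _ [->|->] _ [->|->]|y _ [->|->]]; rewrite ?mulg1 ?mul1g ?invg1 ?ss ?invg_s; by auto.
Qed.

Lemma fp_word_cons a w : fp_word H (a :: w) <-> H a.1 a.2 /\ fp_word H w.
Proof.
split=> [h|[ha hw] b].
  by split=> [|b bw]; apply: h; rewrite ?mem_head // inE bw orbT.
by rewrite inE => /orP[/eqP->|/hw].
Qed.

Lemma fp_word_cat u v : fp_word H u -> fp_word H v -> fp_word H (u ++ v).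
Proof. by move=> hu hv a; rewrite mem_cat => /orP[/hu|/hv]. Qed.

Lemma fp_eval_cat u v : fp_eval (u ++ v) = fp_eval u * fp_eval v.
Proof. exact: big_cat. Qed.

Lemma fp_eq_eval u v : fp_eq H u v -> fp_eval u = fp_eval v.
Proof.
elim=> // [u1 u2 u3 _ -> _ -> //|u1 u1' v1 v1' _ e1 _ e2|i|i x y _ _].
- by rewrite !fp_eval_cat e1 e2.
- by rewrite /fp_eval big_cons !big_nil mulg1.
- by rewrite /fp_eval !big_cons !big_nil !mulg1.
Qed.

Lemma reduced_word u : fp_word H u ->
  exists2 l, sorted (fun i j => i != j) l & fp_eq H u (letters l).
Proof.
elim: u => [_|[i x] u IH /fp_word_cons[/= hx /IH[l sl e]]].
  by exists [::] => //; apply: fp_eq_refl.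
have cons_e y : fp_eq H ((i, y) :: u) ((i, y) :: letters l).
  by apply: (@fp_eq_cat _ _ _ [:: _] [:: _]) => //; apply: fp_eq_refl.
have [->|->] := generated_s hx.
  exists l => //; apply: fp_eq_trans (cons_e 1) _.
  by apply: (@fp_eq_cat _ _ _ [:: _] [::]); [apply: fp_eq_one|apply: fp_eq_refl].
case: l sl e cons_e => [|j l] sl e cons_e; first by exists [:: i] => //; apply: cons_e.
have [ij|ij] := eqVneq i j; last first.
  by exists [:: i, j & l]; rewrite /= ?ij //; apply: cons_e.
exists l; first exact: path_sorted sl.
apply: fp_eq_trans (cons_e (s i)) _; rewrite -ij.
apply: (@fp_eq_cat _ _ _ [:: (i, s i); (i, s i)] [::] (letters l)); last exact: fp_eq_refl.
apply: fp_eq_trans (fp_eq_one _ i).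
by rewrite -(ss i); apply: fp_eq_mul; apply: generated_in.
Qed.

Definition fp_inv u : seq (I * G) := rev [seq (a.1, a.2^-1) | a <- u].

Lemma fp_inv_word u : fp_word H u -> fp_word H (fp_inv u).
Proof.
move=> hu a; rewrite mem_rev => /mapP[b bu ->]; exact: generated_V (hu b bu).
Qed.

Lemma fp_inv_eval u : fp_eval (fp_inv u) = (fp_eval u)^-1.
Proof.
rewrite /fp_eval /fp_inv; elim: u => [|a u IH].
  by rewrite /rev /= !big_nil invg1.
by rewrite /= rev_cons -cats1 big_cat /= IH !big_cons big_nil mulg1 invgM.
Qed.

Lemma fp_inv_eq u : fp_word H u -> fp_eq H (fp_inv u ++ u) [::].
Proof.
elim: u => [_|[i x] u IH /fp_word_cons[/= hx hu]]; first exact: fp_eq_refl.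
rewrite /fp_inv /= rev_cons -cats1 -catA /=.
apply: fp_eq_trans (IH hu); apply: fp_eq_cat; first exact: fp_eq_refl.
apply: (@fp_eq_cat _ _ _ [:: (i, x^-1); (i, x)] [::] u); last exact: fp_eq_refl.
apply: fp_eq_trans (fp_eq_one _ i); rewrite -(mulVg x); apply: fp_eq_mul => //.
exact: generated_V.
Qed.

Lemma generated_letters g : generated (fun g => exists i, g = s i) g <->
  exists l, g = \prod_(i <- l) s i.
Proof.
split.
  elim=> [x [i ->]||x y _ [l ->] _ [l' ->]|x _ [l ->]].
  - by exists [:: i]; rewrite big_seq1.
  - by exists [::]; rewrite big_nil.
  - by exists (l ++ l'); rewrite big_cat.
  exists (rev l); elim: l => [|i l IH]; first by rewrite !big_nil invg1.
  by rewrite big_cons invgM IH rev_cons -cats1 big_cat big_seq1 invg_s.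
case=> l ->; elim: l => [|i l IH]; first by rewrite big_nil; apply: generated_1.
by rewrite big_cons; apply: generated_M => //; apply: generated_in; exists i.
Qed.

Lemma fp_eval_letters l : fp_eval (letters l) = \prod_(i <- l) s i.
Proof. by rewrite /fp_eval big_map. Qed.

Lemma letters_word l : fp_word H (letters l).
Proof. by move=> a /mapP[i _ ->]; apply: generated_in. Qed.

Lemma free_product_involutions :
  (forall l, l != [::] -> sorted (fun i j => i != j) l -> \prod_(i <- l) s i <> 1) ->
  is_free_product H (generated (fun g => exists i, g = s i)).
Proof.
move=> red; split=> [g|u v hu hv].
  rewrite generated_letters; split=> [[l ->]|[w hw <-]].
    by exists (letters l); [apply: letters_word|apply: fp_eval_letters].
  have [l _ /fp_eq_eval ->] := reduced_word hw.
  by exists l; rewrite fp_eval_letters.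
split=> [|e]; first exact: fp_eq_eval.
(* The word [u] followed by the inverse of [v] evaluates to 1, so its reduced form is empty; then
   [u], equivalent to that word followed by [v], is equivalent to [v]. *)
have [l sl el] := reduced_word (fp_word_cat hu (fp_inv_word hv)).
have l0 : l = [::].
  apply/eqP; apply: contraT => l0; case: (red l l0 sl).
  by rewrite -fp_eval_letters -(fp_eq_eval el) fp_eval_cat fp_inv_eval e mulgV.
rewrite l0 in el; rewrite -[u]cats0.
apply: fp_eq_trans (fp_eq_cat (fp_eq_refl _ u) (fp_eq_sym (fp_inv_eq hv))) _.
rewrite catA -{3}[v]cat0s; apply: fp_eq_cat => //; exact: fp_eq_refl.
Qed.

End FreeInvolutions.

Theorem theorem6 (K : closedFieldType) (charK : 2%N \notin [pchar K])
    (F : {mpoly K[3]}) (smoothF : smooth_cubic F) :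
  (forall p : point K, p \in curve F -> exists! s : Bir K, cubic_involution F p s)
  /\ forall sigma : {p : point K | p \in curve F} -> Bir K,
     (forall p, cubic_involution F (val p) (sigma p)) ->
     let S := generated (fun g : Bir K => exists p, g = sigma p) in
     [/\ forall g, S g -> inertia F g,
         forall p, sigma p <> 1%g /\ (sigma p ^+ 2)%g = 1%g
       & is_free_product (fun p => generated (eq (sigma p))) S].
Proof.
have K2 : 2%:R != 0 :> K by apply: contra charK => /eqP h; rewrite inE /= h eqxx.
have [homF singF] := smoothF; have [c FE] := cubic_tensor homF; subst F.
have smooth_c (v : 'rV[K]_3) : v != 0 -> cub c v = 0 -> exists w, polar c v w != 0.
  move=> v0 Fv; have [|i] := singF v v0; first by rewrite meval_cub.
  by rewrite meval_mderiv => h; exists (delta_mx 0 i).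
split=> [p pC|sigma sigmaP S].
  exists (sigma_at K2 smooth_c pC); split; first exact: cubic_involution_sigma.
  by move=> s /(cubic_involution_unique K2 smooth_c pC).
have sigmaE p : sigma p = (\pi_(Bir K) (sigma_pair K2 smooth_c p))%qT.
  exact: (cubic_involution_unique K2 smooth_c (valP p)).
have ss p : (sigma p * sigma p)%g = 1%g by rewrite sigmaE; apply: sigma_sqr.
have prodE l : (\prod_(p <- l) sigma p)%g = (\pi_(Bir K) (word_pair K2 smooth_c l))%qT.
  by rewrite pi_word; apply: eq_bigr => p _.
have red l : l != [::] -> sorted (fun i j => i != j) l -> (\prod_(p <- l) sigma p)%g <> 1%g.
  by move=> l0 sl; rewrite prodE; apply: word_neq1.
split.
- by move=> g /(generated_letters ss)[l ->]; rewrite prodE; apply: word_inertia.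
- move=> p; split; last by rewrite expgS expg1 ss.
  by have := red [:: p] isT isT; rewrite big_seq1.
- exact: free_product_involutions.
Qed.
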